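(* Let $n\geq2$ and $\alpha\in[0,1)$. Let $d_1(\alpha)=1$ if $\alpha\in[0,\frac12]$ and $d_1(\alpha)=\frac{1-\alpha}{\alpha}$ if $\alpha\in(\frac12,1)$. (i) Let $f=(f_1,\dots,f_n)\in S_\alpha^0(\mathbb{B}^n)$, where $\mathbb{B}^n$ is the Euclidean unit ball of $\mathbb{C}^n$. Then $$\left|\frac12\frac{\partial^2f_i}{\partial z_j^2}(0)\right|\leq\frac{3\sqrt3}{2}d_1(\alpha)\quad\text{for }1\leq i\neq j\leq n.$$ These estimates are sharp for all $i\neq j$ (equality is attained by some element of $S_\alpha^0(\mathbb{B}^n)$). (ii) For either choice of sign, let $\widetilde\Phi_{i,j}^\alpha:\mathbb{B}^n\to\mathbb{C}^n$ be given by $$\widetilde\Phi_{i,j}^\alpha(z)=z\pm\frac{3\sqrt3}{2}d_1(\alpha)z_j^2e_i,\quad z=(z_1,\dots,z_n)\in\mathbb{B}^n,$$ for $1\leq i\neq j\leq n$. Then $\widetilde\Phi_{i,j}^\alpha\in S_\alpha^*(\mathbb{B}^n)$, and thus $\widetilde\Phi_{i,j}^\alpha\in S_\alpha^0(\mathbb{B}^n)$, for $1\leq i\neq j\leq n$. (iii) $\widetilde\Phi_{i,j}^\alpha\in S_\alpha^*(\mathbb{B}^n)$ are bounded support points for the family $S_\alpha^0(\mathbb{B}^n)$ and also bounded support points for the family $S_\alpha^*(\mathbb{B}^n)$, for $1\leq i\neq j\leq n$.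
   Context: $\mathbb{U}$ is the open unit disc in $\mathbb{C}$; $e_1,\dots,e_n$ is the standard basis of $\mathbb{C}^n$, $\|\cdot\|$ the Euclidean norm. $H(\mathbb{B}^n)$ is the space of holomorphic maps $\mathbb{B}^n\to\mathbb{C}^n$ with locally uniform convergence; $f$ is normalized if $f(0)=0$, $Df(0)=I$. For $z\neq0$, $T(z)=\{l_z\in L(\mathbb{C}^n,\mathbb{C}):\|l_z\|=1,\ l_z(z)=\|z\|\}$ (for the Euclidean norm, $l_z=\langle\cdot,z\rangle/\|z\|$). $\mathcal{M}(\mathbb{B}^n)$ is the set of normalized $h\in H(\mathbb{B}^n)$ with $\Re l_z(h(z))>0$ for all $z\in\mathbb{B}^n\setminus\{0\}$, $l_z\in T(z)$. For a univalent $g:\mathbb{U}\to\mathbb{C}$ with $g(0)=1$, $\Re g>0$, $\mathcal{M}_g(\mathbb{B}^n)$ is the set of normalized $h\in H(\mathbb{B}^n)$ with $\frac1{\|z\|}l_z(h(z))\in g(\mathbb{U})$ for all $z\in\mathbb{B}^n\setminus\{0\}$, $l_z\in T(z)$. $S_g^*(\mathbb{B}^n)$ is the set of normalized locally biholomorphic $f\in H(\mathbb{B}^n)$ such that $z\mapsto[Df(z)]^{-1}f(z)$ belongs to $\mathcal{M}_g(\mathbb{B}^n)$. A Herglotz vector field is $h:\mathbb{B}^n\times[0,\infty)\to\mathbb{C}^n$ with $h(\cdot,t)\in\mathcal{M}(\mathbb{B}^n)$ for all $t\ge0$ and $h(z,\cdot)$ measurable for all $z$. $S_g^0(\mathbb{B}^n)$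 is the set of normalized $f\in H(\mathbb{B}^n)$ for which there is a Herglotz vector field $h$ with $h(\cdot,t)\in\mathcal{M}_g(\mathbb{B}^n)$ for a.e. $t\ge0$ and $f(z)=\lim_{t\to\infty}e^tv(z,t)$ locally uniformly on $\mathbb{B}^n$, where $v(z,\cdot)$ is the unique locally Lipschitz solution on $[0,\infty)$ of $\frac{\partial v}{\partial t}=-h(v,t)$ for a.e. $t\ge0$, $v(z,0)=z$. $S_\alpha^0(\mathbb{B}^n)$ and $S_\alpha^*(\mathbb{B}^n)$ denote $S_g^0(\mathbb{B}^n)$ and $S_g^*(\mathbb{B}^n)$ with $g(\zeta)=\frac{1-\zeta}{1+(1-2\alpha)\zeta}$. A support point of $E\subseteq H(\mathbb{B}^n)$ is $f\in E$ for which there is a continuous linear functional $\Lambda:H(\mathbb{B}^n)\to\mathbb{C}$ with $\Re\Lambda|_E$ not constant and $\Re\Lambda(f)=\max_{q\in E}\Re\Lambda(q)$. A support point is bounded if it is a bounded mapping on $\mathbb{B}^n$. *)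

(* Defs.v *)
From HB Require Import structures.
From mathcomp Require Import all_boot all_order all_algebra.
From mathcomp Require Import complex.
From mathcomp Require Import all_classical all_reals all_analysis.
From mathcomp Require Import measurable_realfun.

Import Order.TTheory GRing.Theory Num.Theory.
Import numFieldNormedType.Exports.

Local Open Scope classical_set_scope.
Local Open Scope complex_scope.
Local Open Scope ring_scope.

(* Same copies as the library makes for abstract numeric fields, which do not
   fire on the concrete type R[i]. *)
HB.instance Definition _ (R : realType) := GRing.ComAlgebra.copy R[i] R[i]^o.
HB.instance Definition _ (R : realType) := Vector.copy R[i] R[i]^o.
HB.instance Definition _ (R : realType) :=
  PseudoPointedMetric.copy R[i] R[i]^o.
HB.instance Definition _ (R : realType) := NormedModule.copy R[i] R[i]^o.

(* C^n is 'rV[R[i]]_n.  Its library norm is the sup norm: it is only used for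
   the topology (hence for differentiability), the Euclidean norm being
   [enorm].  Maps on the ball are represented by total functions whose values
   outside the ball are irrelevant. *)

Definition cmod {R : realType} (x : R[i]) : R := complex.Re `|x|.

Definition enorm {R : realType} {n : nat} (z : 'rV[R[i]]_n) : R :=
  Num.sqrt (\sum_(i < n) cmod (z 0 i) ^+ 2).

Definition eball {R : realType} (n : nat) : set 'rV[R[i]]_n :=
  [set z | enorm z < 1].

Definition udisc {R : realType} : set R[i] := [set x | cmod x < 1].

(* Frechet differentiability over the field R[i]. *)
Definition holomorphic_on {R : realType} {n : nat} (A : set 'rV[R[i]]_n)
    (f : 'rV[R[i]]_n -> 'rV[R[i]]_n) : Prop :=
  forall z, A z -> differentiable f z.

Definition hol {R : realType} (n : nat) :
    set ('rV[R[i]]_n -> 'rV[R[i]]_n) :=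
  [set f | holomorphic_on (eball n) f].

(* On the locally compact ball, locally uniform convergence is uniform
   convergence on the compact subsets of the ball. *)
Definition ball_compact {R : realType} (n : nat) : set (set 'rV[R[i]]_n) :=
  [set K | compact K /\ K `<=` eball n].

Definition normalized {R : realType} {n : nat}
    (f : 'rV[R[i]]_n -> 'rV[R[i]]_n) : Prop :=
  f 0 = 0 /\ forall v, 'd f 0 v = v.

(* Linear forms on C^n are automatically continuous. *)
Definition opnorm {R : realType} {n : nat}
    (l : {linear 'rV[R[i]]_n -> R[i]}) : R :=
  sup [set cmod (l w) | w in [set w | enorm w <= 1]].

Definition supporting {R : realType} {n : nat} (z : 'rV[R[i]]_n) :
    set {linear 'rV[R[i]]_n -> R[i]} :=
  [set l | opnorm l = 1 /\ l z = (enorm z)%:C].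

Definition classM {R : realType} (n : nat) :
    set ('rV[R[i]]_n -> 'rV[R[i]]_n) :=
  [set h | [/\ hol n h, normalized h &
     forall z l, eball n z -> z != 0 -> supporting z l ->
       0 < complex.Re (l (h z))]].

Definition classMg {R : realType} (n : nat) (g : R[i] -> R[i]) :
    set ('rV[R[i]]_n -> 'rV[R[i]]_n) :=
  [set h | [/\ hol n h, normalized h &
     forall z l, eball n z -> z != 0 -> supporting z l ->
       (g @` udisc) (((enorm z)^-1)%:C * l (h z))]].

Definition locally_biholomorphic {R : realType} {n : nat}
    (f : 'rV[R[i]]_n -> 'rV[R[i]]_n) : Prop :=
  forall z, eball n z ->
  exists U, exists k : 'rV[R[i]]_n -> 'rV[R[i]]_n,
    [/\ open U, U z & U `<=` eball n] /\
    [/\ open (f @` U), holomorphic_on U f, holomorphic_on (f @` U) k &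
        forall w, U w -> k (f w) = w].

(* ['J f z] acts on row vectors on the right, so [Df(z)]^-1 w is
   [w *m invmx ('J f z)]. *)
Definition starlike_g {R : realType} (n : nat) (g : R[i] -> R[i]) :
    set ('rV[R[i]]_n -> 'rV[R[i]]_n) :=
  [set f | [/\ hol n f, normalized f, locally_biholomorphic f &
     classMg n g (fun z => f z *m invmx ('J f z))]].

(* Measurability is Lebesgue (not only Borel) measurability on [0, +oo[. *)
Definition Lebesgue_measurable_on_pos {R : realType} {n : nat}
    (u : R -> 'rV[R[i]]_n) : Prop :=
  forall U : set 'rV[R[i]]_n, open U ->
    (completed_algebra_gen (@lebesgue_measure R)).-sigma.-measurable
      (`[0, +oo[ `&` u @^-1` U).

Definition herglotz {R : realType} {n : nat}
    (h : 'rV[R[i]]_n -> R -> 'rV[R[i]]_n) : Prop :=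
  (forall t, 0 <= t -> classM n (h ^~ t)) /\
  (forall z, eball n z -> Lebesgue_measurable_on_pos (h z)).

Definition locally_lipschitz_pos {R : realType} {n : nat}
    (u : R -> 'rV[R[i]]_n) : Prop :=
  forall t, 0 <= t -> exists e, exists L, 0 < e /\
    forall s1 s2, 0 <= s1 -> 0 <= s2 -> `|s1 - t| < e -> `|s2 - t| < e ->
      enorm (u s1 - u s2) <= L * `|s1 - s2|.

(* The time derivative is written as a limit of difference quotients since
   'rV[R[i]]_n is a normed module over R[i] but not over R. *)
Definition loewner_solution {R : realType} {n : nat}
    (h : 'rV[R[i]]_n -> R -> 'rV[R[i]]_n) (z : 'rV[R[i]]_n)
    (u : R -> 'rV[R[i]]_n) : Prop :=
  [/\ forall t, 0 <= t -> eball n (u t),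
      locally_lipschitz_pos u,
      u 0 = z &
      {ae @lebesgue_measure R, forall t, 0 <= t ->
        (r^-1)%:C *: (u (t + r) - u t) @[r --> 0^'] --> - h (u t) t}].

Definition parametric_g {R : realType} (n : nat) (g : R[i] -> R[i]) :
    set ('rV[R[i]]_n -> 'rV[R[i]]_n) :=
  [set f | [/\ hol n f, normalized f &
     exists h v, [/\ herglotz h,
       {ae @lebesgue_measure R, forall t, 0 <= t -> classMg n g (h ^~ t)},
       forall z, eball n z -> loewner_solution h z (v z) &
       {family @ball_compact R n,
         (fun t z => (expR t)%:C *: v z t) @ +oo --> f}]]].

Definition g_alpha {R : realType} (alpha : R) (x : R[i]) : R[i] :=
  (1 - x) / (1 + (1 - 2 * alpha)%:C * x).

Definition Salpha0 {R : realType} (n : nat) (alpha : R) :=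
  parametric_g n (g_alpha alpha).

Definition Salpha_star {R : realType} (n : nat) (alpha : R) :=
  starlike_g n (g_alpha alpha).

(* Continuous linear functionals on H(B^n).  The locally uniform topology does
   not see the values outside the ball, so that continuity on [hol n] forces
   [Lam f] to depend only on the restriction of f to the ball. *)
Definition continuous_functional {R : realType} {n : nat}
    (Lam : ('rV[R[i]]_n -> 'rV[R[i]]_n) -> R[i]) : Prop :=
  (forall (a : R[i]) f g, hol n f -> hol n g ->
     Lam (a *: f + g) = a * Lam f + Lam g) /\
  {within (hol n : set {family @ball_compact R n, _ -> _}),
    continuous (Lam : {family @ball_compact R n, _ -> _} -> R[i])}.

Definition support_point {R : realType} {n : nat}
    (E : set ('rV[R[i]]_n -> 'rV[R[i]]_n))
    (f : 'rV[R[i]]_n -> 'rV[R[i]]_n) : Prop :=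
  E f /\ exists Lam : ('rV[R[i]]_n -> 'rV[R[i]]_n) -> R[i],
    [/\ continuous_functional Lam,
        ~ (exists c : R, forall q, E q -> complex.Re (Lam q) = c) &
        forall q, E q -> complex.Re (Lam q) <= complex.Re (Lam f)].

Definition bounded_on_ball {R : realType} {n : nat}
    (f : 'rV[R[i]]_n -> 'rV[R[i]]_n) : Prop :=
  exists M : R, forall z, eball n z -> enorm (f z) <= M.

Definition bounded_support_point {R : realType} {n : nat}
    (E : set ('rV[R[i]]_n -> 'rV[R[i]]_n))
    (f : 'rV[R[i]]_n -> 'rV[R[i]]_n) : Prop :=
  support_point E f /\ bounded_on_ball f.

Definition d1 {R : realType} (alpha : R) : R :=
  if alpha <= 2^-1 then 1 else (1 - alpha) / alpha.

(* [neg] selects the minus sign. *)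
Definition Phi {R : realType} {n : nat} (alpha : R) (neg : bool)
    (i j : 'I_n) (z : 'rV[R[i]]_n) : 'rV[R[i]]_n :=
  z + ((-1) ^+ neg * (3 * Num.sqrt 3 / 2 * d1 alpha)%:C * z 0 j ^+ 2)
        *: delta_mx 0 i.

(* Main.v *)
(* Write q for the coefficient of z_j^2 in the i-th component of a map h in M_g.  Put z = a l^2 c e_i + b l e_j with a^2 + b^2 = 1, |c| = 1 and let l run over a circle |l| = r.  On it <h(z), z> is the boundary value of a holomorphic function of l whose value at 0 involves only a, b and q.  Since alpha |W|^2 < Re W for W = <h(z), z> / |z|^2, taking means and letting r tend to 1 gives |a b^2 q| <= d_1(alpha), and the best choice a^2 = 1/3 gives |q| <= (3 sqrt 3 / 2) d_1(alpha).  A starlike f satisfies Df(z) h(z) = f(z), so its coefficient is - q.  For f in S_alpha^0 the rescaled flow w = e^t v issued from z = rho e_j stays O(rho^2)-close to z and moves along e_i with speed at most (|q_t| rho^2 + O(rho^3)) e^(-t), so that |f_i(rho e_j)| <= sup |q_t| rho^2 + O(rho^3).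
   The shear z + c z_j^2 e_i has inverse z - c z_j^2 e_i, which is also its field [Df]^-1 f.  As a b^2 <= 2 / (3 sqrt 3) on the unit sphere, this field lies in M_g when |c| <= (3 sqrt 3 / 2) d_1(alpha), and its flow is explicit.  The functional extracting the coefficient is continuous by Cauchy's estimates, and the shear maximizes it. *)
Require Import Defs.
From HB Require Import structures.
From mathcomp Require Import all_boot all_order all_algebra.
From mathcomp Require Import complex.
From mathcomp Require Import all_classical all_reals all_analysis.
From mathcomp Require Import measurable_realfun.
From mathcomp Require Import ring lra.
Set Implicit Arguments.
Unset Strict Implicit.
Unset Printing Implicit Defensive.
Import Order.TTheory GRing.Theory Num.Theory.
Import numFieldNormedType.Exports.
Local Open Scope classical_set_scope.
Local Open Scope complex_scope.
Local Open Scope ring_scope.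

Local Notation Re := (@complex.Re _).
Local Notation Im := (@complex.Im _).

(* [lra] fails when an equation over [R[i]] is in the context. *)
Ltac rlra := repeat match goal with
  H : @eq _ ?a _ |- _ => let _ := constr:(a : complex _) in clear H end; lra.

(** The constant [d_1(alpha)] is a distance. The image of the disc under [g_alpha] is the set
    [alpha |w|^2 < Re w]: a half-plane if [alpha = 0], otherwise the disc with diameter from [0] to
    [1 / alpha]. The point [1] lies at distance [min(1, 1 / alpha - 1) = d_1(alpha)] from its
    boundary. The shears qualify because their [W] stays closer to [1] than that. The obstacle in
    the Loewner part is that the field is only measurable in time and the orbits only locally
    Lipschitz. Time integration is therefore replaced by a monotonicity argument for derivatives
    known almost everywhere, and every error term has to be uniform in time. This uniformity rests
    on a bound near the origin shared by the whole class [M]. The one-variable theory is drawn from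
    one comparison between the centre and a circle. It yields Cauchy estimates with constants that
    are not sharp; this does no harm, since they only enter error terms of higher order. For the
    shears, invariance of the ball under the flow is an explicit polynomial inequality. *)

Lemma normrC (R : realType) (x : R[i]) : `|x| = (cmod x)%:C.
Proof. by rewrite /cmod normc_def. Qed.

Lemma cmodE (R : realType) (x : R[i]) : cmod x = Num.sqrt (Re x ^+ 2 + Im x ^+ 2).
Proof. by rewrite /cmod normc_def. Qed.

Lemma cmod_ge0 (R : realType) (x : R[i]) : 0 <= cmod x.
Proof. by rewrite cmodE sqrtr_ge0. Qed.
#[local] Hint Extern 0 (is_true _) => (lazymatch goal with |- is_true (@Order.le _ _ _ (@cmod _ _)) => exact: cmod_ge0 end) : core.

Lemma cmod_sqr (R : realType) (x : R[i]) : cmod x ^+ 2 = Re x ^+ 2 + Im x ^+ 2.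
Proof. by rewrite cmodE sqr_sqrtr // addr_ge0 ?sqr_ge0. Qed.

Lemma cmodM (R : realType) (x y : R[i]) : cmod (x * y) = cmod x * cmod y.
Proof. by apply: complexI; rewrite rmorphM /= -!normrC normrM. Qed.

Lemma cmodN (R : realType) (x : R[i]) : cmod (- x) = cmod x.
Proof. by rewrite /cmod normrN. Qed.

Lemma cmodBC (R : realType) (x y : R[i]) : cmod (x - y) = cmod (y - x).
Proof. by rewrite /cmod distrC. Qed.

Lemma cmodD (R : realType) (x y : R[i]) : cmod (x + y) <= cmod x + cmod y.
Proof. by rewrite -lecR rmorphD /= -!normrC ler_normD. Qed.

Lemma cmodB (R : realType) (x y : R[i]) : cmod (x - y) <= cmod x + cmod y.
Proof. by rewrite -(cmodN y) cmodD. Qed.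

Lemma cmodBD (R : realType) (x y z : R[i]) : cmod (x - z) <= cmod (x - y) + cmod (y - z).
Proof. by rewrite (_ : x - z = (x - y) + (y - z)) ?cmodD //; ring. Qed.

Lemma cmod0 (R : realType) : cmod (0 : R[i]) = 0.
Proof. by rewrite /cmod normr0. Qed.

Lemma cmod1 (R : realType) : cmod (1 : R[i]) = 1.
Proof. by rewrite /cmod normr1. Qed.

Lemma cmodR (R : realType) (a : R) : cmod a%:C = `|a|.
Proof. by rewrite cmodE /= expr0n /= addr0 sqrtr_sqr. Qed.

Lemma cmodV (R : realType) (x : R[i]) : cmod x^-1 = (cmod x)^-1.
Proof. by apply: complexI; rewrite fmorphV -!normrC normfV. Qed.

Lemma cmodX (R : realType) (x : R[i]) n : cmod (x ^+ n) = cmod x ^+ n.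
Proof. by apply: complexI; rewrite rmorphXn /= -!normrC normrX. Qed.

Lemma cmod_eq0 (R : realType) (x : R[i]) : (cmod x == 0) = (x == 0).
Proof. by rewrite -(inj_eq (@complexI R)) -normrC normr_eq0. Qed.

Lemma cmod_gt0 (R : realType) (x : R[i]) : (0 < cmod x) = (x != 0).
Proof. by rewrite lt0r cmod_eq0 cmod_ge0 andbT. Qed.

Lemma cmodJ (R : realType) (x : R[i]) : cmod x^*%C = cmod x.
Proof. by rewrite !cmodE; case: x => a b /=; rewrite sqrrN. Qed.

Lemma mulcJ (R : realType) (x : R[i]) : x * x^*%C = (cmod x ^+ 2)%:C.
Proof.
rewrite cmod_sqr; case: x => a b /=; apply/eqP; rewrite eq_complex /=.
by apply/andP; split; apply/eqP; ring.
Qed.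

Lemma ReD (R : realType) (x y : R[i]) : Re (x + y) = Re x + Re y.
Proof. by case: x y => [a b] [c d]. Qed.
Lemma ImD (R : realType) (x y : R[i]) : Im (x + y) = Im x + Im y.
Proof. by case: x y => [a b] [c d]. Qed.
Lemma ReN (R : realType) (x : R[i]) : Re (- x) = - Re x.
Proof. by case: x. Qed.
Lemma ImN (R : realType) (x : R[i]) : Im (- x) = - Im x.
Proof. by case: x. Qed.
Lemma ReM (R : realType) (x y : R[i]) : Re (x * y) = Re x * Re y - Im x * Im y.
Proof. by case: x y => [a b] [c d]. Qed.
Lemma ImM (R : realType) (x y : R[i]) : Im (x * y) = Re x * Im y + Im x * Re y.
Proof. by case: x y => [a b] [c d]. Qed.
Lemma ReZ (R : realType) (a : R) (x : R[i]) : Re (a%:C * x) = a * Re x.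
Proof. by rewrite ReM /= mul0r subr0. Qed.
Lemma ImZ (R : realType) (a : R) (x : R[i]) : Im (a%:C * x) = a * Im x.
Proof. by rewrite ImM /= mul0r addr0. Qed.
Lemma ReJ (R : realType) (x : R[i]) : Re x^*%C = Re x.
Proof. by case: x. Qed.
Lemma ImJ (R : realType) (x : R[i]) : Im x^*%C = - Im x.
Proof. by case: x. Qed.
Lemma complex_ext (R : realType) (x y : R[i]) : Re x = Re y -> Im x = Im y -> x = y.
Proof. by case: x y => [a b] [c d] /= -> ->. Qed.

Lemma norm_Re (R : realType) (x : R[i]) : `|Re x| <= cmod x.
Proof. by rewrite cmodE -sqrtr_sqr ler_sqrt ?lerDl ?sqr_ge0 ?addr_ge0 ?sqr_ge0. Qed.

Lemma norm_Im (R : realType) (x : R[i]) : `|Im x| <= cmod x.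
Proof. by rewrite cmodE -sqrtr_sqr ler_sqrt ?lerDr ?sqr_ge0 ?addr_ge0 ?sqr_ge0. Qed.

Lemma Re_le (R : realType) (x : R[i]) : Re x <= cmod x.
Proof. exact: le_trans (ler_norm _) (norm_Re x). Qed.

Lemma cmod_le_ReIm (R : realType) (x : R[i]) : cmod x <= `|Re x| + `|Im x|.
Proof.
rewrite -[leRHS]ger0_norm ?addr_ge0 // -sqrtr_sqr cmodE ler_sqrt ?sqr_ge0 //.
rewrite sqrrD !real_normK ?num_real //.
by rewrite lerD2r lerDl mulrn_wge0 ?mulr_ge0.
Qed.

(** Bounds on a modulus are reduced to bounds on a real part by such a rotation; for [x != 0] it is
    the conjugate of [x] divided by [cmod x]. *)
Lemma phaseP (R : realType) (x : R[i]) :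
  exists c : R[i], cmod c = 1 /\ Re (c * x) = cmod x.
Proof.
have [->|x0] := eqVneq x 0; first by exists 1; rewrite mulr0 cmod0 cmod1.
have mx0 : cmod x != 0 by rewrite cmod_eq0.
exists (((cmod x)^-1)%:C * x^*%C); split.
  rewrite cmodM cmodR cmodJ ger0_norm ?invr_ge0 // mulVf //.
by rewrite -mulrA (mulrC _ x) mulcJ ReZ /= expr2 mulKf.
Qed.

(** * Complex derivatives *)

(** Here and in [cdif] the tolerances and the modulus are real, so that estimates become
    inequalities over the ordered field [R]. The derivative is an argument of [cdif], a relation
    rather than a chosen value. *)
Definition ccont (R : realType) (f : R[i] -> R[i]) (z : R[i]) : Prop :=
  forall e : R, 0 < e -> exists2 d : R, 0 < d &
    forall w, cmod (w - z) < d -> cmod (f w - f z) <= e.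

Definition cdif (R : realType) (f : R[i] -> R[i]) (z l : R[i]) : Prop :=
  forall e : R, 0 < e -> exists2 d : R, 0 < d &
    forall w, cmod (w - z) < d -> cmod (f w - f z - l * (w - z)) <= e * cmod (w - z).

Lemma ccont_id (R : realType) (z : R[i]) : ccont id z.
Proof. by move=> e e0; exists e => // w /ltW. Qed.

Lemma ccont_cst (R : realType) (c z : R[i]) : ccont (fun=> c) z.
Proof. by move=> e e0; exists 1 => // w _; rewrite subrr cmod0 ltW. Qed.

Lemma ccontD (R : realType) (f g : R[i] -> R[i]) z :
  ccont f z -> ccont g z -> ccont (fun w => f w + g w) z.
Proof.
move=> cf cg e e0; have e2 : 0 < e / 2 by lra.
have [d1 d10 h1] := cf _ e2; have [d2 d20 h2] := cg _ e2.
exists (Num.min d1 d2); first by rewrite lt_min d10.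
move=> w; rewrite lt_min => /andP[/h1 w1 /h2 w2].
rewrite (_ : _ - _ = (f w - f z) + (g w - g z)); last by ring.
by apply: le_trans (cmodD _ _) _; lra.
Qed.

Lemma ccontM (R : realType) (f g : R[i] -> R[i]) z :
  ccont f z -> ccont g z -> ccont (fun w => f w * g w) z.
Proof.
move=> cf cg e e0; pose A := cmod (f z); pose B := cmod (g z).
have AB : 0 < A + B + 1 by rewrite ltr_wpDl ?addr_ge0 /A /B.
pose e' := Num.min 1 (e / (A + B + 1)).
have e'0 : 0 < e' by rewrite lt_min ltr01 divr_gt0.
have e'1 : e' <= 1 by rewrite ge_min lexx.
have e'2 : e' * (A + B + 1) <= e by rewrite -ler_pdivlMr // ge_min lexx orbT.
have [d1 d10 h1] := cf _ e'0; have [d2 d20 h2] := cg _ e'0.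
exists (Num.min d1 d2); first by rewrite lt_min d10.
move=> w; rewrite lt_min => /andP[/h1 w1 /h2 w2].
rewrite (_ : _ - _ = (f w - f z) * (g w - g z) + f z * (g w - g z) + (f w - f z) * g z);
  last by ring.
apply: le_trans (cmodD _ _) _.
apply: le_trans (lerD (cmodD _ _) (lexx _)) _; rewrite !cmodM -/A -/B.
have := cmod_ge0 (f w - f z); have := cmod_ge0 (g w - g z).
have A0 : 0 <= A by rewrite /A. have B0 : 0 <= B by rewrite /B.
move: w1 w2; set x := cmod (f w - f z); set y := cmod (g w - g z) => xe ye y0 x0.
have h : x * y <= e' * 1 by apply: ler_pM => //; lra.
have h' : A * y <= A * e' by rewrite ler_wpM2l.
have h'' : x * B <= e' * B by rewrite ler_wpM2r.
lra.
Qed.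

Lemma ccontV (R : realType) (f : R[i] -> R[i]) z :
  ccont f z -> f z != 0 -> ccont (fun w => (f w)^-1) z.
Proof.
move=> cf fz0 e e0; pose A := cmod (f z).
have A0 : 0 < A by rewrite /A cmod_gt0.
pose e' := Num.min (A / 2) (e * (A ^+ 2 / 2)).
have e'0 : 0 < e' by rewrite lt_min; apply/andP; split; [lra| rewrite mulr_gt0 // divr_gt0 // exprn_gt0].
have [d d0 h] := cf _ e'0; exists d => // w /h; rewrite le_min => /andP[h1 h2].
have h3 : A / 2 <= cmod (f w).
  have := cmodBD (f z) (f w) 0; rewrite !subr0 -/A (cmodBC (f z)); lra.
have fw0 : f w != 0 by rewrite -cmod_gt0; lra.
rewrite (_ : _ - _ = - (f w - f z) / (f w * f z)); last first.
  by field; rewrite fz0.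
rewrite cmodM cmodN cmodV cmodM -/A ler_pdivrMr ?mulr_gt0 //; last lra.
apply: le_trans h2 _; rewrite ler_pM2l // expr2.
by have := ler_wpM2r (ltW A0) h3; lra.
Qed.

Lemma ccont_comp (R : realType) (f g : R[i] -> R[i]) z :
  ccont f z -> ccont g (f z) -> ccont (fun w => g (f w)) z.
Proof.
move=> cf cg e e0; have [d d0 h] := cg _ e0.
have [|d' d'0 h'] := cf (d / 2); first by lra.
by exists d' => // w /h' hw; apply: h; lra.
Qed.

Lemma ccont_ext (R : realType) (f g : R[i] -> R[i]) z r : 0 < r ->
  (forall w, cmod (w - z) < r -> f w = g w) -> ccont f z -> ccont g z.
Proof.
move=> r0 fg cf e e0; have [d d0 h] := cf _ e0.
exists (Num.min d r); first by rewrite lt_min d0.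
move=> w; rewrite lt_min => /andP[w1 w2].
by rewrite -!fg ?subrr ?cmod0 //; apply: h.
Qed.

(** Caratheodory's form of differentiability: the slope function extends continuously to [z]. Sums,
    products, inverses and compositions then only require algebra on continuous slope functions, and
    the slope function itself is what [cauchy_estimate] is applied to. *)
Lemma cdifP (R : realType) (f : R[i] -> R[i]) z l : cdif f z l <->
  exists phi, [/\ ccont phi z, phi z = l & forall w, f w = f z + phi w * (w - z)].
Proof.
split=> [df|[phi [cp pz fE]] e e0]; last first.
  have [d d0 h] := cp _ e0; exists d => // w /h hw.
  rewrite fE (_ : _ - _ = (phi w - phi z) * (w - z)); last by rewrite -pz; ring.
  by rewrite cmodM ler_wpM2r.
exists (fun w => if w == z then l else (f w - f z) / (w - z)); rewrite eqxx; split=> //.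
- move=> e e0; have [d d0 h] := df _ e0; exists d => // w /h; rewrite eqxx.
  case: eqVneq => [->|wz]; first by move=> _; rewrite subrr cmod0 ltW.
  have w0 : w - z != 0 by rewrite subr_eq0.
  rewrite (_ : f w - f z - _ = ((f w - f z) / (w - z) - l) * (w - z)).
    by rewrite cmodM ler_pM2r // cmod_gt0.
  by field.
- move=> w; case: eqVneq => [->|wz]; first by rewrite subrr mulr0 addr0.
  by field; rewrite subr_eq0.
Qed.

Lemma cdif_ccont (R : realType) (f : R[i] -> R[i]) z l : cdif f z l -> ccont f z.
Proof.
case/cdifP => phi [cp _ fE].
apply: (@ccont_ext _ (fun w => f z + phi w * (w - z)) _ _ 1) => //.
apply: ccontD; first exact: ccont_cst.
apply: ccontM => //; apply: ccontD; [exact: ccont_id|exact: ccont_cst].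
Qed.

Lemma cdif_ext (R : realType) (f g : R[i] -> R[i]) z l r : 0 < r ->
  (forall w, cmod (w - z) < r -> f w = g w) -> cdif f z l -> cdif g z l.
Proof.
move=> r0 fg cf e e0; have [d d0 h] := cf _ e0.
exists (Num.min d r); first by rewrite lt_min d0.
move=> w; rewrite lt_min => /andP[w1 w2].
by rewrite -!fg ?subrr ?cmod0 //; apply: h.
Qed.

Lemma cdif_cst (R : realType) (c z : R[i]) : cdif (fun=> c) z 0.
Proof. by move=> e e0; exists 1 => // w _; rewrite mul0r !subrr cmod0 mulr_ge0 // ltW. Qed.

Lemma cdif_id (R : realType) (z : R[i]) : cdif id z 1.
Proof. by move=> e e0; exists 1 => // w _; rewrite mul1r subrr cmod0 mulr_ge0 // ltW. Qed.

Lemma cdifD (R : realType) (f g : R[i] -> R[i]) z l m :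
  cdif f z l -> cdif g z m -> cdif (fun w => f w + g w) z (l + m).
Proof.
case/cdifP => p [cp pz fE] /cdifP[q [cq qz gE]]; apply/cdifP.
exists (fun w => p w + q w); split; [exact: ccontD|by rewrite pz qz|].
by move=> w; rewrite fE gE; ring.
Qed.

Lemma cdifM (R : realType) (f g : R[i] -> R[i]) z l m :
  cdif f z l -> cdif g z m -> cdif (fun w => f w * g w) z (l * g z + f z * m).
Proof.
move=> df dg; have cg := cdif_ccont dg; move: df dg.
case/cdifP => p [cp pz fE] /cdifP[q [cq qz gE]]; apply/cdifP.
exists (fun w => p w * g w + f z * q w); split.
- by apply: ccontD; apply: ccontM => //; exact: ccont_cst.
- by rewrite pz qz.
- by move=> w; rewrite fE [g w in LHS]gE [in RHS](gE w); ring.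
Qed.

Lemma cdifZ (R : realType) (f : R[i] -> R[i]) z l c :
  cdif f z l -> cdif (fun w => c * f w) z (c * l).
Proof. by move=> /(cdifM (cdif_cst c z)); rewrite mul0r add0r. Qed.

Lemma cdifN (R : realType) (f : R[i] -> R[i]) z l :
  cdif f z l -> cdif (fun w => - f w) z (- l).
Proof.
move=> /(@cdifZ _ _ _ _ (-1)); rewrite mulN1r; apply: cdif_ext ltr01 _ => w _.
exact: mulN1r.
Qed.

Lemma cdifB (R : realType) (f g : R[i] -> R[i]) z l m :
  cdif f z l -> cdif g z m -> cdif (fun w => f w - g w) z (l - m).
Proof. by move=> df dg; apply: cdifD => //; exact: cdifN. Qed.

Lemma cdifV (R : realType) (f : R[i] -> R[i]) z l :
  cdif f z l -> f z != 0 -> cdif (fun w => (f w)^-1) z (- l / f z ^+ 2).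
Proof.
move=> df fz0; have cf := cdif_ccont df.
have [d d0 h] : exists2 d : R, 0 < d & forall w, cmod (w - z) < d -> f w != 0.
  have A0 : 0 < cmod (f z) by rewrite cmod_gt0.
  have [|d d0 h] := cf (cmod (f z) / 2); first by lra.
  exists d => // w /h; rewrite -cmod_gt0 cmodBC => h1.
  by have := cmodBD (f z) (f w) 0; rewrite !subr0; lra.
case/cdifP: df => p [cp pz fE].
have : cdif (fun w => (f z)^-1 + (- p w / (f w * f z)) * (w - z)) z (- l / f z ^+ 2).
  apply/cdifP; exists (fun w => - p w / (f w * f z)); split.
  - apply: ccontM; first by apply: (@ccont_ext _ (fun w => -1 * p w) _ _ 1) => // [w _|];
      [exact: mulN1r|apply: ccontM => //; exact: ccont_cst].
    by apply: ccontV; [apply: ccontM => //; exact: ccont_cst|rewrite mulf_neq0].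
  - by rewrite pz expr2.
  - by move=> w; rewrite subrr mulr0 addr0.
apply: cdif_ext d0 _ => w /h fw0.
have {}fE : p w * (w - z) = f w - f z by rewrite fE; ring.
rewrite (_ : - p w / _ * _ = - (p w * (w - z)) / (f w * f z)); last by ring.
by rewrite fE; field; rewrite fw0.
Qed.

Lemma cdif_comp (R : realType) (f g : R[i] -> R[i]) z l m :
  cdif f z l -> cdif g (f z) m -> cdif (fun w => g (f w)) z (m * l).
Proof.
move=> df dg; have cf := cdif_ccont df; move: df dg.
case/cdifP => p [cp pz fE] /cdifP[q [cq qz gE]]; apply/cdifP.
exists (fun w => q (f w) * p w); split.
- by apply: ccontM => //; exact: ccont_comp.
- by rewrite pz qz.
- by move=> w; rewrite gE -mulrA; congr (_ + _ * _); rewrite fE; ring.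
Qed.

Lemma cdif_unique (R : realType) (f : R[i] -> R[i]) z l m :
  cdif f z l -> cdif f z m -> l = m.
Proof.
move=> dl dm; apply/eqP; rewrite -subr_eq0 -cmod_eq0 eq_le cmod_ge0 andbT.
apply/ler_addgt0Pr => e e0; rewrite add0r; have e2 : 0 < e / 2 by lra.
have [d1 d10 h1] := dl _ e2; have [d2 d20 h2] := dm _ e2.
pose d := Num.min d1 d2 / 2; have d0 : 0 < d by rewrite divr_gt0 // lt_min d10.
have dd : d < Num.min d1 d2 by rewrite /d; move: d0; rewrite /d; lra.
have E : z + d%:C - z = d%:C by ring.
have := h1 (z + d%:C); have := h2 (z + d%:C); rewrite E cmodR gtr0_norm //.
move: dd; rewrite lt_min => /andP[-> ->] /(_ isT) a /(_ isT) b.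
rewrite -(ler_pM2r d0) -[in cmod _ * d](gtr0_norm d0) -cmodR -cmodM.
set F := f _ - f z in a b.
rewrite (_ : (l - m) * _ = (F - m * d%:C) - (F - l * d%:C)); last by ring.
by apply: le_trans (cmodB _ _) _; lra.
Qed.

Lemma ccont_bounded (R : realType) (f : R[i] -> R[i]) z : ccont f z ->
  exists2 d : R, 0 < d & forall w, cmod (w - z) < d -> cmod (f w) <= cmod (f z) + 1.
Proof.
move=> /(_ 1 ltr01)[d d0 h]; exists d => // w /h.
by have := cmodBD (f w) (f z) 0; rewrite !subr0; lra.
Qed.

(** * Complex curves of a real variable: mean value inequalities and primitives *)

Definition rcont (R : realType) (f : R -> R[i]) (t : R) : Prop :=
  forall e : R, 0 < e -> exists2 d : R, 0 < d &
    forall s, `|s - t| < d -> cmod (f s - f t) <= e.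

Definition rdif (R : realType) (f : R -> R[i]) (t : R) (l : R[i]) : Prop :=
  forall e : R, 0 < e -> exists2 d : R, 0 < d &
    forall s, `|s - t| < d -> cmod (f s - f t - (s - t)%:C * l) <= e * `|s - t|.

Lemma rdif_rcont (R : realType) (f : R -> R[i]) t l : rdif f t l -> rcont f t.
Proof.
move=> df e e0; have [d d0 h] := df _ ltr01.
have L0 : 0 < cmod l + 1 by rewrite ltr_wpDl.
exists (Num.min d (e / (cmod l + 1))); first by rewrite lt_min d0 divr_gt0.
move=> s; rewrite lt_min ltr_pdivlMr // => /andP[/h h1 h2].
rewrite (_ : f s - f t = (f s - f t - (s - t)%:C * l) + (s - t)%:C * l); last by ring.
by apply: le_trans (cmodD _ _) _; rewrite cmodM cmodR; lra.
Qed.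

Lemma rdif_ext (R : realType) (f g : R -> R[i]) t l r : 0 < r ->
  (forall s, `|s - t| < r -> f s = g s) -> rdif f t l -> rdif g t l.
Proof.
move=> r0 fg df e e0; have [d d0 h] := df _ e0.
exists (Num.min d r); first by rewrite lt_min d0.
move=> s; rewrite lt_min => /andP[s1 s2].
by rewrite -!fg ?subrr ?normr0 //; apply: h.
Qed.

Lemma rdif_cst (R : realType) (c : R[i]) (t : R) : rdif (fun=> c) t 0.
Proof. by move=> e e0; exists 1 => // s _; rewrite mulr0 !subrr cmod0 mulr_ge0 // ltW. Qed.

Lemma rdif_lin (R : realType) (c : R[i]) (t : R) : rdif (fun s => s%:C * c) t c.
Proof.
move=> e e0; exists 1 => // s _; rewrite rmorphB -mulrBl subrr cmod0 mulr_ge0 // ltW //.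
Qed.

Lemma rdifD (R : realType) (f g : R -> R[i]) t l m :
  rdif f t l -> rdif g t m -> rdif (fun s => f s + g s) t (l + m).
Proof.
move=> df dg e e0; have e2 : 0 < e / 2 by lra.
have [d1 d10 h1] := df _ e2; have [d2 d20 h2] := dg _ e2.
exists (Num.min d1 d2); first by rewrite lt_min d10.
move=> s; rewrite lt_min => /andP[/h1 w1 /h2 w2].
rewrite (_ : _ - _ = (f s - f t - (s - t)%:C * l) + (g s - g t - (s - t)%:C * m)); last by ring.
by apply: le_trans (cmodD _ _) _; lra.
Qed.

Lemma rdifZ (R : realType) (f : R -> R[i]) t l c :
  rdif f t l -> rdif (fun s => c * f s) t (c * l).
Proof.
move=> df e e0; have c1 : 0 < cmod c + 1 by rewrite ltr_wpDl.
have [|d d0 h] := df (e / (cmod c + 1)); first by rewrite divr_gt0.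
exists d => // s /h; set x := f s - f t - _ => hx.
rewrite (_ : _ - _ = c * x); last by rewrite /x; ring.
rewrite cmodM; apply: le_trans (ler_wpM2l (cmod_ge0 c) hx) _.
rewrite mulrA ler_wpM2r // mulrCA ler_piMr ?ltW // ltr_pdivrMr // mul1r; lra.
Qed.

Lemma rdifB (R : realType) (f g : R -> R[i]) t l m :
  rdif f t l -> rdif g t m -> rdif (fun s => f s - g s) t (l - m).
Proof.
move=> df /(@rdifZ _ _ _ _ (-1)) dg; rewrite -mulN1r.
by apply: rdif_ext ltr01 _ (rdifD df dg) => s _; rewrite mulN1r.
Qed.

Lemma is_derive_ReC (R : realType) (f : R -> R[i]) t l c :
  rdif f t l -> is_derive t 1 (fun s => Re (c * f s)) (Re (c * l)).
Proof.
move=> df; have h : (fun h : R => h^-1 *: (Re (c * f (h *: (1 : R) + t)) - Re (c * f t))) @ 0^' --> Re (c * l).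
  apply/cvgrPdist_le => e e0.
  have [d d0 h] := @rdifZ _ _ _ _ c df e e0.
  exists d => //= r /=; rewrite sub0r normrN => rd r0.
  rewrite -normrN opprB scaler1.
  have := h (r + t); rewrite addrK => /(_ rd) h1.
  have r0' : `|r| > 0 by rewrite normr_gt0.
  rewrite -(ler_pM2r r0'); apply: le_trans h1; apply: le_trans (norm_Re _).
  rewrite -normrM 2!ReD 2!ReN ReZ mulrBl /GRing.scale /= mulrAC mulVf // mul1r.
  by rewrite [r * _]mulrC.
split; first by apply/cvg_ex; exists (Re (c * l)).
exact: cvg_lim h.
Qed.

Lemma rdif_of_derive (R : realType) (u v : R -> R) (t a b : R) :
  is_derive t 1 u a -> is_derive t 1 v b ->
  rdif (fun s => Complex (u s) (v s)) t (Complex a b).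
Proof.
have H (w : R -> R) c : is_derive t 1 w c -> forall e : R, 0 < e ->
    exists2 d : R, 0 < d & forall s, `|s - t| < d -> `|w s - w t - (s - t) * c| <= e * `|s - t|.
  move=> [dw wc] e e0; move: dw; rewrite /derivable => dw.
  have : (fun h : R => h^-1 *: (w (h *: (1 : R) + t) - w t)) @ 0^' --> c.
    by rewrite -wc; apply: dw.
  move/cvgrPdist_le => /(_ _ e0)[d /= d0 h]; exists d => // s st.
  have [->|s0] := eqVneq s t; first by rewrite !subrr mul0r subrr normr0 mulr0.
  have st0 : s - t != 0 by rewrite subr_eq0.
  have := h (s - t); rewrite /= sub0r normrN => /(_ st st0).
  rewrite scaler1 subrK -(ler_pM2r (_ : 0 < `|s - t|)) ?normr_gt0 // -normrM.
  rewrite mulrBl /GRing.scale /= mulrAC mulVf // mul1r distrC [c * _]mulrC; exact.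
move=> /H hu /H hv e e0; have e2 : 0 < e / 2 by lra.
have [d1 d10 h1] := hu _ e2; have [d2 d20 h2] := hv _ e2.
exists (Num.min d1 d2); first by rewrite lt_min d10.
move=> s; rewrite lt_min => /andP[/h1 w1 /h2 w2].
apply: le_trans (cmod_le_ReIm _) _.
rewrite !ReD !ImD !ReN !ImN ReZ ImZ /=; lra.
Qed.

Lemma mvi_Re (R : realType) (f : R -> R[i]) (a b M : R) : a <= b ->
  (forall t, a <= t <= b -> exists2 l, rdif f t l & Re l <= M) ->
  Re (f b - f a) <= M * (b - a).
Proof.
move=> ab H.
have /choice[df dfP] : forall t, exists l, a <= t <= b -> rdif f t l /\ Re l <= M.
  move=> t; case: (boolP (a <= t <= b)) => [/H[l l1 l2]|_]; first by exists l.
  by exists 0.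
have D t : a <= t <= b -> is_derive t 1 (fun s => Re (1 * f s)) (Re (1 * df t)).
  by move=> /dfP[h _]; exact: is_derive_ReC.
have [| |x] := @MVT_segment R (fun s => Re (1 * f s)) (fun s => Re (1 * df s)) a b ab.
- by move=> t; rewrite in_itv /= => /andP[t1 t2]; apply: D; rewrite !ltW.
- apply: continuous_in_subspaceT => t; rewrite inE /= in_itv /= => /D[dt _].
  by apply: differentiable_continuous; apply/derivable1_diffP.
rewrite in_itv /= !mul1r => /dfP[_ dx] E.
by rewrite ReD ReN E ler_wpM2r ?subr_ge0.
Qed.

Lemma mvi (R : realType) (f : R -> R[i]) (a b M : R) : a <= b ->
  (forall t, a <= t <= b -> exists2 l, rdif f t l & cmod l <= M) ->
  cmod (f b - f a) <= M * (b - a).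
Proof.
move=> ab H; have [c [c1 cE]] := phaseP (f b - f a).
rewrite -cE mulrBr; apply: (@mvi_Re _ (fun s => c * f s)) => // t /H[l dl lM].
exists (c * l); first exact: rdifZ.
by apply: le_trans (Re_le _) _; rewrite cmodM c1 mul1r.
Qed.

(** Integration enters the one-variable theory only here, through the fundamental theorem of
    calculus on real and imaginary parts. Afterwards an integral is an increment of a primitive,
    estimated by [mvi] or [mvi_Re]. *)
Lemma primitive_exists (R : realType) (f : R -> R[i]) (A B : R) :
  (forall t, A <= t <= B -> rcont f t) ->
  exists P : R -> R[i], forall t, A < t < B -> rdif P t (f t).
Proof.
move=> cf.
have H (g : R[i] -> R) : (forall x y, g (x - y) = g x - g y) -> (forall x, `|g x| <= cmod x) ->
    exists P : R -> R, forall t, A < t < B -> is_derive t 1 P (g (f t)).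
  move=> gB gn.
  have cg t : A <= t <= B -> {for t, continuous (fun s => g (f s))}.
    move=> /cf ct; apply/cvgrPdist_le => e e0; have [d d0 h] := ct _ e0.
    exists d => //= s /=; rewrite distrC => /h hs.
    by rewrite distrC -gB; apply: le_trans hs.
  exists (fun x => (\int[lebesgue_measure]_(t in [set` `[A, x]]) (g (f t)))%R).
  move=> t /andP[At tB].
  have [||d1 d2] := @continuous_FTC1_closed R (fun s => g (f s)) A t B tB _ At.
  - apply: continuous_compact_integrable; first exact: segment_compact.
    apply: continuous_in_subspaceT => s; rewrite inE /= in_itv /=; exact: cg.
  - by apply: cg; rewrite !ltW.
  - move: d1 d2; move: (fun x : R => _) => F d1 d2.
    by rewrite -d2 derive1E; exact: DeriveDef.
have [u hu] := H Re (fun x y => etrans (ReD x (- y)) (congr1 _ (ReN y))) (@norm_Re R).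
have [v hv] := H Im (fun x y => etrans (ImD x (- y)) (congr1 _ (ImN y))) (@norm_Im R).
exists (fun t => Complex (u t) (v t)) => t tAB.
rewrite (_ : f t = Complex (Re (f t)) (Im (f t))); last by case: (f t).
exact: rdif_of_derive (hu _ tAB) (hv _ tAB).
Qed.

Lemma cdif_rdif (R : realType) (F : R[i] -> R[i]) (gam : R -> R[i]) t l m :
  rdif gam t m -> cdif F (gam t) l -> rdif (fun s => F (gam s)) t (l * m).
Proof.
move=> dg dF e e0.
have m1 : 0 < cmod m + 1 by rewrite ltr_wpDl.
have l1 : 0 < cmod l + 1 by rewrite ltr_wpDl.
have [|d d0 h] := dF (e / 2 / (cmod m + 1)); first by rewrite !divr_gt0.
have [d1 d10 h1] := rdif_rcont dg (divr_gt0 d0 (@ltr0Sn R 1)).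
have [|d2 d20 h2] := dg (Num.min 1 (e / 2 / (cmod l + 1))).
  by rewrite lt_min ltr01 !divr_gt0.
exists (Num.min d1 d2); first by rewrite lt_min d10.
move=> s; rewrite lt_min => /andP[/h1 s1 /h2 s2].
have {}/h sd : cmod (gam s - gam t) < d by apply: le_lt_trans s1 _; lra.
have s3 : cmod (gam s - gam t) <= (cmod m + 1) * `|s - t|.
  rewrite (_ : gam s - gam t = (gam s - gam t - (s - t)%:C * m) + (s - t)%:C * m); last by ring.
  apply: le_trans (cmodD _ _) _; rewrite cmodM cmodR.
  have : cmod (gam s - gam t - (s - t)%:C * m) <= 1 * `|s - t|.
    by apply: le_trans s2 _; rewrite ler_wpM2r // ge_min lexx.
  by lra.
rewrite (_ : _ - _ = (F (gam s) - F (gam t) - l * (gam s - gam t))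
   + l * (gam s - gam t - (s - t)%:C * m)); last by ring.
apply: le_trans (cmodD _ _) _; rewrite cmodM.
have a1 : cmod (F (gam s) - F (gam t) - l * (gam s - gam t)) <= e / 2 * `|s - t|.
  apply: le_trans sd _; rewrite -mulrA; apply: ler_wpM2l; first lra.
  by rewrite ler_pdivrMl.
have a2 : cmod l * cmod (gam s - gam t - (s - t)%:C * m) <= e / 2 * `|s - t|.
  apply: le_trans (_ : (cmod l + 1) * (e / 2 / (cmod l + 1) * `|s - t|) <= _); last first.
    by rewrite mulrA mulrCA divff ?mulr1 // gt_eqF.
  apply: ler_pM => //; first by rewrite lerDl.
  by apply: le_trans s2 _; rewrite ler_wpM2r // ge_min lexx orbT.
lra.
Qed.

Lemma cdif_mvi (R : realType) (F : R[i] -> R[i]) (a b : R[i]) (M : R) :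
  (forall t : R, 0 <= t <= 1 -> exists2 l, cdif F (a + t%:C * (b - a)) l & cmod l <= M) ->
  cmod (F b - F a) <= M * cmod (b - a).
Proof.
move=> H.
have := @mvi R (fun s => F (a + s%:C * (b - a))) 0 1 (M * cmod (b - a)) ler01.
rewrite mul0r addr0 mul1r subr0 mulr1 [a + (b - a)]addrC subrK; apply=> t /H[l dl lM].
exists (l * (b - a)); last by rewrite cmodM ler_wpM2r.
apply: (@cdif_rdif R F (fun s => a + s%:C * (b - a))) => //.
by rewrite -[X in rdif _ _ X]add0r; apply: rdifD; [exact: rdif_cst|exact: rdif_lin].
Qed.

Lemma cmod_segment (R : realType) (a b : R[i]) (t r : R) : 0 <= t <= 1 ->
  cmod a <= r -> cmod b <= r -> cmod (a + t%:C * (b - a)) <= r.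
Proof.
move=> /andP[t0 t1] ar br.
rewrite (_ : a + _ = (1 - t)%:C * a + t%:C * b); last by rewrite rmorphB; ring.
apply: le_trans (cmodD _ _) _; rewrite !cmodM !cmodR !ger0_norm ?subr_ge0 //.
have := ler_wpM2l t0 br; have := ler_wpM2l (_ : 0 <= 1 - t) ar; rewrite subr_ge0 t1 => /(_ isT); lra.
Qed.

(** * Goursat's theorem on a rectangle, by bisection *)

Lemma nested_intervals (R : realType) (a b : nat -> R) :
  (forall n, a n <= a n.+1) -> (forall n, b n.+1 <= b n) -> (forall n, a n <= b n) ->
  exists p, forall n, a n <= p <= b n.
Proof.
move=> ai bd ab.
have aM m n : (m <= n)%N -> a m <= a n by move=> mn; exact: (homo_leq (@lexx _ R) le_trans ai).
have bM m n : (m <= n)%N -> b n <= b m.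
  move=> mn; apply: (homo_leq (r := fun x y => y <= x) (@lexx _ R) _ bd) mn.
  by move=> y x z h1 h2; exact: le_trans h2 h1.
have abmn m n : a m <= b n.
  by apply: le_trans (aM _ _ (leq_maxl m n)) (le_trans (ab _) (bM _ _ (leq_maxr m n))).
have ne : nonempty (range a) by exists (a 0%N), 0%N.
exists (sup (range a)) => n; apply/andP; split.
  by apply: ub_le_sup; [exists (b 0%N) => _ [m _ <-]; exact: abmn|exists n].
by apply: ge_sup => // _ [m _ <-]; exact: abmn.
Qed.

Lemma halving (R : realType) (L d : R) : 0 < d -> exists n : nat, L / 2 ^+ n < d.
Proof.
move=> d0; have [n h] : exists n : nat, L / d < n%:R.
  exists (Num.truncn `|L / d|).+1.
  by apply: le_lt_trans (ler_norm _) _; rewrite truncnS_gt.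
exists n; rewrite ltr_pdivrMr ?exprn_gt0 // mulrC -ltr_pdivrMr //.
apply: lt_trans h _; rewrite -natrX ltr_nat; exact: ltn_expl.
Qed.

(** Cousin's principle for rectangles. If [P] fails on a rectangle, it fails on one of the four
    quarters; the nested failing quarters shrink to a point [(p, q)], where the local hypothesis
    contradicts the failure. *)
Lemma bisection (R : realType) (P : R -> R -> R -> R -> Prop) (X1 X2 Y1 Y2 : R) :
  X1 <= X2 -> Y1 <= Y2 ->
  (forall a b c d, X1 <= a -> a <= b -> b <= X2 -> Y1 <= c -> c <= d -> d <= Y2 ->
     P a ((a + b) / 2) c ((c + d) / 2) -> P ((a + b) / 2) b c ((c + d) / 2) ->
     P a ((a + b) / 2) ((c + d) / 2) d -> P ((a + b) / 2) b ((c + d) / 2) d -> P a b c d) ->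
  (forall p q, X1 <= p <= X2 -> Y1 <= q <= Y2 -> exists2 del, 0 < del &
     forall a b c d, X1 <= a -> a <= p -> p <= b -> b <= X2 ->
       Y1 <= c -> c <= q -> q <= d -> d <= Y2 -> b - a < del -> d - c < del -> P a b c d) ->
  P X1 X2 Y1 Y2.
Proof.
move=> X12 Y12 sub loc; apply: contrapT => nP.
pose T := (R * R * R * R)%type.
pose ok (t : T) := let: (a, b, c, d) := t in
  [/\ X1 <= a, a <= b, b <= X2, Y1 <= c & [/\ c <= d, d <= Y2 & ~ P a b c d]].
pose half (s t : T) := let: (a, b, c, d) := s in let: (a', b', c', d') := t in
  [/\ a <= a', b' <= b, c <= c', d' <= d & b' - a' = (b - a) / 2 /\ d' - c' = (d - c) / 2].
have /choice[step stepP] : forall s : T, exists t, ok s -> ok t /\ half s t.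
  move=> [[[a b] c] d]; set s := (a, b, c, d).
  case: (pselect (ok s)) => [[Xa ab bX Yc [cd dY nPs]]|]; last by exists s.
  apply: contrapT => H; apply: nPs; apply: sub => //; apply: contrapT => nQ; apply: H;
    [exists (a, (a + b) / 2, c, (c + d) / 2)|exists ((a + b) / 2, b, c, (c + d) / 2)
    |exists (a, (a + b) / 2, (c + d) / 2, d)|exists ((a + b) / 2, b, (c + d) / 2, d)];
    by move=> _; split; split; try split; try (by []); lra.
pose u n := iter n step (X1, X2, Y1, Y2).
have uok n : ok (u n) by elim: n => [|n IH]; [split|rewrite /u iterS; exact: (stepP _ IH).1].
have uh n : half (u n) (u n.+1) by exact: (stepP _ (uok n)).2.
pose a n := (u n).1.1.1; pose b n := (u n).1.1.2; pose c n := (u n).1.2; pose d n := (u n).2.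
have okn n : [/\ X1 <= a n, a n <= b n, b n <= X2, Y1 <= c n & [/\ c n <= d n, d n <= Y2 & ~ P (a n) (b n) (c n) (d n)]].
  by have := uok n; rewrite /a /b /c /d; case: (u n) => [[[? ?] ?] ?].
have hn n : [/\ a n <= a n.+1, b n.+1 <= b n, c n <= c n.+1, d n.+1 <= d n &
    b n.+1 - a n.+1 = (b n - a n) / 2 /\ d n.+1 - c n.+1 = (d n - c n) / 2].
  by have := uh n; rewrite /a /b /c /d; case: (u n) => [[[? ?] ?] ?]; case: (u n.+1) => [[[? ?] ?] ?].
have wab n : b n - a n = (X2 - X1) / 2 ^+ n.
  elim: n => [|n IH]; first by rewrite expr0 divr1.
  by have [_ _ _ _ [-> _]] := hn n; rewrite IH exprS invfM; ring.
have wcd n : d n - c n = (Y2 - Y1) / 2 ^+ n.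
  elim: n => [|n IH]; first by rewrite expr0 divr1.
  by have [_ _ _ _ [_ ->]] := hn n; rewrite IH exprS invfM; ring.
have [n|n|n|p pP] := @nested_intervals R a b; [by have [] := hn n|by have [] := hn n|by have [] := okn n|].
have [n|n|n|q qP] := @nested_intervals R c d; [by have [] := hn n|by have [] := hn n|by have [_ _ _ _ []] := okn n|].
have [||del del0 D] := loc p q; [exact: (pP 0%N)|exact: (qP 0%N)|].
have [n hnn] := @halving R (Num.max (X2 - X1) (Y2 - Y1)) _ del0.
have [k1 k2 k3 k4 [k5 k6 k7]] := okn n; apply: k7.
have /andP[p1 p2] := pP n; have /andP[q1 q2] := qP n.
apply: D => //.
  by rewrite wab; apply: le_lt_trans hnn; rewrite ler_wpM2r ?invr_ge0 ?exprn_ge0 // le_max lexx.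
by rewrite wcd; apply: le_lt_trans hnn; rewrite ler_wpM2r ?invr_ge0 ?exprn_ge0 // le_max lexx orbT.
Qed.

(** On small rectangles [H] is nearly affine, and the boundary integral of an affine function
    vanishes. The resulting quadratic bound is carried to the whole rectangle by [bisection]. The
    derivative of [H] is not assumed continuous. *)
Lemma goursat_periodic (R : realType) (H : R[i] -> R[i]) (Q : R -> R -> R[i]) (A X1 X2 B T : R) :
  A < X1 -> X1 <= X2 -> X2 < B -> 0 < T ->
  (forall x, H (Complex x 0) = H (Complex x T)) ->
  (forall x y, A <= x <= B -> exists b, cdif H (Complex x y) b) ->
  (forall x y, A < x < B -> -1 < y < T + 1 -> rdif (Q x) y (H (Complex x y))) ->
  Q X2 T - Q X2 0 = Q X1 T - Q X1 0.
Proof.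
move=> AX1 X12 X2B T0 per dH dQ.
have /choice[P dP] : forall y, exists P : R -> R[i], forall x, A < x < B -> rdif P x (H (Complex x y)).
  move=> y; apply: (@primitive_exists R (fun x => H (Complex x y))) => t /dH - /(_ y)[b db].
  move=> e e0; have [d d0 h] := cdif_ccont db e0; exists d => // s st; apply: h.
  by apply: le_lt_trans (cmod_le_ReIm _) _; rewrite /= subrr normr0 addr0.
(* This is the integral of [H] over the boundary of the rectangle with sides [[a, b]] and [[c, d]],
   written with primitives along horizontal and vertical lines. *)
pose S a b c d := (P c b - P c a) - (P d b - P d a) + Complex 0 1 * ((Q b d - Q b c) - (Q a d - Q a c)).
have loc e : 0 < e -> cmod (S X1 X2 0 T) <= e * ((X2 - X1) + (T - 0)) ^+ 2.
  move=> e0.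
  apply: (@bisection R (fun a b c d => cmod (S a b c d) <= e * ((b - a) + (d - c)) ^+ 2)) => //.
  - exact: ltW.
  (* A quarter has half the half-perimeter, so its bound is one fourth of the bound for the whole,
     and the four bounds add up exactly. *)
  - move=> a b c d _ ab _ _ cd _; set m := (a + b) / 2; set k := (c + d) / 2.
    have -> : (m - a) + (k - c) = ((b - a) + (d - c)) / 2 by rewrite /m /k; lra.
    have -> : (b - m) + (k - c) = ((b - a) + (d - c)) / 2 by rewrite /m /k; lra.
    have -> : (m - a) + (d - k) = ((b - a) + (d - c)) / 2 by rewrite /m /k; lra.
    have -> : (b - m) + (d - k) = ((b - a) + (d - c)) / 2 by rewrite /m /k; lra.
    move: ((b - a) + (d - c)) => w h1 h2 h3 h4.
    have -> : S a b c d = (S a m c k + S m b c k) + (S a m k d + S m b k d) by rewrite /S; ring.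
    apply: le_trans (cmodD _ _) _.
    apply: le_trans (lerD (cmodD _ _) (cmodD _ _)) _.
    apply: le_trans (lerD (lerD h1 h2) (lerD h3 h4)) _; rewrite !expr2; lra.
  - move=> p q /andP[Xp pX] /andP[Yq qY].
    have [|b db] := dH p q; first by apply/andP; split; lra.
    have [|del del0 hd] := db (e / 8); first lra.
    exists (Num.min (del / 2) (1 / 2)); first by rewrite lt_min; apply/andP; split; lra.
    move=> x1 x2 y1 y2 a1 a2 a3 a4 a5 a6 a7 a8; rewrite !lt_min => /andP[b1 _] /andP[b2 _].
    set w := x2 - x1 in b1 *; set h := y2 - y1 in b2 *.
    have near x y : x1 <= x <= x2 -> y1 <= y <= y2 ->
        cmod (H (Complex x y) - H (Complex p q) - b * (Complex x y - Complex p q)) <= e / 4 * (w + h).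
      move=> /andP[c1 c2] /andP[c3 c4].
      have c5 : cmod (Complex x y - Complex p q) <= w + h.
        apply: le_trans (cmod_le_ReIm _) _ => /=; apply: lerD; rewrite ler_norml /w /h; apply/andP; split; lra.
      have /hd c6 : cmod (Complex x y - Complex p q) < del by apply: le_lt_trans c5 _; lra.
      apply: le_trans c6 _; apply: le_trans (ler_wpM2l _ c5) _; first lra.
      apply: ler_wpM2r; first by rewrite /w /h; lra.
      lra.
    (* The contribution of the linear part [b] is subtracted before [mvi] is applied. In [U + i V]
       the two subtracted terms cancel, which is the vanishing of the integral of an affine
       function. *)
    have I1 : cmod ((P y1 x2 - P y2 x2 - x2%:C * (b * (Complex 0 y1 - Complex 0 y2)))
       - (P y1 x1 - P y2 x1 - x1%:C * (b * (Complex 0 y1 - Complex 0 y2)))) <= e / 2 * (w + h) * (x2 - x1).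
      apply: (@mvi _ (fun x => P y1 x - P y2 x - x%:C * (b * (Complex 0 y1 - Complex 0 y2)))).
        by rewrite (le_trans a2).
      move=> x /andP[c1 c2]; exists (H (Complex x y1) - H (Complex x y2) - b * (Complex 0 y1 - Complex 0 y2)).
        apply: rdifB; last exact: rdif_lin.
        by apply: rdifB; apply: dP; apply/andP; split; lra.
      have n1 : cmod (H (Complex x y1) - H (Complex p q) - b * (Complex x y1 - Complex p q)) <= e / 4 * (w + h).
        by apply: near; apply/andP; split; lra.
      have n2 : cmod (H (Complex x y2) - H (Complex p q) - b * (Complex x y2 - Complex p q)) <= e / 4 * (w + h).
        by apply: near; apply/andP; split; lra.
      have -> : Complex 0 y1 - Complex 0 y2 = Complex x y1 - Complex x y2.
        by apply: complex_ext; rewrite /= ?subrr.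
      move: n1 n2; set u1 := Complex x y1; set u2 := Complex x y2; set u0 := Complex p q => n1 n2.
      rewrite (_ : _ - b * _ = (H u1 - H u0 - b * (u1 - u0)) - (H u2 - H u0 - b * (u2 - u0))); last by ring.
      by apply: le_trans (cmodB _ _) _; lra.
    have I2 : cmod ((Q x2 y2 - Q x1 y2 - y2%:C * (b * (Complex x2 0 - Complex x1 0)))
       - (Q x2 y1 - Q x1 y1 - y1%:C * (b * (Complex x2 0 - Complex x1 0)))) <= e / 2 * (w + h) * (y2 - y1).
      apply: (@mvi _ (fun y => Q x2 y - Q x1 y - y%:C * (b * (Complex x2 0 - Complex x1 0)))).
        by rewrite (le_trans a6).
      move=> y /andP[c1 c2]; exists (H (Complex x2 y) - H (Complex x1 y) - b * (Complex x2 0 - Complex x1 0)).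
        apply: rdifB; last exact: rdif_lin.
        by apply: rdifB; apply: dQ; apply/andP; split; lra.
      have n1 : cmod (H (Complex x2 y) - H (Complex p q) - b * (Complex x2 y - Complex p q)) <= e / 4 * (w + h).
        by apply: near; apply/andP; split; lra.
      have n2 : cmod (H (Complex x1 y) - H (Complex p q) - b * (Complex x1 y - Complex p q)) <= e / 4 * (w + h).
        by apply: near; apply/andP; split; lra.
      have -> : Complex x2 0 - Complex x1 0 = Complex x2 y - Complex x1 y.
        by apply: complex_ext; rewrite /= ?subrr.
      move: n1 n2; set u1 := Complex x2 y; set u2 := Complex x1 y; set u0 := Complex p q => n1 n2.
      rewrite (_ : _ - b * _ = (H u1 - H u0 - b * (u1 - u0)) - (H u2 - H u0 - b * (u2 - u0))); last by ring.
      by apply: le_trans (cmodB _ _) _; lra.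
    move: I1 I2; set U := _ - (_ - x1%:C * _); set V := _ - (_ - y1%:C * _) => I1 I2.
    have -> : S x1 x2 y1 y2 = U + Complex 0 1 * V.
      have e1 : Complex 0 y1 - Complex 0 y2 = Complex 0 1 * (y1 - y2)%:C.
        by apply: complex_ext => /=; rewrite ?ReM ?ImM /=; ring.
      have e2 : Complex x2 0 - Complex x1 0 = (x2 - x1)%:C.
        by apply: complex_ext; rewrite /= ?subrr.
      by rewrite /S /U /V e1 e2 !rmorphB; ring.
    apply: le_trans (cmodD _ _) _.
    have c01 : cmod (Complex 0 1 : R[i]) = 1 by rewrite cmodE /= expr0n /= add0r expr1n sqrtr1.
    rewrite cmodM c01 mul1r; apply: le_trans (lerD I1 I2) _.
    have -> : x2 - x1 = w by []. have -> : y2 - y1 = h by [].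
    rewrite expr2; have : 0 <= e * ((w + h) * (w + h)) by rewrite mulr_ge0 ?(ltW e0) // -expr2 sqr_ge0.
    lra.
have S0 : S X1 X2 0 T = 0.
  apply/eqP; rewrite -cmod_eq0 eq_le cmod_ge0 andbT leNgt; apply/negP => Spos.
  have L0 : 0 < ((X2 - X1) + (T - 0)) ^+ 2 by rewrite exprn_gt0 //; lra.
  have := loc (cmod (S X1 X2 0 T) / 2 / ((X2 - X1) + (T - 0)) ^+ 2).
  rewrite !divr_gt0 // => /(_ isT); rewrite divfK ?gt_eqF //; lra.
have P0 : (P 0 X2 - P T X2) - (P 0 X1 - P T X1) = 0.
  apply/eqP; rewrite -cmod_eq0 eq_le cmod_ge0 andbT -[leRHS](mul0r (X2 - X1)).
  apply: (@mvi _ (fun x => P 0 x - P T x)) => // x /andP[x1 x2].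
  exists (H (Complex x 0) - H (Complex x T)); last by rewrite per subrr cmod0.
  by apply: rdifB; apply: dP; apply/andP; split; lra.
have I0 : (Complex 0 1 : R[i]) != 0 by rewrite eq_complex /= oner_eq0 andbF.
apply: (mulfI I0); apply/eqP; rewrite -subr_eq0 -mulrBr; apply/eqP.
by rewrite -S0 /S -[LHS]add0r -P0; congr (_ + _); ring.
Qed.

(** * The complex exponential and the comparison of the centre with a circle *)

Definition cexp (R : realType) (z : R[i]) : R[i] :=
  (expR (Re z))%:C * Complex (cos (Im z)) (sin (Im z)).

Lemma cmod_cis (R : realType) (y : R) : cmod (Complex (cos y) (sin y)) = 1.
Proof. by rewrite cmodE /= cos2Dsin2 sqrtr1. Qed.

Lemma cmod_cexp (R : realType) (z : R[i]) : cmod (cexp z) = expR (Re z).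
Proof. by rewrite cmodM cmodR cmod_cis mulr1 gtr0_norm ?expR_gt0. Qed.

Lemma cexpD (R : realType) (z w : R[i]) : cexp (z + w) = cexp z * cexp w.
Proof.
rewrite /cexp ReD ImD expRD cosD sinD; apply: complex_ext; rewrite !(ReZ, ImZ, ReM, ImM) /=; ring.
Qed.

(** With [z = h + i k], the error [cexp z - 1 - z] splits exactly into the first-order error of
    [expR] at [h], that of [cos + i sin] at [k], each times a bounded factor, and the product
    [i h k], which is of second order. *)
Lemma cdif_cexp0 (R : realType) : cdif (@cexp R) 0 1.
Proof.
move=> e e0; have e6 : 0 < e / 6 by lra.
have rE : rdif (fun s : R => Complex (expR s) 0) 0 (Complex (expR 0) 0) by apply: rdif_of_derive.
have rC : rdif (fun s : R => Complex (cos s) (sin s)) 0 (Complex (- sin 0) (cos 0)) by apply: rdif_of_derive.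
have [d1 d10 h1] := rE _ e6; have [d2 d20 h2] := rC _ e6.
exists (Num.min (Num.min d1 d2) (Num.min 1 (e / 6))).
  by rewrite !lt_min d10 d20 ltr01 e6.
move=> z; rewrite subr0 !lt_min => /andP[/andP[z1 z2] /andP[z3 z4]].
have nR := norm_Re z; have nI := norm_Im z.
have := h1 (Re z); rewrite subr0 => /(_ (le_lt_trans nR z1)).
have := h2 (Im z); rewrite subr0 => /(_ (le_lt_trans nI z2)).
rewrite expR0 sin0 cos0 oppr0 /cexp /= expR0 sin0 cos0 mul1r.
set c := Complex (cos _) _; set al := _ - _ - _; set be := _ - _ - _.
move=> hal hbe.
set h := Re z in nR hal hbe *; set k := Im z in nI hal hbe *.
have -> : (expR h)%:C * c - 1%:C * Complex 1 0 - z
    = be * c + (1 + h%:C) * al + h%:C * (k%:C * Complex 0 1).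
  rewrite /be /al; have -> : z = Complex h k by rewrite /h /k; case: (z).
  apply: complex_ext; rewrite !(ReD, ImD, ReN, ImN, ReZ, ImZ, ReM, ImM) /=; ring.
apply: le_trans (cmodD _ _) _; apply: le_trans (lerD (cmodD _ _) (lexx _)) _.
rewrite !cmodM cmod_cis mulr1 !cmodR.
have -> : cmod (Complex 0 1 : R[i]) = 1 by rewrite cmodE /= expr0n /= add0r expr1n sqrtr1.
have i1 : cmod (1 + h%:C) <= 2.
  by apply: le_trans (cmodD _ _) _; rewrite cmod1 cmodR; lra.
have i2 : cmod (1 + h%:C) * cmod al <= 2 * (e / 6 * `|k|) by apply: ler_pM.
have i3 : `|h| * (`|k| * 1) <= e / 6 * `|k| by rewrite mulr1 ler_wpM2r //; lra.
have i4 : e / 6 * `|k| <= e / 6 * cmod z by rewrite ler_wpM2l // ltW.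
have i5 : e / 6 * `|h| <= e / 6 * cmod z by rewrite ler_wpM2l // ltW.
have i6 : 0 <= e * cmod z by rewrite mulr_ge0 // ltW.
lra.
Qed.

Lemma cdif_cexp (R : realType) (z : R[i]) : cdif (@cexp R) z (cexp z).
Proof.
have d : cdif (fun w => cexp z * cexp (w - z)) z (cexp z).
  rewrite -[X in cdif _ _ X]mulr1; apply: cdifZ; rewrite -[X in cdif _ _ X]mulr1.
  apply: (@cdif_comp _ (fun w => w - z)); last by rewrite subrr; exact: cdif_cexp0.
  by rewrite -(subr0 1); apply: cdifB; [exact: cdif_id|exact: cdif_cst].
by apply: cdif_ext ltr01 _ d => w _; rewrite -cexpD addrC subrK.
Qed.

(* In the coordinates [z = exp (x + i y)] the horizontal sides of the Goursat rectangle cancel by periodicity, so the circle mean does not depend on the radius; [z = 0] sits at [x = - oo], where continuity of [F] is enough. *)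
Lemma center_Re_le (R : realType) (F : R[i] -> R[i]) (r r' m : R) : 0 < r -> r < r' ->
  (forall z, 0 < cmod z -> cmod z < r' -> exists l, cdif F z l) -> ccont F 0 ->
  (forall z, cmod z = r -> Re (F z) <= m) -> Re (F 0) <= m.
Proof.
move=> r0 rr' dF cF Fm; apply/ler_addgt0Pr => e e0.
have [d d0 hd] := cF _ e0.
pose X1 := ln (Num.min d r / 2); pose X2 := ln r; pose B := ln ((r + r') / 2); pose A := X1 - 1.
have md0 : 0 < Num.min d r by rewrite lt_min d0.
have mdr : Num.min d r <= r by rewrite ge_min lexx orbT.
have mdd : Num.min d r <= d by rewrite ge_min lexx.
have AX1 : A < X1 by rewrite /A; lra.
have X12 : X1 <= X2 by rewrite /X1 /X2 ler_ln ?posrE //; lra.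
have X2B : X2 < B by rewrite /B /X2 ltr_ln ?posrE //; lra.
pose H z := F (cexp z).
have dH x y : A <= x <= B -> exists b, cdif H (Complex x y) b.
  move=> /andP[_ xB]; have [||l dl] := dF (cexp (Complex x y)); rewrite ?cmod_cexp ?expR_gt0 //=.
    have : expR x <= expR B by rewrite ler_expR.
    rewrite lnK ?posrE //; lra.
  by exists (l * cexp (Complex x y)); apply: cdif_comp => //; exact: cdif_cexp.
have T0 : 0 < pi *+ 2 :> R by rewrite mulrn_wgt0 // pi_gt0.
have per x : H (Complex x 0) = H (Complex x (pi *+ 2)).
  by rewrite /H /cexp /= cos0 sin0 cos2pi sin2pi.
have /choice[Q dQ] : forall x, exists P : R -> R[i], A < x < B -> forall y, -1 < y < pi *+ 2 + 1 -> rdif P y (H (Complex x y)).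
  move=> x; case: (boolP (A < x < B)) => [/andP[x1 x2]|_]; last by exists (fun=> 0).
  have [|P hP] := @primitive_exists R (fun y => H (Complex x y)) (-1) (pi *+ 2 + 1).
    move=> t _; have [|b db] := dH x t; first by rewrite !ltW.
    move=> e1 e10; have [d1 d10 h] := cdif_ccont db e10; exists d1 => // s st; apply: h.
    by apply: le_lt_trans (cmod_le_ReIm _) _; rewrite /= subrr normr0 add0r.
  by exists P.
have E := @goursat_periodic R H Q A X1 X2 B _ AX1 X12 X2B T0 per dH (fun x y xAB => dQ x xAB y).
have top : Re (Q X2 (pi *+ 2) - Q X2 0) <= m * (pi *+ 2 - 0).
  apply: mvi_Re => [|y /andP[y0 y1]]; first exact: ltW.
  exists (H (Complex X2 y)); first by apply: dQ; apply/andP; split; lra.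
  by apply: Fm; rewrite cmod_cexp /= lnK.
(* [X1] is the logarithm of a radius smaller than [d], so on that circle [F] is within [e] of [F 0].
   Hence so is the mean. *)
have bot : cmod ((Q X1 (pi *+ 2) - (pi *+ 2)%:C * F 0) - (Q X1 0 - 0%:C * F 0)) <= e * (pi *+ 2 - 0).
  apply: (@mvi _ (fun y => Q X1 y - y%:C * F 0)) => [|y /andP[y0 y1]]; first exact: ltW.
  exists (H (Complex X1 y) - F 0).
    by apply: rdifB; [apply: dQ; apply/andP; split; lra|exact: rdif_lin].
  apply: hd; rewrite subr0 cmod_cexp /= lnK ?posrE; lra.
rewrite -(ler_pM2r T0) -subr_ge0.
have := Re_le (- ((Q X1 (pi *+ 2) - (pi *+ 2)%:C * F 0) - (Q X1 0 - 0%:C * F 0))).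
rewrite cmodN => /le_trans /(_ bot).
move: top; rewrite E !(ReN, ReD, ReZ); lra.
Qed.

Lemma center_cmod_le (R : realType) (F : R[i] -> R[i]) (r r' m : R) : 0 < r -> r < r' ->
  (forall z, 0 < cmod z -> cmod z < r' -> exists l, cdif F z l) -> ccont F 0 ->
  (forall z, cmod z = r -> cmod (F z) <= m) -> cmod (F 0) <= m.
Proof.
move=> r0 rr' dF cF Fm; have [c [c1 cE]] := phaseP (F 0); rewrite -cE.
apply: (@center_Re_le _ (fun z => c * F z) r r') => //.
- by move=> z z0 z1; have [l dl] := dF z z0 z1; exists (c * l); exact: cdifZ.
- by apply: ccontM => //; exact: ccont_cst.
- by move=> z /Fm; apply: le_trans; apply: le_trans (Re_le _) _; rewrite cmodM c1 mul1r.
Qed.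

(** * Cauchy estimates *)

Lemma cdif_shift (R : realType) (F : R[i] -> R[i]) a z l :
  cdif F (a + z) l -> cdif (fun w => F (a + w)) z l.
Proof.
move=> dF; rewrite -[l]mulr1; apply: (@cdif_comp _ (fun w => a + w)) => //.
by rewrite -(add0r 1); apply: cdifD; [exact: cdif_cst|exact: cdif_id].
Qed.

(** The slope function of [F] at [a] is continuous at the centre with value [l], and differentiable
    elsewhere. On the circle of radius [r / 2] it is at most [2 M / (r / 2)], whence the factor
    [4]. *)
Lemma cauchy_estimate (R : realType) (F : R[i] -> R[i]) a (r M : R) l : 0 < r ->
  (forall z, cmod (z - a) < r -> exists l, cdif F z l) ->
  (forall z, cmod (z - a) < r -> cmod (F z) <= M) ->
  cdif F a l -> cmod l <= 4 * M / r.
Proof.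
move=> r0 dF FM dFa.
pose G z := F (a + z).
have dG0 : cdif G 0 l by apply: cdif_shift; rewrite addr0.
have Ga z : cmod z < r -> cmod (G z) <= M by move=> zr; apply: FM; rewrite addrC addKr.
have dG z : cmod z < r -> exists l, cdif G z l.
  by move=> zr; have [|m dm] := dF (a + z); [rewrite addrC addKr|exists m; exact: cdif_shift].
have [phi [cp pz GE]] := (cdifP _ _ _).1 dG0.
rewrite -pz; apply: (@center_cmod_le _ phi (r / 2) r) => //; try lra.
- move=> z; rewrite cmod_gt0 => z0 zr; have [m dm] := dG z zr.
  have : exists k, cdif (fun w => (G w - G 0) * w^-1) z k.
    eexists; apply: cdifM; first by apply: cdifB; [exact: dm|exact: cdif_cst].
    by apply: cdifV z0; exact: cdif_id.
  move=> [k dk]; exists k; have zm : 0 < cmod z by rewrite cmod_gt0.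
  apply: (cdif_ext zm _ dk) => w wz; rewrite GE subr0; field.
  apply/negP => /eqP w0; by move: wz; rewrite w0 sub0r cmodN ltxx.
- move=> z zr; have z0 : z != 0 by rewrite -cmod_gt0 zr; lra.
  have -> : phi z = (G z - G 0) / z by rewrite GE subr0; field.
  rewrite cmodM cmodV zr ler_pdivrMr; last lra.
  apply: le_trans (cmodB _ _) _.
  have -> : 4 * M / r * (r / 2) = M + M by field; rewrite gt_eqF.
  by apply: lerD; apply: Ga; rewrite ?cmod0 ?zr; lra.
Qed.

(** A Cauchy condition with linear rate at [0] gives a limit with the same rate. It serves to
    produce the limit of the difference quotients of a derivative. The limit is read off along the
    sequence [s n]. *)
Lemma cauchy_complete_at0 (R : realType) (q : R[i] -> R[i]) (r C : R) : 0 < r -> 0 <= C ->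
  (forall h k, h != 0 -> k != 0 -> cmod h < r -> cmod k < r -> cmod (q h - q k) <= C * (cmod h + cmod k)) ->
  exists l, forall h, h != 0 -> cmod h < r -> cmod (q h - l) <= C * cmod h.
Proof.
move=> r0 C0 H.
pose s n : R := r / 2 / 2 ^+ n.
have s0 n : 0 < s n by rewrite !divr_gt0 ?exprn_gt0.
have sn0 n : (s n)%:C != 0 :> R[i] by rewrite -cmod_gt0 cmodR gtr0_norm.
have snr n : s n < r.
  apply: (@le_lt_trans _ _ (r / 2)); last lra.
  by rewrite /s ler_pdivrMr ?exprn_gt0 // ler_peMr ?exprn_ege1 //; lra.
have cs n : cmod (s n)%:C = s n by rewrite cmodR gtr0_norm.
have Hs h n : h != 0 -> cmod h < r -> cmod (q h - q (s n)%:C) <= C * (cmod h + s n).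
  by move=> h0 hr; have := H h (s n)%:C h0 (sn0 n) hr; rewrite cs; apply.
(* Completeness of [R] is used on the real and imaginary parts, through nested intervals. *)
have comp (g : R[i] -> R) : (forall x y, g (x - y) = g x - g y) -> (forall x, `|g x| <= cmod x) ->
    exists p, forall n, `|g (q (s n)%:C) - p| <= 2 * C * s n.
  move=> gB gn.
  have ne : nonempty (range (fun n => g (q (s n)%:C) - 2 * C * s n)).
    by exists (g (q (s 0)%:C) - 2 * C * s 0), 0%N.
  have le m n : g (q (s m)%:C) - 2 * C * s m <= g (q (s n)%:C) + 2 * C * s n.
    have := Hs _ n (sn0 m); rewrite cs => /(_ (snr m)) h1.
    have := le_trans (gn _) h1; rewrite gB ler_norml => /andP[_ h2].
    have : 0 <= C * s m by rewrite mulr_ge0 // ltW.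
    have : 0 <= C * s n by rewrite mulr_ge0 // ltW.
    move: h2; lra.
  exists (sup (range (fun n => g (q (s n)%:C) - 2 * C * s n))) => n.
  rewrite ler_norml; apply/andP; split.
    rewrite lerBrDr -lerBrDl opprK; apply: ge_sup => // _ [m _ <-]; exact: le.
  rewrite lerBlDr -lerBlDl; apply: ub_le_sup; last by exists n.
  by exists (g (q (s 0)%:C) + 2 * C * s 0) => _ [m _ <-]; exact: le.
have [u hu] := comp Re (fun x y => etrans (ReD x (- y)) (congr1 _ (ReN y))) (@norm_Re R).
have [v hv] := comp Im (fun x y => etrans (ImD x (- y)) (congr1 _ (ImN y))) (@norm_Im R).
exists (Complex u v) => h h0 hr; apply/ler_addgt0Pr => e e0.
(* [5 C] collects [C s n] from the Cauchy condition between [h] and [s n], and [4 C s n] from the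
   distance of [q (s n)] to the limit. *)
have C1 : 0 < 5 * C + 1 by lra.
have [n hn] := @halving R (r / 2) (e / (5 * C + 1)) (divr_gt0 e0 C1).
have h1 := Hs h n h0 hr.
have h2 : cmod (q (s n)%:C - Complex u v) <= 4 * C * s n.
  apply: le_trans (cmod_le_ReIm _) _; rewrite ReD ImD ReN ImN /=.
  by have := hu n; have := hv n; lra.
apply: le_trans (cmodBD _ (q (s n)%:C) _) _; apply: le_trans (lerD h1 h2) _.
move: hn; rewrite -/(s n) ltr_pdivlMr //; have := s0 n; lra.
Qed.

(** The key to higher derivatives without power series: [cauchy_estimate] is applied to finite
    differences of [F], which are again differentiable. This bounds [F1], then shows that [F1] is
    Lipschitz, then that [F] has a quadratic remainder, and finally that the difference quotients of
    [F1] at [0] satisfy a Cauchy condition. *)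
Lemma cdif_derivative (R : realType) (F F1 : R[i] -> R[i]) (a : R[i]) (r : R) : 0 < r ->
  (forall z, cmod (z - a) < r -> cdif F z (F1 z)) -> exists l, cdif F1 a l.
Proof.
wlog -> : a F F1 / a = 0.
  move=> W r0 dF.
  have [|||l dl] := W 0 (fun w => F (a + w)) (fun w => F1 (a + w)) => //.
    by move=> z; rewrite subr0 => zr; apply: cdif_shift; apply: dF; rewrite addrC addKr.
  exists l; apply: (@cdif_ext _ (fun w => F1 (a + (w - a))) _ _ _ 1) => // [w _|].
    by rewrite addrC subrK.
  have : cdif (fun w => F1 (a + (- a + w))) a l.
    by apply: (@cdif_shift _ (fun w => F1 (a + w)) (- a)); rewrite addNr.
  by apply: cdif_ext ltr01 _ => w _; rewrite [- a + w]addrC.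
move=> r0 dF0.
have [R0 [M [R00 M0 dF FM]]] : exists R0 M : R, [/\ 0 < R0, 0 <= M,
    (forall z, cmod z < R0 -> cdif F z (F1 z)) & forall z, cmod z < R0 -> cmod (F z) <= M].
  have [|d d0 hd] := @ccont_bounded R F 0; first by apply: cdif_ccont (dF0 0 _); rewrite subrr cmod0.
  exists (Num.min r d), (cmod (F 0) + 1); split.
  - by rewrite lt_min r0.
  - by rewrite addr_ge0.
  - by move=> z; rewrite lt_min => /andP[z1 _]; apply: dF0; rewrite subr0.
  - by move=> z; rewrite lt_min => /andP[_ z2]; apply: hd; rewrite subr0.
have tri (z w : R[i]) u v : cmod z <= u -> cmod (w - z) < v -> cmod w < u + v.
  by move=> zu wv; have := cmodD (w - z) z; rewrite subrK; lra.
pose A := 4 * M / (R0 / 2).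
have A0 : 0 <= A by rewrite !mulr_ge0 // invr_ge0; lra.
have F1A z : cmod z <= R0 / 2 -> cmod (F1 z) <= A.
  move=> z2; apply: (@cauchy_estimate _ F z (R0 / 2)); first lra.
  - by move=> w /(tri _ _ _ _ z2) wz; exists (F1 w); apply: dF; lra.
  - by move=> w /(tri _ _ _ _ z2) wz; apply: FM; lra.
  - by apply: dF; lra.
have line (z h : R[i]) (t u v : R) : 0 <= t <= 1 -> cmod z <= u -> cmod h <= v -> cmod (z + t%:C * (z + h - z)) <= u + v.
  move=> /andP[t0 t1] zu hv; apply: le_trans (cmodD _ _) _; apply: lerD => //.
  rewrite cmodM cmodR ger0_norm // addrAC subrr add0r; apply: le_trans (_ : 1 * cmod h <= _); last by rewrite mul1r.
  by rewrite ler_wpM2r.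
have DhA z h : cmod z <= R0 / 4 -> cmod h <= R0 / 4 -> cmod (F (z + h) - F z) <= A * cmod h.
  move=> z4 h4; have := @cdif_mvi R F z (z + h) A; rewrite [z + h - z]addrAC subrr add0r; apply=> t t01.
  have := line z h t _ _ t01 z4 h4; rewrite [z + h - z]addrAC subrr add0r => hz.
  by exists (F1 (z + t%:C * h)); [apply: dF|apply: F1A]; lra.
pose B1 := 4 * A / (R0 / 8).
have B10 : 0 <= B1 by rewrite !mulr_ge0 // invr_ge0; lra.
have dDh z h : cmod z <= R0 / 4 -> cmod h <= R0 / 4 -> cdif (fun w => F (w + h) - F w) z (F1 (z + h) - F1 z).
  move=> z4 h4; have zh : cmod (z + h) <= R0 / 2 by apply: le_trans (cmodD _ _) _; lra.
  apply: cdifB; last by apply: dF; lra.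
  have : cdif (fun w => F (h + w)) z (F1 (z + h)) by apply: cdif_shift; rewrite addrC; apply: dF; lra.
  by apply: cdif_ext ltr01 _ => w _; rewrite addrC.
have F1L z h : cmod z <= R0 / 8 -> cmod h <= R0 / 8 -> cmod (F1 (z + h) - F1 z) <= B1 * cmod h.
  move=> z8 h8.
  have -> : B1 * cmod h = 4 * (A * cmod h) / (R0 / 8) by rewrite /B1; ring.
  apply: (@cauchy_estimate _ (fun w => F (w + h) - F w) z); first lra.
  - by move=> w /(tri _ _ _ _ z8) wz; eexists; apply: dDh; lra.
  - by move=> w /(tri _ _ _ _ z8) wz; apply: DhA; lra.
  - by apply: dDh; lra.
have EhA z h : cmod z <= R0 / 16 -> cmod h <= R0 / 16 -> cmod (F (z + h) - F z - h * F1 z) <= B1 * cmod h * cmod h.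
  move=> z4 h4.
  have := @cdif_mvi R (fun w => F w - w * F1 z) z (z + h) (B1 * cmod h).
  rewrite [z + h - z]addrAC subrr add0r (_ : _ - _ - _ = F (z + h) - F z - h * F1 z); last by ring.
  apply=> t t01.
  have := line z h t _ _ t01 z4 h4; rewrite [z + h - z]addrAC subrr add0r => hz.
  exists (F1 (z + t%:C * h) - (1 * F1 z + (z + t%:C * h) * 0)).
    apply: cdifB; first by apply: dF; lra.
    by apply: cdifM; [exact: cdif_id|exact: cdif_cst].
  rewrite mulr0 addr0 mul1r.
  have th : cmod (t%:C * h) <= cmod h.
    by move/andP: t01 => [t0 t1]; rewrite cmodM cmodR ger0_norm // ler_piMl.
  by apply: le_trans (F1L _ _ _ _) _; [lra|lra|rewrite ler_wpM2l].
pose D := 64 * B1 / R0.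
have D0 : 0 <= D by rewrite !mulr_ge0 // invr_ge0; lra.
(* Multiplied by [h k], the difference of the two quotients is the derivative at [0] of [k (F(w + h)
   - F(w)) - h (F(w + k) - F(w))]. The first-order terms of this combination cancel, so the
   quadratic remainders bound it, and [cauchy_estimate] with radius [R0 / 16] gives [D]. *)
have [l hl] : exists l, forall h, h != 0 -> cmod h < R0 / 16 -> cmod ((F1 h - F1 0) / h - l) <= D * cmod h.
  apply: (@cauchy_complete_at0 _ (fun h => (F1 h - F1 0) / h)) => //; first lra.
  move=> h k h0 k0 hr kr.
  have hk : 0 < cmod h * cmod k by rewrite mulr_gt0 // cmod_gt0.
  rewrite -(ler_pM2r hk) -cmodM -cmodM.
  rewrite (_ : _ * (h * k) = k * (F1 (0 + h) - F1 0) - h * (F1 (0 + k) - F1 0)); last first.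
    by rewrite !add0r; field; rewrite h0 k0.
  have -> : D * (cmod h + cmod k) * cmod (h * k) = 4 * (B1 * (cmod h * cmod k) * (cmod h + cmod k)) / (R0 / 16).
    by rewrite /D cmodM; field; rewrite gt_eqF.
  apply: (@cauchy_estimate _ (fun w => k * (F (w + h) - F w) - h * (F (w + k) - F w)) 0); first lra.
  - move=> w; rewrite subr0 => wr; eexists; apply: cdifB; apply: cdifZ; apply: dDh; lra.
  - move=> w; rewrite subr0 => wr.
    rewrite (_ : _ - _ = k * (F (w + h) - F w - h * F1 w) - h * (F (w + k) - F w - k * F1 w)); last by ring.
    apply: le_trans (cmodB _ _) _; rewrite !cmodM.
    have e1 := ler_wpM2l (cmod_ge0 k) (EhA w h (ltW wr) (ltW hr)).
    have e2 := ler_wpM2l (cmod_ge0 h) (EhA w k (ltW wr) (ltW kr)).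
    by apply: le_trans (lerD e1 e2) _; rewrite le_eqVlt; apply/orP; left; apply/eqP; ring.
  - by apply: cdifB; apply: cdifZ; apply: dDh; rewrite ?cmod0; lra.
exists l => e e0.
have D1 : 0 < D + 1 by lra.
exists (Num.min (R0 / 16) (e / (D + 1))); first by rewrite lt_min !divr_gt0.
move=> h; rewrite subr0 lt_min => /andP[h1]; rewrite ltr_pdivlMr // => h2.
have [->|h0] := eqVneq h 0; first by rewrite mulr0 !subrr cmod0 mulr0.
have -> : F1 h - F1 0 - l * h = ((F1 h - F1 0) / h - l) * h by field.
rewrite cmodM ler_wpM2r //; apply: le_trans (hl _ h0 h1) _.
by have := cmod_ge0 h; lra.
Qed.

Lemma cderiv_fun (R : realType) (F : R[i] -> R[i]) (a : R[i]) (r : R) :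
  (forall z, cmod (z - a) < r -> exists l, cdif F z l) ->
  exists F1, forall z, cmod (z - a) < r -> cdif F z (F1 z).
Proof.
move=> dF; have /choice[F1 h] : forall z, exists l, cmod (z - a) < r -> cdif F z l.
  move=> z; case: (boolP (cmod (z - a) < r)) => [/dF[l dl]|_]; first by exists l.
  by exists 0.
by exists F1.
Qed.

Lemma cderiv2_fun (R : realType) (F F1 : R[i] -> R[i]) (a : R[i]) (r : R) :
  (forall z, cmod (z - a) < r -> cdif F z (F1 z)) ->
  exists F2, forall z, cmod (z - a) < r -> cdif F1 z (F2 z).
Proof.
move=> dF; apply: cderiv_fun => z zr; apply: (@cdif_derivative _ F F1 z (r - cmod (z - a))).
  by rewrite subr_gt0.
by move=> w wr; apply: dF; apply: le_lt_trans (cmodBD w z a) _; lra.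
Qed.

Lemma disc_mvi (R : realType) (G : R[i] -> R[i]) (B : R) z :
  (forall w, cmod w <= cmod z -> exists2 l, cdif G w l & cmod l <= B) ->
  cmod (G z - G 0) <= B * cmod z.
Proof.
move=> dG; rewrite -[X in B * cmod X]subr0; apply: cdif_mvi => t t01; apply: dG.
by apply: cmod_segment t01 _ _; rewrite ?cmod0.
Qed.

(** [cauchy1], [cauchy2] and [cauchy3] bound the first three derivatives on the discs of radius
    [r / 2], [r / 4], [r / 8], for a function bounded by [M] on the disc of radius [r]. Each
    application of [cauchy_estimate] spends half of the radius left. *)
Definition cauchy1 (R : realType) (r M : R) : R := 4 * M / (r / 2).
Definition cauchy2 (R : realType) (r M : R) : R := 4 * cauchy1 r M / (r / 4).
Definition cauchy3 (R : realType) (r M : R) : R := 4 * cauchy2 r M / (r / 8).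

Lemma cauchy2_ge0 (R : realType) (r M : R) : 0 < r -> 0 <= M -> 0 <= cauchy2 r M.
Proof.
move=> r0 M0; rewrite /cauchy2 /cauchy1.
by repeat (apply: divr_ge0; [|lra]; apply: mulr_ge0; first lra).
Qed.

Lemma cauchy3_ge0 (R : realType) (r M : R) : 0 < r -> 0 <= M -> 0 <= cauchy3 r M.
Proof.
move=> r0 M0; apply: divr_ge0; last lra.
by apply: mulr_ge0; [lra|exact: cauchy2_ge0].
Qed.

(** The bounds on the derivatives are integrated along radii by [disc_mvi]. What matters is that the
    error constants depend on [r] and [M] only, not on [F]: applied to [h(., t)], they are uniform
    in [t]. *)
Lemma taylor_estimates (R : realType) (F : R[i] -> R[i]) (r M : R) : 0 < r -> 0 <= M ->
  (forall z, cmod z < r -> exists l, cdif F z l) ->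
  (forall z, cmod z < r -> cmod (F z) <= M) ->
  exists F1 F2 : R[i] -> R[i],
  [/\ forall z, cmod z < r -> cdif F z (F1 z),
      forall z, cmod z < r -> cdif F1 z (F2 z),
      forall z, cmod z <= r / 8 -> cmod (F z - F 0 - F1 0 * z) <= cauchy2 r M * cmod z ^+ 2,
      forall z, cmod z <= r / 8 ->
        cmod (F1 z - F1 0 - F2 0 * z) <= cauchy3 r M * cmod z ^+ 2 &
      forall z, cmod z <= r / 8 ->
        cmod (F z - F 0 - F1 0 * z - F2 0 / 2 * z ^+ 2) <= cauchy3 r M * cmod z ^+ 3].
Proof.
move=> r0 M0 dF FM.
have s0 (G : R[i] -> Prop) : (forall z, cmod z < r -> G z) -> forall z, cmod (z - 0) < r -> G z.
  by move=> h z; rewrite subr0; exact: h.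
have [F1 /= dF1] := cderiv_fun (s0 _ dF); have [F2 dF2] := cderiv2_fun dF1.
have [F3 dF3] := cderiv2_fun dF2.
have t0 (G : R[i] -> Prop) : (forall z, cmod (z - 0) < r -> G z) -> forall z, cmod z < r -> G z.
  by move=> h z zr; apply: h; rewrite subr0.
move/t0: dF1 => dF1; move/t0: dF2 => dF2; move/t0: dF3 => dF3.
have tri (z w : R[i]) (u v : R) : cmod z <= u -> cmod (w - z) < v -> cmod w < u + v.
  by move=> zu wv; have := cmodD (w - z) z; rewrite subrK; lra.
have F1A z : cmod z <= r / 2 -> cmod (F1 z) <= cauchy1 r M.
  move=> z2.
  apply: (@cauchy_estimate _ F z); first lra.
  - by move=> w /(tri _ _ _ _ z2) wz; apply: dF; lra.
  - by move=> w /(tri _ _ _ _ z2) wz; apply: FM; lra.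
  - by apply: dF1; lra.
have F2A z : cmod z <= r / 4 -> cmod (F2 z) <= cauchy2 r M.
  move=> z2.
  apply: (@cauchy_estimate _ F1 z); first lra.
  - by move=> w /(tri _ _ _ _ z2) wz; exists (F2 w); apply: dF2; lra.
  - by move=> w /(tri _ _ _ _ z2) wz; apply: F1A; lra.
  - by apply: dF2; lra.
have F3A z : cmod z <= r / 8 -> cmod (F3 z) <= cauchy3 r M.
  move=> z2.
  apply: (@cauchy_estimate _ F2 z); first lra.
  - by move=> w /(tri _ _ _ _ z2) wz; exists (F3 w); apply: dF3; lra.
  - by move=> w /(tri _ _ _ _ z2) wz; apply: F2A; lra.
  - by apply: dF3; lra.
have dlin (c z : R[i]) : cdif (fun w => c * w) z c.
  by rewrite -[X in cdif _ _ X]mulr1; apply: cdifZ; exact: cdif_id.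
have f1 z : cmod z <= r / 8 -> cmod (F1 z - F1 0) <= cauchy2 r M * cmod z.
  by move=> z8; apply: disc_mvi => w wz; exists (F2 w); [apply: dF2|apply: F2A]; lra.
have f2 z : cmod z <= r / 8 -> cmod (F2 z - F2 0) <= cauchy3 r M * cmod z.
  by move=> z8; apply: disc_mvi => w wz; exists (F3 w); [apply: dF3|apply: F3A]; lra.
have c1 := cauchy2_ge0 r0 M0.
have c2 := cauchy3_ge0 r0 M0.
have f12 z : cmod z <= r / 8 -> cmod (F1 z - F1 0 - F2 0 * z) <= cauchy3 r M * cmod z ^+ 2.
  move=> z8; rewrite (_ : _ - _ = (F1 z - F2 0 * z) - (F1 0 - F2 0 * 0)); last by ring.
  rewrite expr2 mulrA; apply: (@disc_mvi _ (fun w => F1 w - F2 0 * w)) => w wz.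
  exists (F2 w - F2 0); first by apply: cdifB => //; apply: dF2; lra.
  by apply: le_trans (f2 _ _) _; [lra|rewrite ler_wpM2l].
exists F1, F2; split=> // z z8.
- rewrite (_ : _ - _ = (F z - F1 0 * z) - (F 0 - F1 0 * 0)); last by ring.
  rewrite expr2 mulrA; apply: (@disc_mvi _ (fun w => F w - F1 0 * w)) => w wz.
  exists (F1 w - F1 0); first by apply: cdifB => //; apply: dF1; lra.
  by apply: le_trans (f1 _ _) _; [lra|rewrite ler_wpM2l].
- rewrite (_ : _ - _ = (F z - F1 0 * z - F2 0 / 2 * (z * z)) - (F 0 - F1 0 * 0 - F2 0 / 2 * (0 * 0)));
    last by ring.
  rewrite [cmod z ^+ 3]exprSr [cauchy3 _ _ * _]mulrA.
  apply: (@disc_mvi _ (fun w => F w - F1 0 * w - F2 0 / 2 * (w * w))) => w wz.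
  exists (F1 w - F1 0 - F2 0 / 2 * (1 * w + w * 1)).
    apply: cdifB; first by apply: cdifB => //; apply: dF1; lra.
    by apply: cdifZ; apply: cdifM; exact: cdif_id.
  rewrite (_ : F2 0 / 2 * _ = F2 0 * w); last by field.
  by apply: le_trans (f12 _ _) _; [lra|rewrite ler_wpM2l // !expr2 ler_pM].
Qed.

(** The removable singularity of [F(w) / w] at [0]. The Taylor expansion of order two shows that the
    extended quotient has derivative [F2 0 / 2] there. *)
Lemma cdif_div_id (R : realType) (F : R[i] -> R[i]) (r : R) l : 0 < r ->
  (forall z, cmod z < r -> exists l, cdif F z l) -> F 0 = 0 -> cdif F 0 l ->
  forall z, cmod z < r -> exists m, cdif (fun w => if w == 0 then l else F w / w) z m.
Proof.
move=> r0 dF F0 dF0 z zr; have [z0|z0] := eqVneq z 0; last first.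
  have [m dm] := dF z zr; have zp : 0 < cmod z by rewrite cmod_gt0.
  eexists; apply: (cdif_ext zp) => [w wz|]; last first.
    by apply: cdifM; [exact: dm|apply: cdifV z0; exact: cdif_id].
  case: eqVneq => // w0; by move: wz; rewrite w0 sub0r cmodN ltxx.
have [d d0 hd] := ccont_bounded (cdif_ccont dF0).
have md : 0 < Num.min r d by rewrite lt_min r0.
have [||||F1 [F2 [dF1 _ _ _ T]]] := @taylor_estimates R F (Num.min r d) (cmod (F 0) + 1) => //.
- by rewrite addr_ge0.
- by move=> w; rewrite lt_min => /andP[w1 _]; exact: dF.
- by move=> w; rewrite lt_min => /andP[_ w1]; apply: hd; rewrite subr0.
have lE : F1 0 = l by apply: cdif_unique dF0; apply: dF1; rewrite cmod0.
set rho := Num.min r d in md T; set C := cauchy3 _ _ in T.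
have C0 : 0 <= C by apply: cauchy3_ge0 => //; exact: addr_ge0.
exists (F2 0 / 2); rewrite z0 => e e0; exists (Num.min (rho / 8) (e / (C + 1))).
  by rewrite lt_min !divr_gt0 //; rlra.
have C1 : 0 < C + 1 by rlra.
move=> w; rewrite subr0 lt_min eqxx => /andP[w1]; rewrite ltr_pdivlMr // => w2; case: eqVneq => [->|w0]; first by rewrite mulr0 !subrr cmod0 mulr0.
have wp : 0 < cmod w by rewrite cmod_gt0.
rewrite -(ler_pM2r wp) -cmodM (_ : _ * w = F w - F 0 - F1 0 * w - F2 0 / 2 * w ^+ 2); last first.
  by rewrite F0 lE; field.
apply: le_trans (T _ (ltW w1)) _.
rewrite !exprSr expr0 mul1r !mulrA ler_wpM2r // ler_wpM2r //; rlra.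
Qed.

(** The Cayley transform [phi = (1 - P) / (1 + P)] of [P = F(z) / z] is bounded by [1] and vanishes
    at [0]. On [|w| <= 1/10], [cauchy_estimate] with radius [9/10] bounds its derivative by [5], so
    [|phi| <= 1/2] there. Then [|P| <= (1 + 1/2) / (1 - 1/2) = 3]. *)
Lemma harnack (R : realType) (F : R[i] -> R[i]) :
  (forall z, cmod z < 1 -> exists l, cdif F z l) -> F 0 = 0 -> cdif F 0 1 ->
  (forall z, z != 0 -> cmod z < 1 -> 0 < Re (F z / z)) ->
  forall z, cmod z <= 10^-1 -> cmod (F z) <= 3 * cmod z.
Proof.
move=> dF F0 dF0 Fpos.
pose P := (fun w => if w == 0 then 1 else F w / w).
have dP := cdif_div_id ltr01 dF F0 dF0; rewrite -/P in dP.
have Ppos z : cmod z < 1 -> 0 < Re (P z).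
  by move=> z1; rewrite /P; case: eqVneq => [_|z0]; [rewrite /= ltr01|exact: Fpos].
pose phi z := (1 - P z) / (1 + P z).
have P1 z : cmod z < 1 -> 1 + P z != 0.
  move=> /Ppos h; apply/negP => /eqP/(congr1 (@complex.Re R)); rewrite ReD /= => h1; rlra.
have phi1 z : cmod z < 1 -> cmod (phi z) <= 1.
  move=> z1; have h := Ppos z z1; have h1 : 0 < cmod (1 + P z) by rewrite cmod_gt0 P1.
  rewrite cmodM cmodV ler_pdivrMr // mul1r -(@ler_pXn2r _ 2) ?nnegrE //.
  rewrite !cmod_sqr !(ReD, ImD, ReN, ImN) /= sub0r add0r sqrrN; move: h; set x := Re _; set y := Im _ => h.
  by rewrite lerD2r !expr2; rlra.
have dphi z : cmod z < 1 -> exists l, cdif phi z l.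
  move=> z1; have [m dm] := dP z z1; eexists; apply: cdifM.
    by apply: cdifB; [exact: cdif_cst|exact: dm].
  by apply: cdifV; [apply: cdifD; [exact: cdif_cst|exact: dm]|exact: P1].
have phi0 : phi 0 = 0 by rewrite /phi /P eqxx subrr mul0r.
move=> z z10; have [->|z0] := eqVneq z 0; first by rewrite F0 !cmod0 mulr0.
have ph : cmod (phi z) <= 2^-1.
  rewrite -[phi z]subr0 -phi0; apply: le_trans (_ : 5 * cmod z <= _); last rlra.
  apply: disc_mvi => w wz; have [|l dl] := dphi w; first rlra.
  exists l => //; apply: le_trans (_ : 4 * 1 / (9 / 10) <= _); last rlra.
  by apply: (@cauchy_estimate _ phi w); [rlra| | |] => // v vw;
    [apply: dphi|apply: phi1]; have := cmodD (v - w) w; rewrite subrK; rlra.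
have z1 : cmod z < 1 by lra.
have h1 : 0 < cmod (1 + P z) by rewrite cmod_gt0 P1.
move: ph; rewrite cmodM cmodV ler_pdivrMr // => ph.
have PE : F z = P z * z by rewrite /P (negbTE z0) divfK.
rewrite PE cmodM ler_wpM2r //.
have := cmodD 1 (P z); have := cmodB 1 (1 - P z); rewrite cmod1 opprB addrC subrK; rlra.
Qed.

(** * Maps of the ball *)

(** The norm of a row vector takes values in [R[i]]; this is the underlying real number, the sup
    norm. It serves for differentiability and componentwise estimates, while [enorm] decides
    membership in the ball. *)
Definition vnorm (R : realType) n (w : 'rV[R[i]]_n) : R := Re `|w|.

Lemma vnormE (R : realType) n (w : 'rV[R[i]]_n) : `|w| = (vnorm w)%:C.
Proof. by rewrite /vnorm RRe_real // realE normr_ge0. Qed.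

Lemma vnorm_ge0 (R : realType) n (w : 'rV[R[i]]_n) : 0 <= vnorm w.
Proof. by rewrite -ler0c -vnormE normr_ge0. Qed.

Lemma cmod_vnorm (R : realType) n (w : 'rV[R[i]]_n) k : cmod (w 0 k) <= vnorm w.
Proof.
rewrite -lecR -normrC -vnormE [leRHS]/Num.norm /= mx_normE.
have -> : `|w 0 k| = (`|w 0 k|%:nng)%:num by [].
rewrite num_le; exact: (@le_bigmax _ _ _ _ (fun ij => `|w ij.1 ij.2|%:nng) (0, k)).
Qed.

Lemma vnorm_le (R : realType) n (w : 'rV[R[i]]_n) r : 0 <= r ->
  (forall k, cmod (w 0 k) <= r) -> vnorm w <= r.
Proof.
move=> r0 H; rewrite -lecR -vnormE; have [->|w0] := eqVneq `|w| 0; first by rewrite ler0c.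
have [[i k] /= wE] := mx_norm_neq0 w0.
by rewrite [leLHS]wE (ord1 i) normrC lecR.
Qed.

Lemma near0P (R : realType) n (P : 'rV[R[i]]_n -> Prop) :
  (\forall h \near (0 : 'rV[R[i]]_n), P h) <->
  exists2 d : R, 0 < d & forall h, vnorm h < d -> P h.
Proof.
split.
  move/nbhs_norm0P => [e /= e0 h]; exists (Re e); first by move: e0; rewrite ltcE => /andP[].
  move=> w wd; apply: h; rewrite /= vnormE.
  by move: e0; rewrite !ltcE /= => /andP[/eqP -> _]; rewrite eqxx.
move=> [d d0 h]; apply/nbhs_norm0P; exists d%:C; first by rewrite /= ltcR.
by move=> w /=; rewrite vnormE ltcR; exact: h.
Qed.

Lemma diff_near (K : numFieldType) (V W : normedModType K) (f : V -> W) x :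
  differentiable f x -> forall e : K, 0 < e ->
  \forall h \near (0 : V), `|f (h + x) - f x - 'd f x h| <= e * `|h|.
Proof.
move=> /diff_locally df e e0.
have /eqaddoP := df; move=> /(_ e e0); apply: filterS => h /=.
by rewrite /cst /= -[X in `|X| <= _]/(f (h + x) - (f x + 'd f x h)) opprD addrA.
Qed.

Lemma near_diff (K : numFieldType) (V W : normedModType K) (f : V -> W) x
    (df : {linear V -> W}) (L : K) : 0 <= L ->
  (forall h, `|df h| <= L * `|h|) ->
  (forall e : K, 0 < e -> \forall h \near (0 : V), `|f (h + x) - f x - df h| <= e * `|h|) ->
  differentiable f x /\ 'd f x = df :> (V -> W).
Proof.
move=> L0 dfL H.
have cdf : continuous df.
  apply/linear_bounded_continuous/linear_boundedP; exists L; split; first exact: ger0_real.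
  by move=> r /= Lr h; apply: le_trans (dfL h) _; rewrite ler_wpM2r // ltW.
have E : f \o shift x = cst (f x) + df +o_ 0 id.
  apply/eqaddoP => e e0; apply: filterS (H e e0) => h.
  by rewrite -[X in _ -> `|X| <= _]/(f (h + x) - (f x + df h)) opprD addrA.
have dE := diff_unique cdf E.
by split=> //; apply/diff_locallyP; rewrite dE.
Qed.

Lemma near_derive (K : numFieldType) (V W : normedModType K) (g : V -> W) x v (l : W) :
  (forall e : K, 0 < e -> \forall h \near (0 : K)^', `|l - h^-1 *: (g (h *: v + x) - g x)| <= e) ->
  'D_v g x = l.
Proof.
move=> H; apply: cvg_lim; first exact: norm_hausdorff.
by apply/cvgrPdist_le => e e0; exact: H.
Qed.

Lemma near0C (R : realType) (P : R[i] -> Prop) (d : R) : 0 < d ->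
  (forall h, h != 0 -> cmod h < d -> P h) -> \forall h \near (0 : R[i])^', P h.
Proof.
move=> d0 H; apply/nbhs_ballP; exists d%:C; first by rewrite /= ltcR.
move=> h; rewrite -ball_normE /= sub0r normrN normrC ltcR => h1 h2; exact: H.
Qed.

(** Turns the directional derivatives of the theorem into one-variable derivatives along a line, to
    which the Cauchy theory applies. *)
Lemma derive_cdif (R : realType) n (g : 'rV[R[i]]_n -> R[i]) x v l :
  cdif (fun w => g (x + w *: v)) 0 l -> 'D_v g x = l.
Proof.
move=> dg; apply: near_derive => e e0.
have er : e = (Re e)%:C by move: e0; rewrite ltcE; case: (e) => a b /= /andP[/eqP ->].
have re0 : 0 < Re e by move: e0; rewrite er ltcR.
have [d d0 h] := dg _ re0.
apply: (near0C d0) => w w0 wd; have := h w; rewrite subr0 scale0r addr0 => /(_ wd) hw.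
rewrite er normrC lecR cmodBC -(ler_pM2r (_ : 0 < cmod w)) ?cmod_gt0 // -cmodM.
rewrite mulrBl -[_ *: _]/(_ * _) mulrAC mulVf // mul1r addrC.
by rewrite addrC [w *: v + x]addrC.
Qed.

Lemma differentiable_eps (R : realType) n m (f : 'rV[R[i]]_n -> 'rV[R[i]]_m) x :
  differentiable f x -> forall e : R, 0 < e -> exists2 d : R, 0 < d &
    forall h, vnorm h < d -> vnorm (f (h + x) - f x - 'd f x h) <= e * vnorm h.
Proof.
move=> df e e0.
have e0' : 0 < e%:C by rewrite ltcR.
have /near0P[d d0 H] := diff_near df e0'.
by exists d => // h /H; rewrite !vnormE -rmorphM lecR.
Qed.

Lemma differentiable_of_eps (R : realType) n m (f : 'rV[R[i]]_n -> 'rV[R[i]]_m) x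
    (df : {linear 'rV[R[i]]_n -> 'rV[R[i]]_m}) (L : R) : 0 <= L ->
  (forall h, vnorm (df h) <= L * vnorm h) ->
  (forall e : R, 0 < e -> exists2 d : R, 0 < d &
    forall h, vnorm h < d -> vnorm (f (h + x) - f x - df h) <= e * vnorm h) ->
  differentiable f x /\ 'd f x = df :> (_ -> _).
Proof.
move=> L0 dfL H; apply: (@near_diff _ _ _ f x df L%:C).
- by rewrite ler0c.
- by move=> h; rewrite !vnormE -rmorphM lecR.
- move=> e e0.
  have er : e = (Re e)%:C by move: e0; rewrite ltcE; case: (e) => a b /= /andP[/eqP ->].
  have re0 : 0 < Re e by move: e0; rewrite er ltcR.
  have [d d0 hd] := H _ re0; apply/near0P; exists d => // h /hd.
  by rewrite {2}er !vnormE -rmorphM lecR.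
Qed.

Lemma vnormZ (R : realType) n (c : R[i]) (w : 'rV[R[i]]_n) : vnorm (c *: w) = cmod c * vnorm w.
Proof. by apply: complexI; rewrite rmorphM /= -normrC -!vnormE normrZ. Qed.

Lemma cdif_line (R : realType) n m (f : 'rV[R[i]]_n -> 'rV[R[i]]_m) x b k z :
  differentiable f (x + z *: b) ->
  cdif (fun w => f (x + w *: b) 0 k) z ('d f (x + z *: b) b 0 k).
Proof.
move=> df e e0.
have B0 : 0 < vnorm b + 1 by rewrite ltr_wpDl ?vnorm_ge0.
have [|d d0 H] := differentiable_eps df (e := e / (vnorm b + 1)); first by rewrite divr_gt0.
exists (d / (vnorm b + 1)); first by rewrite divr_gt0.
move=> w; rewrite ltr_pdivlMr // => wd.
have hw : vnorm ((w - z) *: b) <= cmod (w - z) * (vnorm b + 1).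
  by rewrite vnormZ ler_wpM2l // lerDl.
have := H _ (le_lt_trans hw wd).
rewrite (_ : (w - z) *: b + _ = x + w *: b); last by rewrite scalerBl addrCA subrK.
rewrite linearZ => H1.
apply: le_trans (_ : cmod ((f (x + w *: b) - f (x + z *: b) - (w - z) *: 'd f (x + z *: b) b) 0 k) <= _).
  by rewrite !mxE [_ * (w - z)]mulrC.
apply: le_trans (cmod_vnorm _ _) _; apply: le_trans H1 _.
apply: le_trans (ler_wpM2l _ hw) _; first by rewrite divr_ge0 // ltW.
by rewrite mulrCA mulrC divfK // gt_eqF.
Qed.

(** * The Hermitian product, supporting functionals and the classes [M] and [M_g] *)

Definition hdot (R : realType) n (a b : 'rV[R[i]]_n) : R[i] := \sum_(k < n) a 0 k * (b 0 k)^*%C.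

Lemma enorm_ge0 (R : realType) n (z : 'rV[R[i]]_n) : 0 <= enorm z.
Proof. exact: sqrtr_ge0. Qed.

Lemma enorm_sqr (R : realType) n (z : 'rV[R[i]]_n) : enorm z ^+ 2 = \sum_(k < n) cmod (z 0 k) ^+ 2.
Proof. by rewrite sqr_sqrtr // sumr_ge0 // => k _; rewrite sqr_ge0. Qed.

Lemma enorm_leP (R : realType) n (z : 'rV[R[i]]_n) (r : R) : 0 <= r ->
  (enorm z <= r) = (\sum_(k < n) cmod (z 0 k) ^+ 2 <= r ^+ 2).
Proof. by move=> r0; rewrite -enorm_sqr ler_pXn2r // nnegrE enorm_ge0. Qed.

Lemma enorm_ltP (R : realType) n (z : 'rV[R[i]]_n) (r : R) : 0 <= r ->
  (enorm z < r) = (\sum_(k < n) cmod (z 0 k) ^+ 2 < r ^+ 2).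
Proof. by move=> r0; rewrite -enorm_sqr ltr_pXn2r // nnegrE enorm_ge0. Qed.

Lemma cmod_enorm (R : realType) n (z : 'rV[R[i]]_n) k : cmod (z 0 k) <= enorm z.
Proof.
rewrite -(@ler_pXn2r _ 2) ?nnegrE ?enorm_ge0 // enorm_sqr (bigD1 k) //= lerDl.
by rewrite sumr_ge0 // => i _; rewrite sqr_ge0.
Qed.

Lemma enormZ (R : realType) n (c : R[i]) (z : 'rV[R[i]]_n) : enorm (c *: z) = cmod c * enorm z.
Proof.
apply/eqP; rewrite -(@eqrXn2 _ 2) ?mulr_ge0 ?enorm_ge0 //; apply/eqP.
rewrite exprMn !enorm_sqr mulr_sumr; apply: eq_bigr => k _.
by rewrite !mxE cmodM exprMn.
Qed.

Lemma enorm_eq0 (R : realType) n (z : 'rV[R[i]]_n) : enorm z = 0 -> z = 0.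
Proof.
move=> z0; apply/rowP => k; rewrite mxE; apply/eqP; rewrite -cmod_eq0.
by have := cmod_enorm z k; rewrite z0 => h; rewrite eq_le h cmod_ge0.
Qed.

Lemma enorm_gt0 (R : realType) n (z : 'rV[R[i]]_n) : z != 0 -> 0 < enorm z.
Proof.
move=> z0; rewrite lt0r enorm_ge0 andbT; apply/negP => /eqP/enorm_eq0 h.
by move: z0; rewrite h eqxx.
Qed.

Lemma hdot_self (R : realType) n (z : 'rV[R[i]]_n) : hdot z z = (enorm z ^+ 2)%:C.
Proof. by rewrite enorm_sqr rmorph_sum; apply: eq_bigr => k _; rewrite mulcJ. Qed.

Lemma hdotDl (R : realType) n (a b z : 'rV[R[i]]_n) : hdot (a + b) z = hdot a z + hdot b z.
Proof. by rewrite -big_split; apply: eq_bigr => k _; rewrite mxE mulrDl. Qed.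

Lemma hdotZl (R : realType) n c (a z : 'rV[R[i]]_n) : hdot (c *: a) z = c * hdot a z.
Proof. by rewrite mulr_sumr; apply: eq_bigr => k _; rewrite mxE mulrA. Qed.

Lemma hdotDr (R : realType) n (a b z : 'rV[R[i]]_n) : hdot z (a + b) = hdot z a + hdot z b.
Proof. by rewrite -big_split; apply: eq_bigr => k _; rewrite mxE rmorphD mulrDr. Qed.

Lemma hdotZr (R : realType) n c (a z : 'rV[R[i]]_n) : hdot z (c *: a) = c^*%C * hdot z a.
Proof. by rewrite mulr_sumr; apply: eq_bigr => k _; rewrite mxE rmorphM mulrCA. Qed.

Lemma hdot_delta (R : realType) n (z : 'rV[R[i]]_n) k : hdot z (delta_mx 0 k) = z 0 k.
Proof.
rewrite /hdot (bigD1 k) //= mxE !eqxx -[X in X^*%C]/(1 : R[i]) conjc1 mulr1 big1 ?addr0 // => i ik.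
by rewrite mxE eqxx (negbTE ik) -[X in X^*%C]/(0 : R[i]) conjc0 mulr0.
Qed.

Lemma cmod_sum (R : realType) (I : finType) (F : I -> R[i]) :
  cmod (\sum_k F k) <= \sum_k cmod (F k).
Proof.
elim/big_ind2 : _ => [|x u y v h1 h2|//]; first by rewrite cmod0.
by apply: le_trans (cmodD _ _) _; exact: lerD.
Qed.

(** Follows termwise from [2 x y <= x^2 + y^2]. For vectors of norm at most [1] it is as good as
    Cauchy-Schwarz, which is all that the operator norm of [l_z] asks for. *)
Lemma cmod_hdot_le (R : realType) n (a b : 'rV[R[i]]_n) :
  cmod (hdot a b) <= (enorm a ^+ 2 + enorm b ^+ 2) / 2.
Proof.
apply: le_trans (cmod_sum _) _; rewrite !enorm_sqr -big_split mulr_suml /=.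
apply: ler_sum => k _; rewrite cmodM cmodJ.
move: (cmod _) (cmod _) => x y; have := sqr_ge0 (x - y); rewrite !expr2; lra.
Qed.

Lemma conjcZ (R : realType) (a : R) (x : R[i]) : (a%:C * x)^*%C = a%:C * x^*%C.
Proof. by apply: complex_ext; rewrite !(ReJ, ImJ, ReZ, ImZ) ?mulrN. Qed.

Lemma supporting_exists (R : realType) n (z : 'rV[R[i]]_n) : z != 0 ->
  exists2 l : {linear 'rV[R[i]]_n -> R[i]}, supporting z l &
    forall w, l w = ((enorm z)^-1)%:C * hdot w z.
Proof.
move=> z0; have N0 := enorm_gt0 z0.
pose f (w : 'rV[R[i]]_n) : R[i] := ((enorm z)^-1)%:C * hdot w z.
have lf : linear f.
  by move=> c a b; rewrite /f hdotDl hdotZl mulrDr mulrCA.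
pose l : {linear 'rV[R[i]]_n -> R[i]} := HB.pack f (GRing.isLinear.Build _ _ _ _ f lf).
have lE w : l w = ((enorm z)^-1)%:C * hdot w z by [].
exists l => //; split; last first.
  by rewrite lE hdot_self -rmorphM expr2 mulKf // gt_eqF.
pose u := ((enorm z)^-1)%:C *: z.
have u1 : enorm u = 1 by rewrite enormZ cmodR ger0_norm ?invr_ge0 ?ltW // mulVf // gt_eqF.
have lu w : l w = hdot w u by rewrite lE hdotZr conjc_real.
have ub w : enorm w <= 1 -> cmod (l w) <= 1.
  move=> w1; rewrite lu; apply: le_trans (cmod_hdot_le _ _) _; rewrite u1 expr1n.
  have : enorm w ^+ 2 <= 1 by rewrite expr_le1 // enorm_ge0.
  lra.
apply/eqP; rewrite eq_le; apply/andP; split.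
  apply: ge_sup; first by exists (cmod (l u)), u => //=; rewrite u1.
  by move=> _ [w w1 <-]; exact: ub.
apply: ub_le_sup; first by exists 1 => _ [w w1 <-]; exact: ub.
by exists u; [rewrite /= u1|rewrite lu hdot_self u1 expr1n cmod1].
Qed.

(** Writing [l = <., c>], the operator norm gives [|c| <= 1], and [l z = |z|] is then the equality
    case of Cauchy-Schwarz: the squared norm of [z - |z| c] is at most [0]. So [T(z)] is a singleton
    and the conditions over all [l_z] become conditions on [hdot (h z) z]. *)
Lemma supporting_unique (R : realType) n (z : 'rV[R[i]]_n) (l : {linear 'rV[R[i]]_n -> R[i]}) :
  z != 0 -> supporting z l -> forall w, l w = ((enorm z)^-1)%:C * hdot w z.
Proof.
move=> z0 [l1 lz]; have N0 := enorm_gt0 z0.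
have ub w : enorm w <= 1 -> cmod (l w) <= 1.
  move=> w1; rewrite -l1; apply: ub_le_sup; last by exists w.
  (* A [sup] without an upper bound has the default value [0], so [opnorm l = 1] already says that
     the values are bounded. *)
  apply: contrapT => nub; have : opnorm l = 0 by apply: sup_out => -[].
  by rewrite l1 => /eqP; rewrite oner_eq0.
pose c : 'rV[R[i]]_n := \row_k (l (delta_mx 0 k))^*%C.
have lc w : l w = hdot w c.
  rewrite {1}(row_sum_delta w) linear_sum; apply: eq_bigr => k _.
  by rewrite linearZ !mxE conjcK.
have c1 : enorm c ^+ 2 <= 1.
  have [->|c0] := eqVneq c 0; first by rewrite enorm_sqr big1 ?ler01 // => k _; rewrite mxE cmod0 expr0n.
  have C0 := enorm_gt0 c0.
  have := ub (((enorm c)^-1)%:C *: c); rewrite enormZ lc hdotZl hdot_self -rmorphM !cmodR.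
  rewrite (ger0_norm (_ : 0 <= (enorm c)^-1)) ?invr_ge0 ?enorm_ge0 //.
  rewrite mulVf ?gt_eqF // lexx expr2 mulKf ?gt_eqF // => /(_ isT).
  by rewrite ger0_norm ?enorm_ge0 // => h; rewrite mulr_ile1 ?enorm_ge0.
have key : \sum_(k < n) cmod (z 0 k - (enorm z)%:C * c 0 k) ^+ 2 <= 0.
  have -> : \sum_(k < n) cmod (z 0 k - (enorm z)%:C * c 0 k) ^+ 2 =
     enorm z ^+ 2 - 2 * enorm z * Re (hdot z c) + enorm z ^+ 2 * enorm c ^+ 2.
    rewrite [X in X - _]enorm_sqr [enorm c ^+ 2]enorm_sqr /hdot.
    have -> : Re (\sum_(k < n) z 0 k * (c 0 k)^*%C) = \sum_(k < n) Re (z 0 k * (c 0 k)^*%C).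
      by elim/big_ind2 : _ => // x u y v <- <-; rewrite ReD.
    rewrite !mulr_sumr -sumrN -!big_split /=; apply: eq_bigr => k _.
    rewrite !cmod_sqr !(ReD, ImD, ReN, ImN, ReZ, ImZ, ReM, ImM, ReJ, ImJ) /=; ring.
  rewrite -lc lz /=.
  have := ler_wpM2l (sqr_ge0 (enorm z)) c1; rewrite mulr1 !expr2; lra.
have ck k : (c 0 k)^*%C = ((enorm z)^-1)%:C * (z 0 k)^*%C.
  have /eqP : z 0 k - (enorm z)%:C * c 0 k == 0.
    rewrite -cmod_eq0 -sqrf_eq0 eq_le sqr_ge0 andbT; apply: le_trans key.
    by rewrite (bigD1 k) //= lerDl sumr_ge0 // => i _; rewrite sqr_ge0.
  by move/subr0_eq => ->; rewrite conjcZ mulrA -rmorphM mulVf ?gt_eqF // rmorph1 mul1r.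
by move=> w; rewrite lc mulr_sumr; apply: eq_bigr => k _; rewrite ck mulrCA.
Qed.

Lemma classM_hdot (R : realType) n (h : 'rV[R[i]]_n -> 'rV[R[i]]_n) z :
  classM n h -> enorm z < 1 -> z != 0 -> 0 < Re (hdot (h z) z).
Proof.
move=> [_ _ H] z1 z0; have [l sl lE] := supporting_exists z0.
have := H z l z1 z0 sl; rewrite lE ReZ pmulr_rgt0 // invr_gt0; exact: enorm_gt0.
Qed.

(** [g_alpha] is an involution, so the preimage of [w] is [g_alpha w] itself. It lies in the disc
    because [|1 + (1 - 2 alpha) w|^2 - |1 - w|^2 = 4 (1 - alpha) (Re w - alpha |w|^2)]. *)
Lemma g_alpha_imageP (R : realType) (alpha : R) (w : R[i]) : 0 <= alpha < 1 ->
  (g_alpha alpha @` udisc) w <-> alpha * cmod w ^+ 2 < Re w.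
Proof.
move=> /andP[a0 a1]; split.
  move=> [x x1 <-]; rewrite /udisc /= in x1; rewrite /g_alpha.
  set D := 1 + (1 - 2 * alpha)%:C * x.
  have D0 : 0 < cmod D.
    rewrite cmod_gt0; apply/negP => /eqP D0.
    have : cmod ((1 - 2 * alpha)%:C * x) = 1.
      have -> : (1 - 2 * alpha)%:C * x = - 1 + D by rewrite /D addrA addNr add0r.
      by rewrite D0 addr0 cmodN cmod1.
    rewrite cmodM cmodR; have : `|1 - 2 * alpha| <= 1 by rewrite ler_norml; lra.
    move=> h1 h2; have := cmod_ge0 x; have := ler_wpM2r (cmod_ge0 x) h1; rewrite h2; lra.
  have D2 : 0 < cmod D ^+ 2 by rewrite exprn_gt0.
  have E : (1 - x) / D = ((cmod D ^+ 2)^-1)%:C * ((1 - x) * D^*%C).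
    have -> : ((cmod D ^+ 2)^-1)%:C = (D * D^*%C)^-1 by rewrite mulcJ fmorphV.
    have Dn : D != 0 by rewrite -cmod_gt0.
    by field; rewrite conjc_eq0 Dn.
  rewrite {2}E ReZ cmodM cmodV exprMn exprVn mulrA ltr_pdivrMr // mulrAC mulVf ?gt_eqF // mul1r.
  have : cmod x ^+ 2 < 1 by rewrite expr_lt1.
  rewrite !cmod_sqr /D !(ReD, ImD, ReN, ImN, ReZ, ImZ, ReM, ImM, ReJ, ImJ) /=.
  move: (Re x) (Im x) => u v h.
  have : 0 < (1 - alpha) * (1 - (u ^+ 2 + v ^+ 2)) by rewrite mulr_gt0 //; lra.
  rewrite !expr2; lra.
move=> H; pose D := 1 + (1 - 2 * alpha)%:C * w.
have lt2 : cmod (1 - w) ^+ 2 < cmod D ^+ 2.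
  move: H; rewrite !cmod_sqr /D !(ReD, ImD, ReN, ImN, ReZ, ImZ) /=.
  move: (Re w) (Im w) => u v H; have : 0 < (1 - alpha) * (u - alpha * (u ^+ 2 + v ^+ 2)).
    by rewrite mulr_gt0 //; lra.
  rewrite !expr2; lra.
have lt1 : cmod (1 - w) < cmod D by rewrite -(@ltr_pXn2r _ 2) ?nnegrE.
have D0 : 0 < cmod D by apply: le_lt_trans lt1.
have Dn : D != 0 by rewrite -cmod_gt0.
have a1n : (1 - alpha)%:C != 0 :> R[i] by rewrite -cmod_gt0 cmodR normr_gt0; apply/negP => /eqP; lra.
have two : (2 : R[i]) != 0 by rewrite pnatr_eq0.
exists ((1 - w) / D); first by rewrite /udisc /= cmodM cmodV ltr_pdivrMr // mul1r.
rewrite /g_alpha.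
have e1 : 1 - (1 - w) / D = 2 * (1 - alpha)%:C * w / D.
  rewrite -{1}(divff Dn) -mulrBl; congr (_ / _); rewrite /D !rmorphB !rmorphM /= rmorph1 rmorph_nat; ring.
have e2 : 1 + (1 - 2 * alpha)%:C * ((1 - w) / D) = 2 * (1 - alpha)%:C / D.
  rewrite mulrA -{1}(divff Dn) -mulrDl; congr (_ / _); rewrite /D !rmorphB !rmorphM /= rmorph1 rmorph_nat; ring.
by rewrite e1 e2; field; move: a1n; rewrite Dn rmorphB rmorph1.
Qed.

Lemma classMg_hdot (R : realType) n (alpha : R) (h : 'rV[R[i]]_n -> 'rV[R[i]]_n) z :
  0 <= alpha < 1 -> classMg n (g_alpha alpha) h -> enorm z < 1 -> z != 0 ->
  alpha * cmod (((enorm z ^+ 2)^-1)%:C * hdot (h z) z) ^+ 2 < Re (((enorm z ^+ 2)^-1)%:C * hdot (h z) z).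
Proof.
move=> al [_ _ H] z1 z0; have [l sl lE] := supporting_exists z0.
have /(g_alpha_imageP _ al) := H z l z1 z0 sl.
by rewrite lE mulrA -rmorphM -invfM -expr2.
Qed.

Lemma classMg_intro (R : realType) n (alpha : R) (h : 'rV[R[i]]_n -> 'rV[R[i]]_n) :
  0 <= alpha < 1 -> hol n h -> normalized h ->
  (forall z, enorm z < 1 -> z != 0 ->
    alpha * cmod (((enorm z ^+ 2)^-1)%:C * hdot (h z) z) ^+ 2 < Re (((enorm z ^+ 2)^-1)%:C * hdot (h z) z)) ->
  classMg n (g_alpha alpha) h /\ classM n h.
Proof.
move=> al hh nh H; split; split => // z l z1 z0 sl; rewrite (supporting_unique z0 sl).
  by apply/(g_alpha_imageP _ al); rewrite mulrA -rmorphM -invfM -expr2; exact: H.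
have N0 := enorm_gt0 z0.
have := H z z1 z0; rewrite ReZ => h1.
have : 0 < (enorm z ^+ 2)^-1 * Re (hdot (h z) z).
  by apply: le_lt_trans h1; rewrite mulr_ge0 ?sqr_ge0 //; case/andP: al.
by rewrite pmulr_rgt0 ?invr_gt0 ?exprn_gt0 // => h2; rewrite ReZ mulr_gt0 ?invr_gt0.
Qed.

Lemma cdif_sum (R : realType) (I : finType) (F : I -> R[i] -> R[i]) (l : I -> R[i]) z :
  (forall k, cdif (F k) z (l k)) -> cdif (fun w => \sum_k F k w) z (\sum_k l k).
Proof.
move=> H; elim: (index_enum I) => [|k s IH].
  by rewrite big_nil; apply: cdif_ext ltr01 _ (cdif_cst 0 z) => w _; rewrite big_nil.
rewrite big_cons; apply: cdif_ext ltr01 _ (cdifD (H k) IH) => w _.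
by rewrite big_cons.
Qed.

Lemma cdif_hdot_line (R : realType) n (h : 'rV[R[i]]_n -> 'rV[R[i]]_n) x b c z :
  differentiable h (x + z *: b) ->
  cdif (fun w => hdot (h (x + w *: b)) c) z (hdot ('d h (x + z *: b) b) c).
Proof.
move=> dh; apply: cdif_sum => k.
have := cdifZ ((c 0 k)^*%C) (@cdif_line _ _ _ h x b k z dh).
by rewrite mulrC; apply: cdif_ext ltr01 _ => w _; rewrite mulrC.
Qed.

(** The chain rule along a parabola, with velocity [v = b1 + 2 z b2]. This is the curve of
    [classMg_mean], where the component along [e_i] runs with weight two so that it meets the
    quadratic term in [z_j]. *)
Lemma cdif_quadratic (R : realType) n m (f : 'rV[R[i]]_n -> 'rV[R[i]]_m) b1 b2 k z :
  differentiable f (z *: b1 + z ^+ 2 *: b2) ->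
  exists l, cdif (fun w => f (w *: b1 + w ^+ 2 *: b2) 0 k) z l.
Proof.
move=> df; set x := z *: b1 + z ^+ 2 *: b2 in df.
set v := b1 + (2 * z) *: b2.
exists ('d f x v 0 k) => e e0.
set B := vnorm v + vnorm b2 + 1; set D := cmod ('d f x b2 0 k) + 1.
have B0 : 0 < B by rewrite ltr_wpDl ?addr_ge0 ?vnorm_ge0.
have D0 : 0 < D by rewrite ltr_wpDl.
have [|d d0 H] := differentiable_eps df (e := e / 2 / B); first by rewrite !divr_gt0.
exists (Num.min (Num.min 1 (d / B)) (e / 2 / D)); first by rewrite !lt_min !divr_gt0 // ltr01.
move=> w; rewrite !lt_min => /andP[/andP[w1]]; rewrite !ltr_pdivlMr // => w2 w3.
set t := w - z in w1 w2 w3 *.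
have E : w *: b1 + w ^+ 2 *: b2 = (t *: v + t ^+ 2 *: b2) + x.
  rewrite /x /v /t; apply/rowP => l; rewrite !mxE; ring.
have hB : vnorm (t *: v + t ^+ 2 *: b2) <= cmod t * B.
  apply: vnorm_le => [|l]; first by rewrite mulr_ge0 // ltW.
  rewrite !mxE; apply: le_trans (cmodD _ _) _; rewrite !cmodM.
  have v1 : cmod t * cmod (b1 0 l + 2 * z * b2 0 l) <= cmod t * vnorm v.
    by rewrite ler_wpM2l //; have := cmod_vnorm v l; rewrite /v !mxE.
  have v2 : cmod t * cmod t * cmod (b2 0 l) <= cmod t * vnorm b2.
    rewrite -mulrA ler_wpM2l //; apply: le_trans (cmod_vnorm b2 l).
    by rewrite ler_piMl // ltW.
  rewrite /B; have := cmod_ge0 t; lra.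
have := H _ (le_lt_trans hB w2); rewrite -E => H1.
have H2 := le_trans (cmod_vnorm _ k) (le_trans H1 (ler_wpM2l (divr_ge0 (divr_ge0 (ltW e0) (ler0n R 2)) (ltW B0)) hB)).
rewrite (_ : _ - _ - _ = (f (w *: b1 + w ^+ 2 *: b2) - f x - 'd f x (t *: v + t ^+ 2 *: b2)) 0 k
   + t ^+ 2 * 'd f x b2 0 k); last first.
  have -> : 'd f x (t *: v + t ^+ 2 *: b2) = t *: 'd f x v + t ^+ 2 *: 'd f x b2.
    by rewrite linearD !linearZ.
  by rewrite -/x !mxE; ring.
apply: le_trans (cmodD _ _) _.
have H3 : e / 2 / B * (cmod t * B) = e / 2 * cmod t by field; rewrite gt_eqF.
rewrite H3 in H2.
have H4 : cmod (t ^+ 2 * 'd f x b2 0 k) <= e / 2 * cmod t.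
  rewrite cmodM cmodX expr2 -mulrA mulrC ler_wpM2r //.
  have : cmod t * cmod ('d f x b2 0 k) <= cmod t * D by rewrite ler_wpM2l // lerDl.
  lra.
lra.
Qed.

Lemma hol_differentiable (R : realType) n (h : 'rV[R[i]]_n -> 'rV[R[i]]_n) z :
  hol n h -> enorm z < 1 -> differentiable h z.
Proof. by move=> hh z1; exact: hh. Qed.

(** On the complex line through the unit vector [w = z / |z|], the function [F(x) = <h(x w), w>]
    satisfies the hypotheses of [harnack]: the conjugate of [x] times [F(x)] is [<h(x w), x w>],
    whose real part is positive. *)
Lemma classM_numrange (R : realType) n (h : 'rV[R[i]]_n -> 'rV[R[i]]_n) z :
  classM n h -> enorm z <= 10^-1 -> cmod (hdot (h z) z) <= 3 * enorm z ^+ 2.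
Proof.
move=> hM z10; have [hh [h0 dh0] _] := hM.
have [->|z0] := eqVneq z 0.
  rewrite /hdot big1 ?cmod0; first by rewrite mulr_ge0 ?sqr_ge0 //; lra.
  by move=> k _; rewrite [(0 : 'rV_n) 0 k]mxE conjc0 mulr0.
have N0 := enorm_gt0 z0; pose w := ((enorm z)^-1)%:C *: z.
have w1 : enorm w = 1 by rewrite enormZ cmodR ger0_norm ?invr_ge0 ?ltW // mulVf // gt_eqF.
have sw x : enorm (0 + x *: w) = cmod x by rewrite add0r enormZ w1 mulr1.
have zE : z = (enorm z)%:C *: w by rewrite scalerA -rmorphM mulfV ?gt_eqF // scale1r.
pose F x := hdot (h (0 + x *: w)) w.
have dF x : cmod x < 1 -> cdif F x (hdot ('d h (0 + x *: w) w) w).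
  by move=> x1; apply: cdif_hdot_line; apply: hol_differentiable; rewrite ?sw.
have := @harnack R F _ _ _ _ (enorm z)%:C; rewrite cmodR ger0_norm ?enorm_ge0 //.
have -> : hdot (h z) z = (enorm z)%:C * hdot (h z) w by rewrite {2}zE hdotZr conjc_real.
rewrite cmodM cmodR ger0_norm ?enorm_ge0 // => H.
rewrite expr2 mulrCA ler_pM2l //.
have FE : F (enorm z)%:C = hdot (h z) w by rewrite /F add0r -zE.
move: H; rewrite FE; apply => //.
- by move=> x x1; eexists; exact: dF.
- by rewrite /F scale0r addr0 h0 /hdot big1 // => k _; rewrite mxE mul0r.
- have := dF 0; rewrite cmod0 scale0r addr0 => /(_ ltr01).
  by rewrite dh0 hdot_self w1 expr1n.
- move=> x x0 x1; have xw0 : 0 + x *: w != 0.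
    by apply/negP => /eqP/(congr1 (@enorm R n)); rewrite sw => /eqP; rewrite /enorm big1 ?sqrtr0 ?cmod_eq0 ?(negbTE x0) // => k _; rewrite mxE cmod0 expr0n.
  have := classM_hdot hM (z := 0 + x *: w); rewrite sw => /(_ x1 xw0).
  rewrite {2}add0r hdotZr -/(F x) => H.
  have x2 : 0 < cmod x ^+ 2 by rewrite exprn_gt0 // cmod_gt0.
  have -> : F x / x = ((cmod x ^+ 2)^-1)%:C * (x^*%C * F x).
    have -> : ((cmod x ^+ 2)^-1)%:C = (x * x^*%C)^-1 by rewrite mulcJ fmorphV.
    by field; rewrite conjc_eq0 x0.
  by rewrite ReZ mulr_gt0 // invr_gt0.
Qed.

Lemma enorm_sqrD (R : realType) n (a b : 'rV[R[i]]_n) :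
  enorm (a + b) ^+ 2 <= 2 * (enorm a ^+ 2 + enorm b ^+ 2).
Proof.
rewrite !enorm_sqr -big_split mulr_sumr; apply: ler_sum => k _ /=; rewrite mxE.
have h : cmod (a 0 k + b 0 k) ^+ 2 <= (cmod (a 0 k) + cmod (b 0 k)) ^+ 2.
  by rewrite ler_pXn2r ?nnegrE ?addr_ge0 // cmodD.
apply: le_trans h _; have := sqr_ge0 (cmod (a 0 k) - cmod (b 0 k)); rewrite !expr2; lra.
Qed.

Lemma enorm_delta (R : realType) n (k : 'I_n) : enorm (delta_mx 0 k : 'rV[R[i]]_n) = 1.
Proof.
rewrite /enorm (bigD1 k) //= mxE !eqxx big1 ?addr0; last first.
  by move=> l lk; rewrite mxE eqxx (negbTE lk) cmod0 expr0n.
by rewrite -[X in cmod X]/(1 : R[i]) cmod1 expr1n sqrtr1.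
Qed.

(* On the circle [|l| = 1] the function [l <h(z), w> + d h_k(z)], with [z = w + l d e_k], equals [l <h(z), z>] because [l^-1] is the conjugate of [l]; at [l = 0] it is [d h_k(w)]. *)
Lemma classM_bound (R : realType) n (h : 'rV[R[i]]_n -> 'rV[R[i]]_n) w k :
  classM n h -> enorm w <= 20^-1 -> cmod (h w 0 k) <= 1.
Proof.
move=> hM w20; have [hh _ _] := hM.
pose b : 'rV[R[i]]_n := (20^-1)%:C *: delta_mx 0 k.
have b20 : enorm b = 20^-1 by rewrite enormZ enorm_delta mulr1 cmodR ger0_norm // invr_ge0.
have hb x : hdot x b = (20^-1)%:C * x 0 k by rewrite hdotZr conjc_real hdot_delta.
have wsq : enorm w ^+ 2 <= 20^-1 ^+ 2 by rewrite ler_pXn2r ?nnegrE ?enorm_ge0 // invr_ge0.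
have nz l : cmod l <= 2 -> enorm (w + l *: b) ^+ 2 <= 2 * ((1 + cmod l ^+ 2) * 20^-1 ^+ 2).
  move=> l2; apply: le_trans (enorm_sqrD _ _) _; rewrite enormZ b20 exprMn; lra.
have ball l : cmod l < 2 -> enorm (w + l *: b) < 1.
  move=> l2; rewrite -(@ltr_pXn2r _ 2) ?nnegrE ?enorm_ge0 // expr1n.
  apply: le_lt_trans (nz _ (ltW l2)) _.
  have : cmod l ^+ 2 < 2 ^+ 2 by rewrite ltr_pXn2r ?nnegrE.
  rewrite !expr2; lra.
pose G l := l * hdot (h (w + l *: b)) w + hdot (h (w + l *: b)) b.
have dG l : cmod l < 2 -> exists m, cdif G l m.
  move=> /ball l2; eexists; apply: cdifD; first apply: cdifM; first exact: cdif_id.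
    by apply: cdif_hdot_line; apply: hol_differentiable.
  by apply: cdif_hdot_line; apply: hol_differentiable.
(* On the unit circle [|z|^2 <= 4 / 400], so [classM_numrange] applies and yields [12 / 400]. As
   [G 0] is [h_k(w) / 20], this gives [|h_k(w)| <= 0.6]. *)
have : cmod (G 0) <= 3 * (2 * (2 * 20^-1 ^+ 2)).
  apply: (@center_cmod_le _ G 1 2) => //; first lra.
  - by move=> l _; exact: dG.
  - by have [|m dm] := dG 0; [rewrite cmod0|exact: cdif_ccont dm].
  - move=> l l1; have nl : enorm (w + l *: b) ^+ 2 <= 2 * (2 * 20^-1 ^+ 2).
      by apply: le_trans (nz _ _) _; rewrite l1 ?expr1n //; lra.
    have -> : G l = l * hdot (h (w + l *: b)) (w + l *: b).
      rewrite /G hdotDr hdotZr mulrDr mulrA mulcJ l1 expr1n mul1r //.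
    rewrite cmodM l1 mul1r; apply: le_trans (classM_numrange hM _) _.
      rewrite -(@ler_pXn2r _ 2) ?nnegrE ?enorm_ge0 ?invr_ge0 //.
      by apply: le_trans nl _; rewrite !expr2; lra.
    by rewrite ler_wpM2l.
rewrite /G mul0r add0r scale0r addr0 hb cmodM cmodR ger0_norm ?invr_ge0 // !expr2; lra.
Qed.

(** * Expansions at the origin with uniform constants *)

Lemma enorm_le_vnorm (R : realType) n (z : 'rV[R[i]]_n) : enorm z <= n%:R * vnorm z.
Proof.
case: n z => [|n] z; first by rewrite /enorm big_ord0 sqrtr0 mul0r.
rewrite enorm_leP ?mulr_ge0 ?vnorm_ge0 //.
apply: le_trans (_ : \sum_(k < n.+1) vnorm z ^+ 2 <= _).
  by apply: ler_sum => k _; rewrite ler_pXn2r ?nnegrE ?vnorm_ge0 // cmod_vnorm.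
rewrite sumr_const card_ord exprMn -[leLHS]mulr_natl ler_wpM2r ?sqr_ge0 //.
by rewrite -natrX ler_nat -mulnn leq_pmulr.
Qed.

(** The radius and the bound are parameters, so that one pair can serve all the fields [h(., t)] at
    once. The domain is a polydisc, since only components and lines through the origin or near it
    are expanded. *)
Definition bounded_germ (R : realType) n (r M : R) (h : 'rV[R[i]]_n -> 'rV[R[i]]_n) : Prop :=
  [/\ forall z, vnorm z < r -> differentiable h z, normalized h &
      forall z k, vnorm z < r -> cmod (h z 0 k) <= M].

Lemma classM_germ (R : realType) n (h : 'rV[R[i]]_n -> 'rV[R[i]]_n) :
  classM n h -> bounded_germ (20^-1 / (n%:R + 1)) 1 h.
Proof.
move=> hM; have [hh nh _] := hM.
have n1 : 0 < n%:R + 1 :> R by rewrite ltr_wpDl.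
have H (z : 'rV[R[i]]_n) : vnorm z < 20^-1 / (n%:R + 1) -> enorm z <= 20^-1.
  move=> zr; apply: le_trans (enorm_le_vnorm z) _.
  move: zr; rewrite ltr_pdivlMr // => zr; have := vnorm_ge0 z; lra.
split=> // z; first by move=> /H z1; apply: hol_differentiable => //; lra.
by move=> k /H z1; exact: classM_bound.
Qed.

(** For a single map, the radius and the bound come from differentiability at the origin. They
    depend on the map, in contrast with [classM_germ]. *)
Lemma hol_germ (R : realType) n (h : 'rV[R[i]]_n -> 'rV[R[i]]_n) :
  hol n h -> normalized h -> exists r M : R, [/\ 0 < r, 0 <= M & bounded_germ r M h].
Proof.
move=> hh nh; have n1 : 0 < n%:R + 1 :> R by rewrite ltr_wpDl.
have d0 : differentiable h 0 by apply: hol_differentiable => //; rewrite /enorm big1 ?sqrtr0 // => k _; rewrite mxE cmod0 expr0n.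
have [d dpos H] := differentiable_eps d0 (ltr01).
exists (Num.min d (2^-1 / (n%:R + 1))), (2 * d); split; first by rewrite lt_min dpos !divr_gt0.
  by rewrite mulr_ge0 // ltW.
split; [move=> z|exact: nh|move=> z k]; rewrite lt_min.
  move=> /andP[_ z1]; apply: hol_differentiable => //.
  apply: le_lt_trans (enorm_le_vnorm z) _.
  move: z1; rewrite ltr_pdivlMr //; have := vnorm_ge0 z; lra.
move=> /andP[z1 _]; have [h0 dh0] := nh; have := H z z1; rewrite addr0 h0 subr0 dh0 mul1r => H1.
have := le_trans (cmod_vnorm _ k) H1; rewrite !mxE => H2.
have := cmodD (h z 0 k - z 0 k) (z 0 k); rewrite subrK; have := cmod_vnorm z k; lra.
Qed.

Lemma germ_line (R : realType) n (r M : R) (h : 'rV[R[i]]_n -> 'rV[R[i]]_n) u k :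
  0 < r -> 0 <= M -> bounded_germ r M h -> vnorm u <= 1 ->
  exists F2 : R[i] -> R[i],
  [/\ forall z, cmod z < r -> cdif (fun w => 'd h (w *: u) u 0 k) z (F2 z),
      forall z, cmod z < r -> cdif (fun w => h (w *: u) 0 k) z ('d h (z *: u) u 0 k),
      forall z, cmod z <= r / 8 -> cmod (h (z *: u) 0 k - z * u 0 k) <= cauchy2 r M * cmod z ^+ 2,
      forall z, cmod z <= r / 8 ->
        cmod ('d h (z *: u) u 0 k - u 0 k - F2 0 * z) <= cauchy3 r M * cmod z ^+ 2 &
      forall z, cmod z <= r / 8 ->
        cmod (h (z *: u) 0 k - z * u 0 k - F2 0 / 2 * z ^+ 2) <= cauchy3 r M * cmod z ^+ 3].
Proof.
move=> r0 M0 [dh [h0 dh0] hM] u1.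
have zu z : cmod z < r -> vnorm (z *: u) < r.
  by move=> zr; apply: le_lt_trans zr; rewrite vnormZ ler_piMr.
have dF z : cmod z < r -> cdif (fun w => h (w *: u) 0 k) z ('d h (z *: u) u 0 k).
  move=> zr; have := @cdif_line _ _ _ h 0 u k z; rewrite add0r => /(_ (dh _ (zu _ zr))).
  by apply: cdif_ext ltr01 _ => w _; rewrite add0r.
have [||F1 [F2 [dF1 dF2 T1 T2 T3]]] := taylor_estimates (F := fun w => h (w *: u) 0 k) r0 M0.
- by move=> z zr; eexists; exact: dF.
- by move=> z zr; apply: hM; exact: zu.
have FE z : cmod z < r -> F1 z = 'd h (z *: u) u 0 k.
  by move=> zr; exact: cdif_unique (dF1 z zr) (dF z zr).
have F10 : F1 0 = u 0 k by rewrite FE ?cmod0 // scale0r dh0.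
have F00 : h (0 *: u) 0 k = 0 by rewrite scale0r h0 mxE.
have r8 : r / 8 < r by lra.
exists F2; split => //.
- move=> z zr; have p : 0 < r - cmod z by rewrite subr_gt0.
  apply: (cdif_ext p _ (dF2 z zr)) => w wz; apply: FE.
  by have := cmodD (w - z) z; rewrite subrK; lra.
- by move=> z zr; have := T1 z zr; rewrite F00 F10 subr0 mulrC.
- by move=> z zr; have := T2 z zr; rewrite F10 FE //; exact: le_lt_trans zr r8.
- by move=> z zr; have := T3 z zr; rewrite F00 F10 subr0 [u 0 k * z]mulrC.
Qed.

Lemma germ_linear_approx (R : realType) n (r M : R) (h : 'rV[R[i]]_n -> 'rV[R[i]]_n) z k :
  0 < r -> 0 <= M -> bounded_germ r M h -> vnorm z <= r / 8 ->
  cmod (h z 0 k - z 0 k) <= cauchy2 r M * vnorm z ^+ 2.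
Proof.
move=> r0 M0 H z8; have [z0|z0] := eqVneq (vnorm z) 0.
  have -> : z = 0.
    by apply/rowP => l; rewrite mxE; apply/eqP; rewrite -cmod_eq0 eq_le cmod_ge0 -z0 cmod_vnorm.
  by have [_ [-> _] _] := H; rewrite subrr cmod0 mulr_ge0 ?sqr_ge0 // cauchy2_ge0.
have p : 0 < vnorm z by rewrite lt0r z0 vnorm_ge0.
have [|F2 [_ _ T _ _]] := @germ_line _ _ r M h (((vnorm z)^-1)%:C *: z) k r0 M0 H.
  by rewrite vnormZ cmodR ger0_norm ?invr_ge0 ?vnorm_ge0 // mulVf.
have := T (vnorm z)%:C; rewrite cmodR ger0_norm ?vnorm_ge0 // => /(_ z8).
by rewrite mxE mulrA scalerA -rmorphM mulfV // rmorph1 mul1r scale1r.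
Qed.

(** [h - id] is at most [K (2 s)^2] on the polydisc of radius [2 s], where [K] is [cauchy2 r M]. The
    line [x + w v] stays there for [|w| < s / |v|], so [cauchy_estimate] gives
    [4 K (2 s)^2 |v| / s]. *)
Lemma germ_diff_estimate (R : realType) n (r M s : R) (h : 'rV[R[i]]_n -> 'rV[R[i]]_n) x v k :
  0 < r -> 0 <= M -> bounded_germ r M h -> 0 < s -> s <= r / 16 -> vnorm x <= s ->
  cmod ('d h x v 0 k - v 0 k) <= 16 * cauchy2 r M * s * vnorm v.
Proof.
move=> r0 M0 H s0 s16 xs; have [dh _ _] := H.
have K0 := cauchy2_ge0 r0 M0.
have [v0|v0] := eqVneq (vnorm v) 0.
  have -> : v = 0.
    by apply/rowP => l; rewrite mxE; apply/eqP; rewrite -cmod_eq0 eq_le cmod_ge0 -v0 cmod_vnorm.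
  rewrite linear0 subrr cmod0; apply: mulr_ge0 (vnorm_ge0 _).
  by apply: mulr_ge0 (ltW s0); apply: mulr_ge0.
have p : 0 < vnorm v by rewrite lt0r v0 vnorm_ge0.
have xw w : cmod (w - 0) < s / vnorm v -> vnorm (x + w *: v) <= 2 * s.
  rewrite subr0 ltr_pdivlMr // => ws; apply: vnorm_le; first lra.
  move=> l; rewrite !mxE; apply: le_trans (cmodD _ _) _; rewrite cmodM.
  have := ler_wpM2l (cmod_ge0 w) (cmod_vnorm v l); have := cmod_vnorm x l; lra.
have dg w : cmod (w - 0) < s / vnorm v ->
    cdif (fun w => h (x + w *: v) 0 k - (x 0 k + w * v 0 k)) w ('d h (x + w *: v) v 0 k - (0 + (1 * v 0 k + w * 0))).
  move=> /xw w1; apply: cdifB; first by apply: cdif_line; apply: dh; lra.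
  apply: cdifD; first exact: cdif_cst.
  by apply: cdifM; [exact: cdif_id|exact: cdif_cst].
have -> : 16 * cauchy2 r M * s * vnorm v = 4 * (cauchy2 r M * (2 * s) ^+ 2) / (s / vnorm v).
  by field; rewrite !gt_eqF.
apply: (@cauchy_estimate _ (fun w => h (x + w *: v) 0 k - (x 0 k + w * v 0 k)) 0).
- exact: divr_gt0.
- by move=> w w1; eexists; exact: dg.
- move=> w /xw w1; have := @germ_linear_approx _ _ r M h (x + w *: v) k r0 M0 H.
  rewrite !mxE => /(_ _)/le_trans; apply; first lra.
  by rewrite ler_wpM2l // ler_pXn2r ?nnegrE ?vnorm_ge0 //; lra.
- have := dg 0; rewrite subrr cmod0 scale0r addr0 mul1r mul0r addr0 add0r; apply.
  exact: divr_gt0.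
Qed.

Lemma germ_increment (R : realType) n (r M s : R) (h : 'rV[R[i]]_n -> 'rV[R[i]]_n) x y k :
  0 < r -> 0 <= M -> bounded_germ r M h -> 0 < s -> s <= r / 16 -> vnorm x <= s -> vnorm y <= s ->
  cmod ((h y 0 k - y 0 k) - (h x 0 k - x 0 k)) <= 16 * cauchy2 r M * s * vnorm (y - x).
Proof.
move=> r0 M0 H s0 s16 xs ys; have [dh _ _] := H.
pose g w := h (x + w *: (y - x)) 0 k - (x 0 k + w * (y - x) 0 k).
have -> : (h y 0 k - y 0 k) - (h x 0 k - x 0 k) = g 1 - g 0.
  by rewrite /g scale1r scale0r addr0 addrCA subrr addr0 !mxE; ring.
have := @cdif_mvi R g 0 1 (16 * cauchy2 r M * s * vnorm (y - x)).
rewrite subr0 cmod1 mulr1; apply => t t01; rewrite add0r mulr1.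
have tn : vnorm (x + t%:C *: (y - x)) <= s.
  apply: vnorm_le; first exact: ltW.
  move=> l; rewrite !mxE; apply: cmod_segment => //.
    exact: le_trans (cmod_vnorm _ _) xs.
  exact: le_trans (cmod_vnorm _ _) ys.
exists ('d h (x + t%:C *: (y - x)) (y - x) 0 k - (0 + (1 * (y - x) 0 k + t%:C * 0))).
  apply: cdifB; first by apply: cdif_line; apply: dh; lra.
  apply: cdifD; first exact: cdif_cst.
  by apply: cdifM; [exact: cdif_id|exact: cdif_cst].
rewrite mulr0 addr0 add0r mul1r; exact: germ_diff_estimate.
Qed.

Definition coef2 (R : realType) n (i j : 'I_n) (f : 'rV[R[i]]_n -> 'rV[R[i]]_n) : R[i] :=
  2^-1 * 'D_(delta_mx 0 j) ('D_(delta_mx 0 j) (fun z : 'rV[R[i]]_n => f z 0 i)) 0.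

Lemma vnorm_delta (R : realType) n (k : 'I_n) : vnorm (delta_mx 0 k : 'rV[R[i]]_n) <= 1.
Proof. by apply: vnorm_le => // l; rewrite -(enorm_delta R k) cmod_enorm. Qed.

(** As [i != j], the linear term of the [i]-th component vanishes on the [j]-axis, and the
    coefficient is the leading one there. *)
Lemma germ_coef2 (R : realType) n (r M : R) (h : 'rV[R[i]]_n -> 'rV[R[i]]_n) (i j : 'I_n) :
  i != j -> 0 < r -> 0 <= M -> bounded_germ r M h ->
  [/\ cdif (fun w => 'd h (w *: delta_mx 0 j) (delta_mx 0 j) 0 i) 0 (2 * coef2 i j h),
      forall z, cmod z <= r / 8 ->
        cmod ('d h (z *: delta_mx 0 j) (delta_mx 0 j) 0 i - 2 * coef2 i j h * z)
           <= cauchy3 r M * cmod z ^+ 2 &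
      forall z, cmod z <= r / 8 ->
        cmod (h (z *: delta_mx 0 j) 0 i - coef2 i j h * z ^+ 2) <= cauchy3 r M * cmod z ^+ 3].
Proof.
move=> ij r0 M0 H.
have [F2 [d1 d2 _ T2 T3]] := germ_line i r0 M0 H (vnorm_delta R j).
have [dh _ _] := H.
have eij : (delta_mx 0 j : 'rV[R[i]]_n) 0 i = 0 by rewrite mxE eqxx (negbTE ij).
have D1 w : cmod w < r -> 'D_(delta_mx 0 j) (fun z : 'rV[R[i]]_n => h z 0 i) (w *: delta_mx 0 j)
    = 'd h (w *: delta_mx 0 j) (delta_mx 0 j) 0 i.
  move=> wr; apply: derive_cdif.
  have := @cdif_line _ _ _ h (w *: delta_mx 0 j) (delta_mx 0 j) i 0.
  rewrite scale0r addr0; apply; apply: dh; apply: le_lt_trans wr.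
  by rewrite vnormZ ler_piMr // vnorm_delta.
have c2 : 2 * coef2 i j h = F2 0.
  rewrite /coef2 mulrA mulfV ?pnatr_eq0 // mul1r; apply: derive_cdif.
  have := d1 0; rewrite cmod0 => /(_ r0); apply: (cdif_ext r0) => w; rewrite subr0 => wr.
  by rewrite add0r D1.
have c1 : coef2 i j h = F2 0 / 2 by rewrite -c2 mulrC mulKf // pnatr_eq0.
split.
- by rewrite c2; apply: d1; rewrite cmod0.
- by move=> z zr; have := T2 z zr; rewrite eij subr0 c2.
- by move=> z zr; have := T3 z zr; rewrite eij mulr0 subr0 c1.
Qed.

(** * Coefficient bounds *)

(** Replaces the passage [r -> 1] by the inequality [(1 - t)^4 >= 1 - 4 t]. The exponent is the one
    that multiplies the coefficient in [classMg_mean]. *)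
Lemma le_of_scaled (R : realType) (X Y : R) : 0 <= X ->
  (forall r, 0 < r -> r < 1 -> X * r ^+ 4 <= Y) -> X <= Y.
Proof.
move=> X0 H; apply/ler_addgt0Pr => e e0.
have X1 : 0 < 4 * X + 1 by lra.
pose t := Num.min 2^-1 (e / (4 * X + 1)).
have t0 : 0 < t by rewrite lt_min divr_gt0 // invr_gt0 ltr0n.
have t1 : t <= 2^-1 by rewrite ge_min lexx.
have t2 : t * (4 * X + 1) <= e by rewrite -ler_pdivlMr // ge_min lexx orbT.
have := H (1 - t) _ _; have -> : 0 < 1 - t by lra. have -> : 1 - t < 1 by lra.
move=> /(_ isT isT) h.
have b1 : 1 - 2 * t <= (1 - t) ^+ 2 by rewrite expr2; have := sqr_ge0 t; rewrite expr2; lra.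
have b2 : 1 - 4 * t <= (1 - t) ^+ 4.
  apply: le_trans (_ : (1 - 2 * t) ^+ 2 <= _).
    by rewrite expr2; have := sqr_ge0 t; rewrite expr2; lra.
  by rewrite (_ : 4%N = (2 * 2)%N) // exprM ler_pXn2r // nnegrE ?sqr_ge0 //; lra.
have := ler_wpM2l X0 b2; lra.
Qed.

(* With [z = a l^2 c e_i + b l e_j] and [|l| = r], replacing the conjugate of [l] by [r^2 / l] makes <h(z), z> holomorphic in [l]; its value at [l = 0] only retains the coefficient of [z_j^2] in [h_i]. *)
Lemma classMg_mean (R : realType) n (alpha a b r : R) (c : R[i]) (h : 'rV[R[i]]_n -> 'rV[R[i]]_n)
    (i j : 'I_n) : i != j -> 0 <= alpha < 1 -> classM n h -> classMg n (g_alpha alpha) h ->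
  0 < a -> 0 < b -> a ^+ 2 + b ^+ 2 = 1 -> cmod c = 1 -> 0 < r -> r < 1 ->
  let N := a ^+ 2 * r ^+ 4 + b ^+ 2 * r ^+ 2 in
  let V := N + a * b ^+ 2 * r ^+ 4 * Re (c^*%C * coef2 i j h) in
  0 <= V /\ alpha * V <= N.
Proof.
move=> ij al hM hMg a0 b0 ab c1 r0 r1 N V.
have [hh [h0 dh0] _] := hM.
set rho := 20^-1 / (n%:R + 1) : R; have germ := classM_germ hM; rewrite -/rho in germ.
have rho0 : 0 < rho by rewrite divr_gt0 ?invr_gt0 // ltr_wpDl.
have a1 : a <= 1 by rewrite -(@expr_le1 _ 2) ?(ltW a0) // -ab lerDl sqr_ge0.
have b1 : b <= 1 by rewrite -(@expr_le1 _ 2) ?(ltW b0) // -ab lerDr sqr_ge0.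
pose e1 : 'rV[R[i]]_n := b%:C *: delta_mx 0 j; pose e2 : 'rV[R[i]]_n := (a%:C * c) *: delta_mx 0 i.
pose z l := l *: e1 + l ^+ 2 *: e2.
have zi l : z l 0 i = l ^+ 2 * (a%:C * c).
  by rewrite !mxE !eqxx (negbTE ij) /= !mulr0 add0r mulr1.
have zj l : z l 0 j = l * b%:C.
  by rewrite !mxE !eqxx (eq_sym j) (negbTE ij) /= !mulr0 addr0 mulr1.
have zk l k : k != i -> k != j -> z l 0 k = 0.
  by move=> /negbTE ki /negbTE kj; rewrite !mxE ki kj /= !mulr0 addr0.
have ca : cmod a%:C = a by rewrite cmodR gtr0_norm.
have cb : cmod b%:C = b by rewrite cmodR gtr0_norm.
have zn l : enorm (z l) ^+ 2 = a ^+ 2 * cmod l ^+ 4 + b ^+ 2 * cmod l ^+ 2.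
  rewrite enorm_sqr (bigD1 i) //= (bigD1 j) //=; last by rewrite eq_sym.
  rewrite big1 => [|k /andP[ki kj]]; last by rewrite zk // cmod0 expr0n.
  by rewrite zi zj !cmodM ca cb c1; ring.
have N0 : 0 < N by rewrite addr_gt0 // mulr_gt0 ?exprn_gt0.
have z1 l : cmod l < 1 -> enorm (z l) < 1.
  move=> l1; rewrite -(@expr_lt1 _ 2) ?enorm_ge0 // zn.
  have l2 : cmod l ^+ 2 < 1 by rewrite expr_lt1.
  have l4 : cmod l ^+ 4 <= cmod l ^+ 2.
    by rewrite (_ : 4%N = (2 + 2)%N) // exprD ler_piMl ?sqr_ge0 // ltW.
  have := ler_wpM2l (sqr_ge0 a) l4; have : 0 < b ^+ 2 by rewrite exprn_gt0.
  have : a ^+ 2 * cmod l ^+ 2 + b ^+ 2 * cmod l ^+ 2 = cmod l ^+ 2 by rewrite -mulrDl ab mul1r.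
  lra.
(* On [|l| = r] the conjugates of [z_i] and [z_j] are [A / l^2] and [B / l]. The value [F0] is the
   limit at [0], as [h_i(z l) / l^2] tends to [a c + q b^2] and [h_j(z l) / l] to [b]. *)
pose A := a%:C * c^*%C * (r ^+ 4)%:C; pose B := b%:C * (r ^+ 2)%:C.
pose q := coef2 i j h.
pose F0 := A * (a%:C * c + q * b%:C ^+ 2) + B * b%:C.
pose F l := if l == 0 then F0 else A * (h (z l) 0 i / l ^+ 2) + B * (h (z l) 0 j / l).
have dF l : 0 < cmod l -> cmod l < 1 -> exists m, cdif F l m.
  move=> l0 l1; have lz : l != 0 by rewrite -cmod_gt0.
  have dz : differentiable h (z l) by apply: hol_differentiable => //; exact: z1.
  have [m1 dm1] := cdif_quadratic i dz; have [m2 dm2] := cdif_quadratic j dz.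
  eexists; apply: (@cdif_ext _ (fun l => A * (h (z l) 0 i * (l ^+ 2)^-1) + B * (h (z l) 0 j * l^-1)) _ _ _ _ l0) => [w wl|]; last first.
    apply: cdifD; apply: cdifZ; apply: cdifM; [exact: dm1| |exact: dm2|].
      apply: cdifV; last by rewrite expf_neq0.
      by apply: cdif_ext ltr01 _ (cdifM (cdif_id l) (cdif_id l)) => w _; rewrite expr2.
    by apply: cdifV lz; exact: cdif_id.
  rewrite /F; case: eqVneq => // w0; by move: wl; rewrite w0 sub0r cmodN ltxx.
set K2 := cauchy2 rho 1; set K3 := cauchy3 rho 1.
have K20 : 0 <= K2 by apply: cauchy2_ge0.
have K30 : 0 <= K3 by apply: cauchy3_ge0.
have znorm l : cmod l <= 1 -> vnorm (z l) <= cmod l.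
  move=> l1; apply: vnorm_le => // k.
  have [->|ki] := eqVneq k i.
    by rewrite zi !cmodM ca c1 mulr1 -mulrA ler_piMr // mulr_ile1 // ltW.
  have [->|kj] := eqVneq k j; first by rewrite zj cmodM cb ler_piMr.
  by rewrite zk // cmod0.
have cF : ccont F 0.
  have key l : l != 0 -> cmod l <= rho / 16 -> cmod l <= 1 ->
      cmod (F l - F0) <= (cmod A * (16 * K2 + K3) + cmod B * K2) * cmod l.
    move=> l0 l8 l1; rewrite /F (negbTE l0).
    have lp : 0 < cmod l by rewrite cmod_gt0.
    have zl := znorm l l1.
    have e1l : vnorm (l *: e1) <= cmod l.
      rewrite /e1 scalerA vnormZ cmodM cb -[leRHS]mulr1.
      by apply: ler_pM; rewrite ?mulr_ge0 ?vnorm_ge0 ?(ltW b0) ?vnorm_delta // ler_piMr.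
    have g1 := germ_increment i rho0 ler01 germ lp l8 e1l zl.
    have e1i : (l *: e1) 0 i = 0 by rewrite !mxE eqxx (negbTE ij) /= !mulr0.
    rewrite e1i subr0 zi -/K2 in g1.
    have g2 : vnorm (z l - l *: e1) <= cmod l ^+ 2.
      rewrite /z [l *: e1 + _]addrC addrK vnormZ cmodX /e2 vnormZ cmodM ca c1 mulr1.
      rewrite ler_piMr ?sqr_ge0 //; apply: mulr_ile1 => //; rewrite ?vnorm_ge0 ?vnorm_delta //; exact: ltW.
    have g3 : cmod (h (l *: e1) 0 i - q * (l * b%:C) ^+ 2) <= K3 * cmod l ^+ 3.
      have [_ _ T] := germ_coef2 ij rho0 ler01 germ.
      have lb : cmod (l * b%:C) <= cmod l by rewrite cmodM cb ler_piMr.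
      have lb8 : cmod (l * b%:C) <= rho / 8 by lra.
      rewrite /e1 scalerA; apply: le_trans (T _ lb8) _.
      by rewrite ler_wpM2l // ler_pXn2r ?nnegrE.
    have g4 : cmod (h (z l) 0 j - l * b%:C) <= K2 * cmod l ^+ 2.
      have := germ_linear_approx j rho0 ler01 germ (z := z l); rewrite zj => /(_ _)/le_trans; apply.
        lra.
      by rewrite ler_wpM2l // ler_pXn2r ?nnegrE ?vnorm_ge0.
    (* The step from the axis point [l e1] to [z l] has size at most [|l|^2], and [h - id] has a
       Lipschitz constant of order [|l|] there. The error is of third order and survives the
       division by [l^2]. *)
    have g5 : cmod (h (z l) 0 i - l ^+ 2 * (a%:C * c) - q * (l * b%:C) ^+ 2) <= (16 * K2 + K3) * cmod l ^+ 3.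
      rewrite (_ : _ - _ - _ = (h (z l) 0 i - l ^+ 2 * (a%:C * c) - h (l *: e1) 0 i)
        + (h (l *: e1) 0 i - q * (l * b%:C) ^+ 2)); last by ring.
      apply: le_trans (cmodD _ _) _; apply: le_trans (lerD g1 g3) _.
      have := ler_wpM2l (mulr_ge0 (mulr_ge0 (ler0n R 16) K20) (ltW lp)) g2.
      rewrite !exprSr expr0 mul1r; lra.
    rewrite (_ : _ - F0 = A * ((h (z l) 0 i - l ^+ 2 * (a%:C * c) - q * (l * b%:C) ^+ 2) / l ^+ 2)
      + B * ((h (z l) 0 j - l * b%:C) / l)); last by rewrite /F0; field.
    apply: le_trans (cmodD _ _) _.
    rewrite (cmodM A) (cmodM B) [cmod (_ / l ^+ 2)]cmodM [cmod (_ / l)]cmodM !cmodV cmodX.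
    have k1 : cmod (h (z l) 0 i - l ^+ 2 * (a%:C * c) - q * (l * b%:C) ^+ 2) / cmod l ^+ 2
        <= (16 * K2 + K3) * cmod l.
      rewrite ler_pdivrMr ?exprn_gt0 //.
      by have -> : (16 * K2 + K3) * cmod l * cmod l ^+ 2 = (16 * K2 + K3) * cmod l ^+ 3 by ring.
    have k2 : cmod (h (z l) 0 j - l * b%:C) / cmod l <= K2 * cmod l.
      by rewrite ler_pdivrMr // -mulrA -expr2.
    have := ler_wpM2l (cmod_ge0 A) k1; have := ler_wpM2l (cmod_ge0 B) k2; lra.
  move=> e ep; set C := _ + _ in key.
  have C0 : 0 <= C.
    by rewrite /C; apply: addr_ge0; apply: mulr_ge0 => //; apply: addr_ge0 => //; apply: mulr_ge0.
  have C1 : 0 < C + 1 by lra.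
  exists (Num.min (Num.min 1 (rho / 16)) (e / (C + 1))); first by rewrite !lt_min ltr01 !divr_gt0.
  move=> l; rewrite subr0 !lt_min => /andP[/andP[l1 l2]]; rewrite ltr_pdivlMr // => l3.
  have F00 : F 0 = F0 by rewrite /F eqxx.
  have [->|l0] := eqVneq l 0; first by rewrite subrr cmod0 ltW.
  rewrite F00; apply: le_trans (key l l0 (ltW l2) (ltW l1)) _; have := cmod_ge0 l; rlra.
have circ l : cmod l = r -> F l = hdot (h (z l)) (z l).
  move=> lr; have l0 : l != 0 by rewrite -cmod_gt0 lr.
  have lJ : l^*%C = (r ^+ 2)%:C / l by rewrite -lr -mulcJ mulrAC mulfV // mul1r.
  rewrite /F (negbTE l0) /hdot (bigD1 i) //= (bigD1 j) //=; last by rewrite eq_sym.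
  rewrite big1 => [|k /andP[ki kj]]; last by rewrite zk // conjc0 mulr0.
  rewrite zi zj addr0 /A /B.
  have -> : (l ^+ 2 * (a%:C * c))^*%C = l^*%C ^+ 2 * (a%:C * c^*%C).
    by rewrite rmorphM rmorphXn /= conjcZ.
  have -> : (l * b%:C)^*%C = l^*%C * b%:C by rewrite mulrC conjcZ mulrC.
  rewrite lJ (_ : (r ^+ 4)%:C = (r ^+ 2)%:C * (r ^+ 2)%:C); last by rewrite -rmorphM -exprD.
  by field.
have cV : Re F0 = V.
  rewrite /F0 /V /N.
  have -> : A * (a%:C * c + q * b%:C ^+ 2) + B * b%:C = (a ^+ 2 * r ^+ 4 + b ^+ 2 * r ^+ 2)%:C
      + (a * b ^+ 2 * r ^+ 4)%:C * (c^*%C * q).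
    have -> : A * (a%:C * c + q * b%:C ^+ 2) = a%:C * a%:C * (r ^+ 4)%:C * (c * c^*%C)
       + a%:C * b%:C ^+ 2 * (r ^+ 4)%:C * (c^*%C * q) by rewrite /A; ring.
    by rewrite mulcJ c1 expr1n rmorph1 mulr1 /B !(rmorphD, rmorphM, rmorphXn) /=; ring.
  by rewrite ReD ReZ.
have F00 : F 0 = F0 by rewrite /F eqxx.
have bound l : cmod l = r -> 0 <= Re (F l) /\ alpha * Re (F l) <= N.
  move=> lr; rewrite circ //.
  have zN : enorm (z l) ^+ 2 = N by rewrite zn lr.
  have z0 : z l != 0.
    apply/negP => /eqP zl0; move: N0; rewrite -zN zl0 enorm_sqr big1 ?ltxx // => k _.
    by rewrite mxE cmod0 expr0n.
  have l1 : enorm (z l) < 1 by apply: z1; rewrite lr.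
  have p := classM_hdot hM l1 z0; split; first exact: ltW.
  have := classMg_hdot al hMg l1 z0; rewrite zN cmodM cmodR ReZ ger0_norm ?invr_ge0 ?(ltW N0) //.
  rewrite exprMn exprVn; set x := Re _ in p *; set y := cmod _ => hy.
  have xy : x ^+ 2 <= y ^+ 2 by rewrite ler_pXn2r ?nnegrE ?(ltW p) ?cmod_ge0 // Re_le.
  have al0 : 0 <= alpha by case/andP: al.
  (* In [alpha |W|^2 < Re W] with [W = F / N], only the real part is kept in the modulus. Dividing
     by [Re F > 0] leaves [alpha Re F <= N], which is linear and so passes to the centre. *)
  have h1 : alpha * (N ^- 2 * x ^+ 2) <= N^-1 * x.
    apply: le_trans (ltW hy); rewrite ler_wpM2l // ler_wpM2l // invr_ge0 sqr_ge0 //.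
  have p2 : 0 < N ^+ 2 / x by rewrite divr_gt0 ?exprn_gt0.
  have := ler_wpM2r (ltW p2) h1.
  rewrite (_ : alpha * _ * _ = alpha * x); last by field; rewrite !gt_eqF.
  by rewrite (_ : N^-1 * x * _ = N) //; field; rewrite !gt_eqF.
split.
  have := @center_Re_le R (fun l => - F l) r 1 0 r0 r1; rewrite F00 ReN cV oppr_le0; apply.
  - by move=> l l0 l1; have [m dm] := dF l l0 l1; exists (- m); exact: cdifN.
  - by apply: ccont_ext ltr01 _ (ccontM (ccont_cst (-1) 0) cF) => w _; rewrite mulN1r.
  - by move=> l /bound[]; rewrite ReN oppr_le0.
have := @center_Re_le R (fun l => alpha%:C * F l) r 1 N r0 r1; rewrite F00 ReZ cV; apply.
- by move=> l l0 l1; have [m dm] := dF l l0 l1; exists (alpha%:C * m); exact: cdifZ.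
- by apply: ccontM => //; exact: ccont_cst.
- by move=> l /bound[_]; rewrite ReZ.
Qed.

(** The free phase is used twice. Turned against [q] in [0 <= V], it gives [X <= 1] for
    [X = a b^2 |q|]; aligned with [q] in [alpha V <= N], it gives [alpha X <= 1 - alpha]. [d1] is
    the smaller of the two bounds on [X]. *)
Lemma classMg_coef2_le (R : realType) n (alpha : R) (h : 'rV[R[i]]_n -> 'rV[R[i]]_n) (i j : 'I_n) :
  i != j -> 0 <= alpha < 1 -> classM n h -> classMg n (g_alpha alpha) h ->
  cmod (coef2 i j h) <= 3 * Num.sqrt 3 / 2 * d1 alpha.
Proof.
move=> ij al hM hMg; set q := coef2 i j h.
have [a0 a1] := andP al.
have s3 : 0 < Num.sqrt 3 :> R by rewrite sqrtr_gt0.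
have s33 : Num.sqrt 3 ^+ 2 = 3 :> R by rewrite sqr_sqrtr.
have s2 : 0 < Num.sqrt 2 :> R by rewrite sqrtr_gt0.
have s22 : Num.sqrt 2 ^+ 2 = 2 :> R by rewrite sqr_sqrtr.
set a := (Num.sqrt 3)^-1 : R; set b := Num.sqrt 2 / Num.sqrt 3 : R.
have ap : 0 < a by rewrite invr_gt0.
have bp : 0 < b by rewrite divr_gt0.
have aa : a ^+ 2 = 3^-1 by rewrite exprVn s33.
have bb : b ^+ 2 = 2 / 3 by rewrite expr_div_n s22 s33.
have ab : a ^+ 2 + b ^+ 2 = 1 by rewrite aa bb; field.
have [c [c1 cE]] := phaseP q.
set X := a * b ^+ 2 * cmod q.
have X0 : 0 <= X by rewrite !mulr_ge0 ?sqr_ge0 // ltW.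
have Nle r : 0 < r -> r < 1 -> a ^+ 2 * r ^+ 4 + b ^+ 2 * r ^+ 2 <= 1.
  move=> r0 r1; rewrite -ab; apply: lerD; rewrite ler_piMr ?sqr_ge0 // exprn_ile1 // ltW //.
have X1 : X <= 1.
  apply: le_of_scaled => // r r0 r1; have cN : cmod (- c^*%C) = 1 by rewrite cmodN cmodJ.
  have [+ _] := classMg_mean ij al hM hMg ap bp ab cN r0 r1.
  have -> : ((- c^*%C)^*%C * coef2 i j h) = - (c * q) by rewrite rmorphN /= conjcK mulNr.
  by rewrite ReN cE; have := Nle r r0 r1; rewrite /X; lra.
have X2 : 0 < alpha -> alpha * X <= 1 - alpha.
  move=> alp; apply: le_of_scaled => [|r r0 r1]; first by rewrite mulr_ge0.
  have cN : cmod c^*%C = 1 by rewrite cmodJ.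
  have [_ +] := classMg_mean ij al hM hMg ap bp ab cN r0 r1.
  rewrite conjcK cE -/q; have := Nle r r0 r1; set N := _ + _ => N1.
  have : (1 - alpha) * N <= 1 - alpha by rewrite ler_piMr //; lra.
  rewrite /X; lra.
have XE : cmod q = 3 * Num.sqrt 3 / 2 * X.
  by rewrite /X bb /a; field; rewrite gt_eqF.
rewrite XE; apply: ler_wpM2l; first by rewrite divr_ge0 // mulr_ge0 // ltW.
rewrite /d1; case: (lerP alpha 2^-1) => [//|h2].
have alp : 0 < alpha by apply: lt_trans h2; rewrite invr_gt0.
by rewrite ler_pdivlMr // mulrC; exact: X2.
Qed.

(** * The coefficient of a starlike map *)

Lemma diff_left_inverse (K : numFieldType) (V W : normedModType K) (f : V -> W) (k : W -> V) z v :
  differentiable f z -> differentiable k (f z) -> (\forall w \near z, k (f w) = w) ->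
  'd k (f z) ('d f z v) = v.
Proof.
move=> df dk E; have dkf : differentiable (k \o f) z by exact: differentiable_comp.
have E' : \forall w \near z, (k \o f) w = id w by [].
have := near_eq_derive v E'; rewrite deriveE // deriveE // diff_comp //= => ->.
have -> : 'd (id : V -> V) z = id :> (V -> V) by exact: diff_val.
by [].
Qed.

(** By the chain rule the Jacobian of a local inverse inverts that of [f]. Hence [invmx] in
    [starlike_g] is a genuine inverse and not its default value. *)
Lemma locally_biholomorphic_unit (R : realType) n (f : 'rV[R[i]]_n -> 'rV[R[i]]_n) z :
  locally_biholomorphic f -> eball n z -> 'J f z \in unitmx.
Proof.
move=> lb zb; have [U [k [[oU Uz UB] [_ hf hk kf]]]] := lb z zb.
have df : differentiable f z by exact: hf.
have dk : differentiable k (f z) by apply: hk; exists z.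
have dkf v : 'd k (f z) ('d f z v) = v.
  apply: diff_left_inverse; [exact: df|exact: dk|].
  have : nbhs z U by exact: open_nbhs_nbhs.
  by apply: filterS => w Uw; exact: kf.
have E : 'J f z *m 'J k (f z) = 1%:M.
  apply/row_matrixP => l; rewrite rowE [RHS]rowE mulmxA mulmx1.
  by rewrite /jacobian !mul_rV_lin1 dkf.
exact: (mulmx1_unit E).1.
Qed.

Lemma starlike_relation (R : realType) n (f : 'rV[R[i]]_n -> 'rV[R[i]]_n) z :
  locally_biholomorphic f -> hol n f -> eball n z ->
  f z = 'd f z (f z *m invmx ('J f z)).
Proof.
move=> lb hf zb; have df : differentiable f z by exact: hf.
by rewrite -deriveE // deriveEjacobian // mulmxKV // locally_biholomorphic_unit.
Qed.

Lemma classMg_classM (R : realType) n (alpha : R) (h : 'rV[R[i]]_n -> 'rV[R[i]]_n) :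
  0 <= alpha < 1 -> classMg n (g_alpha alpha) h -> classM n h.
Proof.
move=> al hMg; have [hh nh _] := hMg.
by apply: (classMg_intro al hh nh _).2 => z z1 z0; exact: classMg_hdot.
Qed.

Lemma eq0_of_le_small (R : realType) (x C r : R) : 0 <= x -> 0 <= C -> 0 < r ->
  (forall t, 0 < t -> t <= r -> x <= C * t) -> x = 0.
Proof.
move=> x0 C0 r0 H; apply/eqP; rewrite eq_le x0 andbT; apply/ler_addgt0Pr => e e0; rewrite add0r.
have C1 : 0 < C + 1 by lra.
have t0 : 0 < Num.min r (e / (C + 1)) by rewrite lt_min r0 divr_gt0.
apply: le_trans (H _ t0 _) _; first by rewrite ge_min lexx.
have : Num.min r (e / (C + 1)) * (C + 1) <= e by rewrite -ler_pdivlMr // ge_min lexx orbT.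
lra.
Qed.

(** The terms of order [t^2] of [f = Df h] are compared at [x = t e_j]. With [h(x) = x + y], the
    [i]-th component of [Df(x) x] contributes [2 c t^2] and that of [Df(x) y] contributes [q t^2],
    while [f_i(x)] has [c t^2]. So [c = 2 c + q]. *)
Lemma starlike_coef2 (R : realType) n (f h : 'rV[R[i]]_n -> 'rV[R[i]]_n) (i j : 'I_n) :
  i != j -> hol n f -> normalized f -> hol n h -> normalized h ->
  (forall z, eball n z -> f z = 'd f z (h z)) -> coef2 i j f = - coef2 i j h.
Proof.
move=> ij hf nf hh nh rel.
have [r1 [M1 [r10 M10 gf]]] := hol_germ hf nf; have [r2 [M2 [r20 M20 gh]]] := hol_germ hh nh.
have [_ F1 F2] := germ_coef2 ij r10 M10 gf; have [_ _ H2] := germ_coef2 ij r20 M20 gh.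
set c := coef2 i j f in F1 F2 *; set q := coef2 i j h in H2 *.
have A0 := cauchy2_ge0 r10 M10; have B0 := cauchy3_ge0 r10 M10.
have C0 := cauchy2_ge0 r20 M20; have D0 := cauchy3_ge0 r20 M20.
move: F1 F2 H2 A0 B0 C0 D0 (fun s x v k p1 p2 p3 => @germ_diff_estimate _ _ r1 M1 s f x v k r10 M10 gf p1 p2 p3)
  (fun z k p => @germ_linear_approx _ _ r2 M2 h z k r20 M20 gh p).
set A := cauchy2 r1 M1; set B := cauchy3 r1 M1; set C := cauchy2 r2 M2; set D := cauchy3 r2 M2.
move=> F1 F2 H2 A0 B0 C0 D0 dest lin.
apply/eqP; rewrite -subr_eq0 opprK -cmod_eq0; apply/eqP.
apply: (@eq0_of_le_small _ _ (2 * B + 16 * A * C + D) (Num.min (Num.min (r1 / 16) (r2 / 16)) 2^-1)) => //.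
- by apply: addr_ge0 D0; apply: addr_ge0; [|apply: mulr_ge0 C0]; apply: mulr_ge0.
- by rewrite !lt_min !divr_gt0 // invr_gt0 ltr0n.
move=> t t0; rewrite !le_min => /andP[/andP[tr1 tr2] t2].
pose x : 'rV[R[i]]_n := t%:C *: delta_mx 0 j.
have ct : cmod t%:C = t by rewrite cmodR gtr0_norm.
have xt : vnorm x <= t by rewrite vnormZ ct ler_piMr ?vnorm_delta // ltW.
have xb : eball n x by rewrite /eball /= /x enormZ enorm_delta ct; lra.
pose y := h x - x.
have yn : vnorm y <= C * t ^+ 2.
  apply: vnorm_le => [|k]; first by rewrite mulr_ge0 ?sqr_ge0.
  have -> : y 0 k = h x 0 k - x 0 k by rewrite /y !mxE.
  apply: le_trans (lin x k _) _; first lra.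
  by rewrite ler_wpM2l // ler_pXn2r ?nnegrE ?vnorm_ge0 // ltW.
have fE : f x 0 i = t%:C * 'd f x (delta_mx 0 j) 0 i + 'd f x y 0 i.
  have : 'd f x (h x) = t%:C *: 'd f x (delta_mx 0 j) + 'd f x y.
    by rewrite -linearZ -linearD /y -/x addrC subrK.
  by rewrite -rel // => ->; rewrite !mxE.
have yi : y 0 i = h x 0 i.
  by rewrite !mxE eqxx (negbTE ij) /= mulr0 subr0.
have ct8 : cmod t%:C <= r1 / 8 by lra.
have ct8' : cmod t%:C <= r2 / 8 by lra.
have e1 := F1 _ ct8; have e2 := F2 _ ct8; have e3 := H2 _ ct8'.
have e4 := dest t x y i t0 tr1 xt; rewrite -/x ct in e1 e2 e3.
have e5 : cmod ('d f x y 0 i - y 0 i) <= 16 * A * C * t ^+ 3.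
  apply: le_trans e4 _; rewrite -/A.
  have -> : 16 * A * C * t ^+ 3 = 16 * A * t * (C * t ^+ 2) by ring.
  apply: ler_wpM2l yn; apply: mulr_ge0 (ltW t0); exact: mulr_ge0.
have t3 : 0 < t ^+ 2 by rewrite exprn_gt0.
rewrite -(ler_pM2r t3).
have -> : cmod (c + q) * t ^+ 2 = cmod ((c + q) * t%:C ^+ 2) by rewrite cmodM cmodX ct.
rewrite (_ : (c + q) * t%:C ^+ 2 = (f x 0 i - c * t%:C ^+ 2)
  - t%:C * ('d f x (delta_mx 0 j) 0 i - 2 * c * t%:C) - ('d f x y 0 i - y 0 i)
  - (h x 0 i - q * t%:C ^+ 2)); last by rewrite fE yi; ring.
apply: le_trans (cmodB _ _) _; apply: le_trans (lerD (cmodB _ _) (lexx _)) _.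
apply: le_trans (lerD (lerD (cmodB _ _) (lexx _)) (lexx _)) _.
rewrite cmodM ct.
have e6 := ler_wpM2l (ltW t0) e1.
apply: le_trans (lerD (lerD (lerD e2 e6) e5) e3) _.
by rewrite le_eqVlt; apply/orP; left; apply/eqP; ring.
Qed.

Lemma starlike_coef2_le (R : realType) n (alpha : R) (f : 'rV[R[i]]_n -> 'rV[R[i]]_n) (i j : 'I_n) :
  i != j -> 0 <= alpha < 1 -> Salpha_star n alpha f ->
  cmod (coef2 i j f) <= 3 * Num.sqrt 3 / 2 * d1 alpha.
Proof.
move=> ij al [hf nf lb hMg]; have hM := classMg_classM al hMg; have [hh nh _] := hM.
rewrite (@starlike_coef2 _ _ f (fun z => f z *m invmx ('J f z))) //; last first.
  by move=> z zb; exact: starlike_relation.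
by rewrite cmodN; exact: classMg_coef2_le.
Qed.

(** * Loewner chains *)

(** The failure of [P] persists to the right, so the infimum of the times where [P] holds is itself
    such a time. *)
Lemma first_exit (R : realType) (P : R -> Prop) (t1 : R) : 0 <= t1 -> P t1 ->
  (forall t, 0 <= t -> ~ P t -> exists2 d : R, 0 < d & forall s, t <= s -> s < t + d -> ~ P s) ->
  exists T, [/\ 0 <= T, P T & forall s, 0 <= s -> s < T -> ~ P s].
Proof.
move=> t10 Pt1 op; pose S := [set t | 0 <= t /\ P t].
have S1 : S t1 by [].
have lbS : has_lbound S by exists 0 => t [].
have infS : has_inf S by split => //; exists t1.
have inf0 : 0 <= inf S by apply: lb_le_inf; [exists t1|move=> t []].
have below s : 0 <= s -> s < inf S -> ~ P s.
  by move=> s0 sS Ps; have := ge_inf lbS (conj s0 Ps : S s); rewrite leNgt sS.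
exists (inf S); split => //; apply: contrapT => nP.
have [d d0 H] := op _ inf0 nP.
have [s [s0 Ps] sd] := inf_adherent d0 infS.
exact: (H s (ge_inf lbS (conj s0 Ps : S s)) sd Ps).
Qed.

(** Continuous induction from the left end. A first time at which [phi] exceeds [phi a] exists by
    the local decrease to the right, and it is excluded by the control of jumps from the left. *)
Lemma nonincreasing_of_local (R : realType) (phi : R -> R) (a b : R) : a <= b ->
  (forall t, a <= t -> t < b -> exists2 d : R, 0 < d &
     forall s, t <= s -> s < t + d -> s <= b -> phi s <= phi t) ->
  (forall t, a < t -> t <= b -> forall e : R, 0 < e -> exists2 d : R, 0 < d &
     forall s, a <= s -> t - d < s -> s < t -> phi t <= phi s + e) ->
  phi b <= phi a.
Proof.
move=> ab right left; rewrite leNgt; apply/negP => lt_ab.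
pose P t := a + t <= b /\ phi a < phi (a + t).
have [||t t0 nP|T [T0 [Tb PT] below]] := @first_exit R P (b - a).
- by rewrite subr_ge0.
- by rewrite /P addrC subrK.
- have [tb|tb] := ltP (a + t) b; last first.
    have [tbE|tb'] := eqVneq (a + t) b.
      by exfalso; apply: nP; rewrite /P tbE lexx.
    exists 1 => // s ts _ [sb _].
    by move/negP: tb'; apply; rewrite eq_le tb andbT (le_trans _ sb) // lerD2l.
  have [|d d0 H] := right (a + t) _ tb; first by rewrite lerDl.
  have pt : phi (a + t) <= phi a.
    by rewrite leNgt; apply/negP => pt; apply: nP; split => //; exact: ltW.
  exists d => // s ts sd [sb]; apply/negP; rewrite -leNgt; apply: le_trans pt.
  by apply: H => //; rewrite ?lerD2l // -addrA ltrD2l.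
have T1 : 0 < T.
  by rewrite lt0r T0 andbT; apply/negP => /eqP TE; move: PT; rewrite TE addr0 ltxx.
move: PT; apply/negP; rewrite -leNgt; apply/ler_addgt0Pr => e e0.
have [|d d0 H] := left (a + T) _ Tb e e0; first by rewrite ltrDl.
pose m := Num.max 0 (T - d / 2).
have m0 : 0 <= m by rewrite le_max lexx.
have mT : m < T by rewrite gt_max T1 ltrBlDr ltrDl divr_gt0.
have mb := below m m0 mT.
have pm : phi (a + m) <= phi a.
  by rewrite leNgt; apply/negP => h; apply: mb; split => //; lra.
have md : T - d < m by rewrite lt_max; apply/orP; right; lra.
by apply: le_trans (H (a + m) _ _ _) _; [rewrite lerDl|lra|lra|lra].
Qed.

(* The exceptional null set is covered by an open set [O] of small measure; subtracting [L] times the measure of [O] below [t] absorbs the increments of [phi] near the bad times. *)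
Lemma le_of_ae_derivative (R : realType) (phi : R -> R) (a b L : R) : a <= b -> 0 <= L ->
  (forall s t, a <= s -> s <= t -> t <= b -> `|phi t - phi s| <= L * (t - s)) ->
  {ae @lebesgue_measure R, forall t, a <= t -> t < b -> forall e : R, 0 < e ->
    exists2 d : R, 0 < d & forall s, t <= s -> s < t + d -> s <= b -> phi s - phi t <= e * (s - t)} ->
  phi b <= phi a.
Proof.
move=> ab L0 lip [N [mN N0 bad]]; apply/ler_addgt0Pr => e e0.
have K0 : 0 < L + (b - a) + 1 by lra.
pose eta := e / (L + (b - a) + 1).
have eta0 : 0 < eta by rewrite divr_gt0.
have [|O [oO NO muO]] := @lebesgue_regularity_outer R N eta mN _ eta0.
  apply: (@le_lt_trans _ _ 0%E); last exact: ltry.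
  by rewrite le_eqVlt; apply/orP; left; apply/eqP; exact: N0.
have mO : measurable O by exact: open_measurable.
have muO' : (lebesgue_measure O <= eta%:E)%E.
  have N0' : lebesgue_measure N = 0%E by exact: N0.
  have E : lebesgue_measure O = (lebesgue_measure (O `\` N) + lebesgue_measure N)%E.
    by rewrite -{2}(setIidr NO); exact: measureDI.
  by rewrite E N0' adde0; exact: ltW.
pose m t := fine (lebesgue_measure (O `&` [set` `[a, t]])).
have mfin t : (lebesgue_measure (O `&` [set` `[a, t]]) = (m t)%:E)%E.
  rewrite /m fineK // ge0_fin_numE //; apply: (@le_lt_trans _ _ eta%:E); last exact: ltry.
  by apply: le_trans muO'; apply: le_measure; rewrite ?inE //; exact: measurableI.
have m0 t : 0 <= m t by rewrite fine_ge0.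
have meta t : m t <= eta.
  by rewrite -lee_fin -mfin; apply: le_trans muO'; apply: le_measure; rewrite ?inE //; exact: measurableI.
have mmono s t : s <= t -> m s <= m t.
  move=> st; rewrite -lee_fin -!mfin; apply: le_measure; rewrite ?inE; try exact: measurableI.
  apply: setIS => x /=; rewrite !in_itv /= => /andP[-> /le_trans->//].
have mloc s t : a <= s -> s <= t -> (forall x, s < x -> x <= t -> O x) -> t - s <= m t - m s.
  move=> as_ st sO.
  have mI u : measurable (O `&` [set` `[a, u]]) by exact: measurableI.
  have dis : (O `&` [set` `[a, s]]) `&` [set` `]s, t]] = set0.
    apply/seteqP; split => x //= -[[_]]; rewrite !in_itv /= => /andP[_ xs] /andP[sx _].
    by move: xs; rewrite leNgt sx.
  have U : (lebesgue_measure ((O `&` [set` `[a, s]]) `|` [set` `]s, t]]) = (m s)%:E + (t - s)%:E)%E.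
    have E : lebesgue_measure ((O `&` [set` `[a, s]]) `|` [set` `]s, t]])
        = (lebesgue_measure (O `&` [set` `[a, s]]) + lebesgue_measure [set` `]s, t]])%E.
      apply: measureU; [exact: mI|exact: measurable_itv|exact: dis].
    rewrite E mfin; congr (_ + _)%E.
    rewrite lebesgue_measure_itv /= lte_fin; case: ltP => // ts.
    by have -> : t = s; [apply/eqP; rewrite eq_le ts st|rewrite subrr].
  rewrite lerBrDl -lee_fin -mfin EFinD -U; apply: le_measure; rewrite ?inE.
  - by apply: measurableU; [exact: mI|exact: measurable_itv].
  - exact: mI.
  move=> x [[Ox /=]|/=]; rewrite !in_itv /=.
    by move=> /andP[ax xs]; split=> //; rewrite ax (le_trans xs).
  move=> /andP[sx xt]; split; first exact: sO.
  by rewrite /= ?in_itv /= xt andbT (le_trans as_) // ltW.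
have E : eta * (L + (b - a) + 1) = e by rewrite divfK // gt_eqF.
have Lm : L * m b <= L * eta by rewrite ler_wpM2l.
have Lm0 : 0 <= L * m a by rewrite mulr_ge0.
(* Good times contribute a slope of at most [eta], absorbed by [eta * t]. Both corrections together
   change by at most [eta (L + b - a)] over [[a, b]], which the choice of [eta] keeps below [e]. *)
suff H1 : phi b - L * m b - eta * b <= phi a - L * m a - eta * a by lra.
apply: (@nonincreasing_of_local R (fun t => phi t - L * m t - eta * t) a b ab) => [t at_ tb|t at_ tb e1 e10].
- case: (pselect (N t)) => [Nt|Nt].
    have /nbhs_ballP[d /= d0 dO] : nbhs t O by apply: open_nbhs_nbhs; split => //; exact: NO.
    exists d => // s ts sd sb.
    have h1 : t - s <= 0 by lra.
    have h2 : s - t <= m s - m t.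
      apply: mloc => // x tx xs; apply: dO; rewrite -ball_normE /= ltr_norml; apply/andP; split; lra.
    have h3 := le_trans (ler_norm _) (lip t s at_ ts sb).
    have := ler_wpM2l L0 h2; have : 0 <= eta * (s - t) by apply: mulr_ge0; [exact: ltW|lra].
    lra.
  have good : forall e : R, 0 < e -> exists2 d : R, 0 < d &
      forall s, t <= s -> s < t + d -> s <= b -> phi s - phi t <= e * (s - t).
    by apply: contrapT => nb; apply: Nt; apply: bad => /= H; apply: nb; exact: H.
  have [d d0 H] := good _ eta0; exists d => // s ts sd sb.
  have := H s ts sd sb; have := ler_wpM2l L0 (mmono _ _ ts); lra.
- have L1 : 0 < L + 1 by lra.
  exists (e1 / (L + 1)); first by rewrite divr_gt0.
  move=> s as_ ds st.
  have h3 := le_trans (ler_norm _) (lip s t as_ (ltW st) tb).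
  have : (t - s) * (L + 1) <= e1 by rewrite -ler_pdivlMr //; lra.
  have := ler_wpM2l L0 (mmono _ _ (ltW st)); have : 0 <= eta * (t - s) by apply: mulr_ge0; [exact: ltW|lra].
  lra.
Qed.

Lemma expRN_diff (R : realType) (s t : R) : 0 <= t -> t <= s ->
  expR (- t) - expR (- s) <= s - t /\ expR (- s) - expR (- t) <= - ((s - t) * expR (- s)).
Proof.
move=> t0 ts; have Et : expR (- t) <= 1 by rewrite -expR0 ler_expR oppr_le0.
have Es : 0 < expR (- s) by exact: expR_gt0. have Et0 : 0 < expR (- t) by exact: expR_gt0.
have st : 0 <= s - t by rewrite subr_ge0.
split.
  have h : expR (- t) * (1 + (t - s)) <= expR (- s).
    rewrite [X in _ <= expR X](_ : _ = - t + (t - s)); last by ring.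
    by rewrite expRD ler_pM2l // expR_ge1Dx.
  have := ler_wpM2r st Et; lra.
have h : expR (- s) * (1 + (s - t)) <= expR (- t).
  rewrite [X in _ <= expR X](_ : _ = - s + (s - t)); last by ring.
  by rewrite expRD ler_pM2l // expR_ge1Dx.
lra.
Qed.

(** After a rotation, [Re (c u) + A e^(-t)] is nonincreasing, since the bound on the speed is minus
    the derivative of the second term; the bound [A] therefore holds for every [T]. The Lipschitz
    constant is only local, so [le_of_ae_derivative] is used on short intervals, joined by
    [nonincreasing_of_local]. *)
Lemma le_of_ae_rdif (R : realType) (u : R -> R[i]) (T A : R) : 0 <= T -> 0 <= A ->
  (forall t, 0 <= t -> exists e L : R, 0 < e /\ forall s1 s2, 0 <= s1 -> 0 <= s2 ->
     `|s1 - t| < e -> `|s2 - t| < e -> cmod (u s1 - u s2) <= L * `|s1 - s2|) ->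
  {ae @lebesgue_measure R, forall t, 0 <= t -> t < T ->
     exists l, rdif u t l /\ cmod l <= A * expR (- t)} ->
  cmod (u T - u 0) <= A.
Proof.
move=> T0 A0 lip der; have [c [c1 cE]] := phaseP (u T - u 0).
pose phi t := Re (c * u t) + A * expR (- t).
have phiB s t : phi s - phi t = Re (c * (u s - u t)) + A * (expR (- s) - expR (- t)).
  by rewrite /phi mulrBr ReD ReN; ring.
have cu s t : `|Re (c * (u s - u t))| <= cmod (u s - u t).
  by apply: le_trans (norm_Re _) _; rewrite cmodM c1 mul1r.
have dini : {ae @lebesgue_measure R, forall t, 0 <= t -> t < T -> forall e : R, 0 < e ->
    exists2 d : R, 0 < d & forall s, t <= s -> s < t + d -> phi s - phi t <= e * (s - t)}.
  apply: (@filterS _ _ (ae_filter_ringOfSetsType (@lebesgue_measure R)) _ _ _ der) => t H t0 tT e e0; have [l [ul lA]] := H t0 tT.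
  have [|d d0 hd] := ul (e / 2); first by lra.
  have A1 : 0 < A + 1 by lra.
  exists (Num.min d (e / 2 / (A + 1))); first by rewrite lt_min d0 !divr_gt0.
  move=> s ts; rewrite -ltrBlDl lt_min ltr_pdivlMr // => /andP[sd se].
  have st : 0 <= s - t by rewrite subr_ge0.
  have := hd s; rewrite ger0_norm // => /(_ sd); set w := _ - _ - _ => hw.
  have E : Re (c * (u s - u t)) = Re (c * w) + (s - t) * Re (c * l).
    rewrite -ReZ -ReD /w; congr complex.Re; ring.
  have h1 : Re (c * w) <= e / 2 * (s - t).
    by apply: le_trans (Re_le _) _; rewrite cmodM c1 mul1r.
  have h2 : Re (c * l) <= A * expR (- t).
    by apply: le_trans (Re_le _) _; rewrite cmodM c1 mul1r.
  have [e1 e2] := expRN_diff t0 ts.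
  have h3 := ler_wpM2l st h2; have h4 := ler_wpM2l A0 e2.
  have h5 := ler_wpM2l (mulr_ge0 A0 st) e1.
  have h6 : (s - t) * (A + 1) * (s - t) <= e / 2 * (s - t) by rewrite ler_wpM2r // ltW.
  have h7 : 0 <= (s - t) * (s - t) by rewrite mulr_ge0.
  rewrite phiB E; lra.
have decr : phi T <= phi 0.
  apply: nonincreasing_of_local T0 _ _ => [t t0 tT|t t0 tT e e0].
    have [d [L [d0 hd]]] := lip t t0.
    exists d => // s ts sd sT.
    pose L' := Num.max 0 L + A.
    have L'0 : 0 <= L' by rewrite addr_ge0 // le_max lexx.
    apply: (le_of_ae_derivative ts L'0) => [x y tx xy ys|].
      have x0 : 0 <= x by exact: le_trans tx.
      have y0 : 0 <= y by exact: le_trans xy.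
      rewrite phiB; apply: le_trans (ler_normD _ _) _.
      have h1 : cmod (u y - u x) <= L * (y - x).
        have -> : y - x = `|y - x| by rewrite ger0_norm // subr_ge0.
        by apply: hd => //; rewrite ger0_norm; lra.
      have h2 : L * (y - x) <= Num.max 0 L * (y - x).
        by rewrite ler_wpM2r ?subr_ge0 // le_max lexx orbT.
      have [e1 e2] := expRN_diff x0 xy.
      have h3 : `|A * (expR (- y) - expR (- x))| <= A * (y - x).
        rewrite normrM ger0_norm //; apply: ler_wpM2l => //; rewrite ler_norml; apply/andP; split; first lra.
        have : expR (- y) <= expR (- x) by rewrite ler_expR lerN2.
        lra.
      have := cu y x; rewrite /L'; lra.
    apply: (@filterS _ _ (ae_filter_ringOfSetsType (@lebesgue_measure R)) _ _ _ dini) => x H tx xs e e0.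
    have [||d' d'0 H'] := H _ _ e e0; [lra|lra|].
    by exists d' => // y xy yd _; exact: H'.
  have [d [L [d0 hd]]] := lip t (ltW t0).
  pose L' := Num.max 0 L + A + 1.
  have M0 : 0 <= Num.max 0 L by rewrite le_max lexx.
  have L'0 : 0 < L' by rewrite /L'; lra.
  exists (Num.min d (e / L')); first by rewrite lt_min d0 divr_gt0.
  move=> s s0; rewrite ltrBlDr -ltrBlDl lt_min ltr_pdivlMr // => /andP[sd se] st.
  have h1 : cmod (u t - u s) <= L * (t - s).
    have -> : t - s = `|t - s| by rewrite ger0_norm // subr_ge0 ltW.
    apply: hd => //; rewrite ?subrr ?normr0 //; first exact: ltW.
    by rewrite ltr0_norm; lra.
  have h2 : L * (t - s) <= Num.max 0 L * (t - s).
    by apply: ler_wpM2r; [lra|rewrite le_max lexx orbT].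
  have h3 := le_trans (ler_norm _) (cu t s).
  have h4 : A * expR (- t) <= A * expR (- s) by rewrite ler_wpM2l // ler_expR lerN2 ltW.
  have h5 : 0 <= A * (t - s) by rewrite mulr_ge0 // subr_ge0 ltW.
  have := phiB t s; rewrite /L' in se; lra.
have := expR_ge0 (- T); have : 0 <= A * expR (- T) by rewrite mulr_ge0 // expR_ge0.
have := phiB T 0; rewrite cE oppr0 expR0; lra.
Qed.

(** * The rescaled Loewner flow *)

Lemma rdifM (R : realType) (f g : R -> R[i]) t l m :
  rdif f t l -> rdif g t m -> rdif (fun s => f s * g s) t (l * g t + f t * m).
Proof.
move=> df dg e e0; have cg := rdif_rcont dg.
set F := cmod (f t); set G := cmod (g t); set L := cmod l.
have [F0 G0 L0] : [/\ 0 <= F, 0 <= G & 0 <= L] by split; exact: cmod_ge0.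
have S0 : 0 < F + G + L + 2 by lra.
pose e' := Num.min 1 (e / (F + G + L + 2)).
have e'0 : 0 < e' by rewrite lt_min ltr01 divr_gt0.
have e'1 : e' <= 1 by rewrite ge_min lexx.
have e'2 : e' * (F + G + L + 2) <= e by rewrite -ler_pdivlMr // ge_min lexx orbT.
have [d1 d10 h1] := df _ e'0; have [d2 d20 h2] := dg _ e'0; have [d3 d30 h3] := cg _ e'0.
exists (Num.min d1 (Num.min d2 d3)); first by rewrite !lt_min d10 d20.
move=> s; rewrite !lt_min => /and3P[/h1 a1 /h2 a2 /h3 a3].
set x := `|s - t| in a1 a2 *.
have x0 : 0 <= x by rewrite /x.
rewrite (_ : _ - _ - _ = (f s - f t - (s - t)%:C * l) * g s + (s - t)%:C * l * (g s - g t)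
  + f t * (g s - g t - (s - t)%:C * m)); last by ring.
apply: le_trans (cmodD _ _) _; apply: le_trans (lerD (cmodD _ _) (lexx _)) _.
rewrite !cmodM cmodR -/x -/F -/L.
have gs : cmod (g s) <= G + 1 by have := cmodBD (g s) (g t) 0; rewrite !subr0 -/G; lra.
have b1 : cmod (f s - f t - (s - t)%:C * l) * cmod (g s) <= e' * x * (G + 1) by apply: ler_pM.
have b2 : x * L * cmod (g s - g t) <= x * L * e' by rewrite ler_wpM2l // mulr_ge0 // /L.
have b3 : F * cmod (g s - g t - (s - t)%:C * m) <= F * (e' * x) by rewrite ler_wpM2l // /F.
have b4 : e' * (F + G + L + 2) * x <= e * x by rewrite ler_wpM2r.
have b5 : 0 <= e' * x by rewrite mulr_ge0 // ltW.
lra.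
Qed.

Lemma near0R (R : realType) (P : R -> Prop) : (\forall r \near (0 : R)^', P r) ->
  exists2 d : R, 0 < d & forall r, r != 0 -> `|r| < d -> P r.
Proof.
move=> /nbhs_ballP[d /= d0 H]; exists d => // r r0 rd; apply: H => //.
by rewrite -ball_normE /= sub0r normrN.
Qed.

Lemma near_cvg (K : numFieldType) (V : pseudoMetricNormedZmodType K) (T : Type)
    (F : set_system T) (FF : Filter F) (f : T -> V) (l : V) (e : K) :
  f x @[x --> F] --> l -> 0 < e -> \forall x \near F, `|l - f x| <= e.
Proof. by move=> /cvgrPdist_le H e0; exact: H. Qed.

Lemma loewner_rdif (R : realType) n (u : R -> 'rV[R[i]]_n) (l : 'rV[R[i]]_n) t k :
  (r^-1)%:C *: (u (t + r) - u t) @[r --> (0 : R)^'] --> l ->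
  rdif (fun s => u s 0 k) t (l 0 k).
Proof.
move=> ul e e0; have e0' : 0 < e%:C by rewrite ltcR.
have [d d0 H] := near0R (near_cvg _ ul e0'); exists d => // s sd.
have [->|st] := eqVneq s t; first by rewrite !subrr mul0r subrr normr0 cmod0 mulr0.
have st0 : s - t != 0 by rewrite subr_eq0.
have := H (s - t) st0 sd; rewrite [t + (s - t)]addrC subrK vnormE lecR => h1.
have p : 0 < `|s - t| by rewrite normr_gt0.
have -> : u s 0 k - u t 0 k - (s - t)%:C * l 0 k
    = - ((s - t)%:C * (l - ((s - t)^-1)%:C *: (u s - u t)) 0 k).
  rewrite !mxE mulrBr mulrA -rmorphM mulfV // rmorph1 mul1r; ring.
rewrite cmodN cmodM cmodR mulrC ler_pM2r //.
exact: le_trans (cmod_vnorm _ _) h1.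
Qed.

Lemma rdif_expR (R : realType) (t : R) : rdif (fun s => (expR s)%:C) t (expR t)%:C.
Proof. by apply: rdif_of_derive. Qed.

Lemma vnorm_le_enorm (R : realType) n (z : 'rV[R[i]]_n) : vnorm z <= enorm z.
Proof. by apply: vnorm_le (enorm_ge0 z) _ => k; exact: cmod_enorm. Qed.

Lemma vnormD (R : realType) n (a b : 'rV[R[i]]_n) : vnorm (a + b) <= vnorm a + vnorm b.
Proof. by rewrite -lecR rmorphD /= -!vnormE ler_normD. Qed.

Lemma vnormBD (R : realType) n (a b c : 'rV[R[i]]_n) : vnorm (a - c) <= vnorm (a - b) + vnorm (b - c).
Proof. by rewrite -(subrK b a) -addrA subrK vnormD. Qed.

Lemma rescaled_lipschitz (R : realType) n (u : R -> 'rV[R[i]]_n) :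
  (forall t, 0 <= t -> eball n (u t)) -> locally_lipschitz_pos u ->
  forall t, 0 <= t -> exists e L : R, 0 < e /\ forall s1 s2, 0 <= s1 -> 0 <= s2 ->
     `|s1 - t| < e -> `|s2 - t| < e ->
     vnorm ((expR s1)%:C *: u s1 - (expR s2)%:C *: u s2) <= L * `|s1 - s2|.
Proof.
move=> ub lip t t0; have [e [L [e0 H]]] := lip t t0.
exists (Num.min e 1), (expR (t + 1) * (Num.max 0 L + 1)); split; first by rewrite lt_min e0 ltr01.
move=> s1 s2 s10 s20; rewrite !lt_min => /andP[a1 a1'] /andP[a2 a2'].
have := H s1 s2 s10 s20 a1 a2; set x := `|s1 - s2| => h1.
have x0 : 0 <= x by rewrite /x.
have b1 : s1 <= t + 1 by move: a1'; rewrite ltr_norml => /andP[]; lra.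
have b2 : s2 <= t + 1 by move: a2'; rewrite ltr_norml => /andP[]; lra.
have E1 : expR s1 <= expR (t + 1) by rewrite ler_expR.
have D : `|expR s1 - expR s2| <= expR (t + 1) * x.
  have key y z : z <= t + 1 -> expR z - expR y <= expR (t + 1) * `|z - y|.
    move=> zt; have := expR_ge1Dx (y - z); have Ez : expR z <= expR (t + 1) by rewrite ler_expR.
    have -> : expR y = expR z * expR (y - z) by rewrite -expRD addrC subrK.
    move=> h; have := ler_wpM2l (expR_ge0 z) h; have := ler_norm (z - y).
    have := ler_wpM2r (normr_ge0 (z - y)) Ez; have := ler_wpM2l (expR_ge0 z) (ler_norm (z - y)); lra.
  rewrite ler_norml; apply/andP; split; last exact: key.
  by rewrite lerNl opprB /x distrC; exact: key.
have -> : (expR s1)%:C *: u s1 - (expR s2)%:C *: u s2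
    = (expR s1)%:C *: (u s1 - u s2) + (expR s1 - expR s2)%:C *: u s2.
  by rewrite rmorphB scalerBr scalerBl addrA subrK.
apply: le_trans (vnormD _ _) _; rewrite !vnormZ !cmodR (gtr0_norm (expR_gt0 _)).
have h2 : vnorm (u s1 - u s2) <= Num.max 0 L * x.
  apply: le_trans (vnorm_le_enorm _) _; apply: le_trans h1 _.
  by rewrite ler_wpM2r // le_max lexx orbT.
have h3 : vnorm (u s2) <= 1 by apply: le_trans (vnorm_le_enorm _) (ltW (ub _ s20)).
have h4 : expR s1 * vnorm (u s1 - u s2) <= expR (t + 1) * (Num.max 0 L * x).
  by apply: ler_pM => //; rewrite ?expR_ge0 ?vnorm_ge0.
have h5 : `|expR s1 - expR s2| * vnorm (u s2) <= expR (t + 1) * x * 1.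
  by apply: ler_pM => //; rewrite ?vnorm_ge0.
lra.
Qed.

Lemma lipschitz_stay (R : realType) n (w : R -> 'rV[R[i]]_n) z (rho s : R) : 0 <= s ->
  (exists e L : R, 0 < e /\ forall s1 s2, 0 <= s1 -> 0 <= s2 ->
     `|s1 - s| < e -> `|s2 - s| < e -> vnorm (w s1 - w s2) <= L * `|s1 - s2|) ->
  vnorm (w s - z) < rho ->
  exists2 d : R, 0 < d & forall x, s <= x -> x < s + d -> vnorm (w x - z) < rho.
Proof.
move=> s0 [e [L [e0 H]]] ps; pose L' := Num.max 0 L.
have L'0 : 0 <= L' by rewrite le_max lexx.
have LL' : L <= L' by rewrite le_max lexx orbT.
have L1 : 0 < L' + 1 by lra.
have p : 0 < rho - vnorm (w s - z) by rewrite subr_gt0.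
exists (Num.min e ((rho - vnorm (w s - z)) / (L' + 1))); first by rewrite lt_min e0 divr_gt0.
move=> x sx; rewrite -ltrBlDl lt_min ltr_pdivlMr // => /andP[xe xL].
apply: le_lt_trans (vnormBD _ (w s) _) _.
have x0 : 0 <= x - s by lra.
have := H x s (le_trans s0 sx) s0; rewrite subrr normr0 ger0_norm // => /(_ xe e0) h1.
have : L * (x - s) <= L' * (x - s) by rewrite ler_wpM2r.
lra.
Qed.

(** Two passes. The first confines the rescaled orbit [w] to a neighbourhood of [z] for all times,
    by a bootstrap; the second uses this confinement to isolate the coefficient in the [i]-th
    component of the speed. No constant depends on [t], which allows the limit [t -> +oo]
    afterwards. *)
Lemma loewner_coef_bound (R : realType) n (r M rho Q : R) (h : 'rV[R[i]]_n -> R -> 'rV[R[i]]_n)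
    (i j : 'I_n) (u : R -> 'rV[R[i]]_n) : i != j ->
  0 < r -> 0 <= M -> (forall t, 0 <= t -> bounded_germ r M (h ^~ t)) -> 0 <= Q ->
  {ae @lebesgue_measure R, forall t, 0 <= t -> cmod (coef2 i j (h ^~ t)) <= Q} ->
  0 < rho -> rho <= r / 32 -> 4 * cauchy2 r M * rho < 1 ->
  loewner_solution h (rho%:C *: delta_mx 0 j) u ->
  forall t, 0 <= t -> cmod ((expR t)%:C * u t 0 i)
    <= Q * rho ^+ 2 + (cauchy3 r M + 128 * cauchy2 r M ^+ 2) * rho ^+ 3.
Proof.
move=> ij r0 M0 germ Q0 hQ rho0 rho32 K1 [ub lip u0 du].
have lebF := ae_filter_ringOfSetsType (@lebesgue_measure R).
set K := cauchy2 r M in K1 *; set K3 := cauchy3 r M.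
have K0 : 0 <= K by exact: cauchy2_ge0. have K30 : 0 <= K3 by exact: cauchy3_ge0.
pose z : 'rV[R[i]]_n := rho%:C *: delta_mx 0 j.
have zn : vnorm z <= rho by rewrite vnormZ cmodR gtr0_norm // ler_piMr ?vnorm_delta // ltW.
pose w t := (expR t)%:C *: u t.
have w0 : w 0 = z by rewrite /w expR0 rmorph1 scale1r u0.
have wlip := rescaled_lipschitz ub lip.
have wlipk k t : 0 <= t -> exists e L : R, 0 < e /\ forall s1 s2, 0 <= s1 -> 0 <= s2 ->
     `|s1 - t| < e -> `|s2 - t| < e -> cmod (w s1 0 k - w s2 0 k) <= L * `|s1 - s2|.
  move=> t0; have [e [L [e0 H]]] := wlip t t0; exists e, L; split=> // s1 s2 a b c d.
  apply: le_trans (H s1 s2 a b c d).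
  by have := cmod_vnorm (w s1 - w s2) k; rewrite mxE [(- w s2) 0 k]mxE.
have uw t : u t = (expR (- t))%:C *: w t.
  by rewrite /w scalerA -rmorphM -expRD addNr expR0 rmorph1 scale1r.
have dw k : {ae @lebesgue_measure R, forall t, 0 <= t ->
    rdif (fun s => w s 0 k) t ((expR t)%:C * (u t 0 k - h (u t) t 0 k))}.
  apply: (@filterS _ _ lebF _ _ _ du) => t H t0; have := loewner_rdif k (H t0).
  move=> H1; have := rdifM (rdif_expR t) H1; rewrite [(- h (u t) t) 0 k]mxE mulrBr mulrN.
  by apply: rdif_ext ltr01 _ => s _; rewrite mxE.
have small t : 0 <= t -> vnorm (w t - z) < rho -> vnorm (u t) <= 2 * rho * expR (- t) /\ vnorm (u t) <= r / 16.
  move=> t0 h1; have wt : vnorm (w t) <= 2 * rho.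
    by have := vnormD (w t - z) z; rewrite subrK; lra.
  have Et : expR (- t) <= 1 by rewrite -expR0 ler_expR oppr_le0.
  have h2 : vnorm (u t) <= 2 * rho * expR (- t).
    rewrite uw vnormZ cmodR gtr0_norm ?expR_gt0 // mulrC ler_wpM2r // expR_ge0 //.
  split=> //; apply: le_trans h2 _; have := ler_wpM2l (ltW rho0) Et; lra.
have EE (t : R) : expR t * (expR (- t) * expR (- t)) = expR (- t).
  by rewrite mulrA -expRD subrr expR0 mul1r.
(* The speed of a component of [w] is [e^t] times that of [h(u) - u]. With [|u| <= 2 rho e^(-t)],
   the quadratic bound on [h - id] makes it at most [4 K rho^2 e^(-t)], which is integrable over all
   times. *)
have step1 T k : 0 <= T -> (forall t, 0 <= t -> t < T -> vnorm (w t - z) < rho) ->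
    cmod (w T 0 k - z 0 k) <= 4 * K * rho ^+ 2.
  move=> T0 H; rewrite -w0; apply: (@le_of_ae_rdif _ (fun s => w s 0 k)) => //.
  - by rewrite mulr_ge0 ?sqr_ge0 // mulr_ge0.
  - exact: wlipk.
  - apply: (@filterS _ _ lebF _ _ _ (dw k)) => t dt t0 tT.
    exists ((expR t)%:C * (u t 0 k - h (u t) t 0 k)); split; first exact: dt.
    have [s1 s2] := small t t0 (H t t0 tT).
    rewrite cmodM cmodR gtr0_norm ?expR_gt0 // cmodBC.
    have u8 : vnorm (u t) <= r / 8 by lra.
    have h1 := germ_linear_approx k r0 M0 (germ t t0) u8; rewrite -/K in h1.
    have h2 : vnorm (u t) ^+ 2 <= (2 * rho * expR (- t)) ^+ 2.
      by rewrite ler_pXn2r ?nnegrE ?vnorm_ge0 // mulr_ge0 ?expR_ge0 // mulr_ge0 // ltW.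
    have h3 := le_trans h1 (ler_wpM2l K0 h2).
    apply: le_trans (ler_wpM2l (expR_ge0 t) h3) _.
    have -> : 4 * K * rho ^+ 2 * expR (- t) = 4 * K * rho ^+ 2 * (expR t * (expR (- t) * expR (- t))) by rewrite EE.
    by rewrite le_eqVlt; apply/orP; left; apply/eqP; ring.
have step1v T : 0 <= T -> (forall t, 0 <= t -> t < T -> vnorm (w t - z) < rho) ->
    vnorm (w T - z) <= 4 * K * rho ^+ 2.
  move=> T0 H; apply: vnorm_le => [|k]; first by rewrite mulr_ge0 ?sqr_ge0 // mulr_ge0.
  by rewrite mxE [(- z) 0 k]mxE; exact: step1.
have Krho : 4 * K * rho ^+ 2 < rho.
  by have : 4 * K * rho * rho < 1 * rho by [rewrite ltr_pM2r]; rewrite expr2; lra.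
(* At a first time where the distance reaches [rho], the previous bound would still give at most
   [4 K rho^2 < rho]. *)
have stay t : 0 <= t -> vnorm (w t - z) < rho.
  move=> t0; rewrite ltNge; apply/negP => bad.
  have [s s0 ns|T [T0 PT below]] := @first_exit R (fun t => rho <= vnorm (w t - z)) t t0 bad.
    have ps : vnorm (w s - z) < rho by rewrite ltNge; apply/negP.
    have [d d0 H] := lipschitz_stay s0 (wlip s s0) ps.
    clear bad ns; exists d; first exact: d0.
    move=> x sx xd; apply/negP; rewrite -ltNge; exact: H.
  have H : vnorm (w T - z) <= 4 * K * rho ^+ 2.
    apply: step1v T0 _ => s s0 sT; rewrite ltNge; apply/negP; exact: below.
  by clear below bad; have := le_lt_trans H Krho; rewrite ltNge PT.
move=> T T0.
have zi : z 0 i = 0 by rewrite !mxE eqxx (negbTE ij) /= mulr0.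
have -> : (expR T)%:C * u T 0 i = w T 0 i - w 0 0 i by rewrite w0 zi subr0 mxE.
apply: (@le_of_ae_rdif _ (fun s => w s 0 i)) => //.
- apply: addr_ge0; apply: mulr_ge0; rewrite ?exprn_ge0 // ?(ltW rho0) //.
  by apply: addr_ge0 => //; apply: mulr_ge0 => //; exact: sqr_ge0.
- exact: wlipk.
apply: (@filterS2 _ _ lebF _ _ _ _ (dw i) hQ) => t dt qt t0 tT.
exists ((expR t)%:C * (u t 0 i - h (u t) t 0 i)); split; first exact: dt.
have [s1 s2] := small t t0 (stay t t0).
rewrite cmodM cmodR gtr0_norm ?expR_gt0 // cmodBC.
set E := expR (- t) in s1 s2 *.
have Ep : 0 < E by exact: expR_gt0.
have E1 : E <= 1 by rewrite -expR0 ler_expR oppr_le0.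
pose x : 'rV[R[i]]_n := (E * rho)%:C *: delta_mx 0 j.
have xE : x = E%:C *: z by rewrite /x /z scalerA -rmorphM.
have cErho : cmod (E * rho)%:C = E * rho by rewrite cmodR gtr0_norm // mulr_gt0.
have Erho : E * rho <= rho by rewrite ler_piMl // ltW.
have Erho0 : 0 < E * rho by exact: mulr_gt0.
have s0 : 0 < 2 * rho * E by rewrite mulr_gt0 // mulr_gt0.
have s16 : 2 * rho * E <= r / 16 by lra.
have xs : vnorm x <= 2 * rho * E.
  rewrite /x vnormZ cErho; apply: le_trans (_ : E * rho * 1 <= _); last lra.
  by rewrite ler_wpM2l ?vnorm_delta // ltW.
have g1 := germ_increment i r0 M0 (germ t t0) s0 s16 xs s1.
have ux : vnorm (u t - x) <= E * (4 * K * rho ^+ 2).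
  rewrite uw xE -/E -scalerBr vnormZ cmodR gtr0_norm // ler_wpM2l ?(ltW Ep) //.
  by apply: step1v => // s s0' _; exact: stay.
have xi : x 0 i = 0 by rewrite !mxE eqxx (negbTE ij) /= mulr0.
have [_ _ T2] := germ_coef2 ij r0 M0 (germ t t0).
have Er8 : cmod (E * rho)%:C <= r / 8.
  by rewrite cErho; apply: le_trans Erho _; clear -rho32 r0; lra.
have g2 := T2 _ Er8; rewrite -/x cErho -/K3 in g2; rewrite xi subr0 -/K in g1.
have g3 : cmod (coef2 i j (h^~ t) * (E * rho)%:C ^+ 2) <= Q * (E * rho) ^+ 2.
  by rewrite cmodM cmodX cErho ler_wpM2r ?sqr_ge0 //; exact: qt.
have g4 : 16 * K * (2 * rho * E) * vnorm (u t - x) <= 16 * K * (2 * rho * E) * (E * (4 * K * rho ^+ 2)).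
  by apply: ler_wpM2l ux; apply: mulr_ge0 (ltW s0); exact: mulr_ge0.
have g5 : cmod (h (u t) t 0 i - u t 0 i) <= (Q * rho ^+ 2 + (K3 + 128 * K ^+ 2) * rho ^+ 3) * (E * E).
  rewrite (_ : h (u t) t 0 i - u t 0 i = (h (u t) t 0 i - u t 0 i - h x t 0 i)
    + (h x t 0 i - coef2 i j (h^~ t) * (E * rho)%:C ^+ 2) + coef2 i j (h^~ t) * (E * rho)%:C ^+ 2); last by ring.
  apply: le_trans (cmodD _ _) _; apply: le_trans (lerD (cmodD _ _) (lexx _)) _.
  apply: le_trans (lerD (lerD (le_trans g1 g4) g2) g3) _.
  have h3 : K3 * (E * rho) ^+ 3 <= K3 * rho ^+ 3 * (E * E).
    have -> : K3 * (E * rho) ^+ 3 = K3 * rho ^+ 3 * (E * E) * E by ring.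
    rewrite ler_piMr //; apply: mulr_ge0 (mulr_ge0 (ltW Ep) (ltW Ep)).
    by apply: mulr_ge0 => //; rewrite exprn_ge0 // ltW.
  have -> : 16 * K * (2 * rho * E) * (E * (4 * K * rho ^+ 2)) = 128 * K ^+ 2 * rho ^+ 3 * (E * E) by ring.
  have -> : Q * (E * rho) ^+ 2 = Q * rho ^+ 2 * (E * E) by ring.
  clear -h3; lra.
apply: le_trans (ler_wpM2l (expR_ge0 t) g5) _.
by rewrite mulrCA EE.
Qed.

(** * Locally uniform limits, and the bound for the parametric class *)

Lemma family_nbhs (K : numFieldType) (U : choiceType) (V : normedModType K) (fam : set U -> Prop)
    (A : set U) (e : K) (f : {family fam, U -> V}) :
  0 < e -> fam A -> nbhs f [set g : {family fam, U -> V} | forall y, A y -> `|f y - g y| < e].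
Proof.
move=> e0 FA; have := fam_nbhs f (entourage_ball V (PosNum e0)) FA.
by apply: filterS => g /= H y /H; rewrite -ball_normE.
Qed.

Lemma family_cvg_intro (K : numFieldType) (U : choiceType) (V : normedModType K) (fam : set U -> Prop)
    (F : set_system (U -> V)) (f : U -> V) : Filter F ->
  (forall A e, fam A -> 0 < e -> F [set g | forall y, A y -> `|f y - g y| < e]) ->
  {family fam, F --> f}.
Proof.
move=> FF H; apply/fam_cvgP => A FA P /uniform_nbhs[E [entE EP]].
move: entE; rewrite -entourage_ballE => -[e /= e0 eE].
apply: filterS (H A e FA e0) => g Hg; apply: EP => y /Hg h.
by apply: eE; rewrite /= -ball_normE.
Qed.

Lemma family_cvg_point (R : realType) n (F : R -> 'rV[R[i]]_n -> 'rV[R[i]]_n) f z :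
  eball n z -> {family @ball_compact R n, F @ +oo --> f} ->
  forall e : R, 0 < e -> exists2 t : R, 0 <= t & vnorm (f z - F t z) <= e.
Proof.
move=> zb Ff e e0.
have Kz : @ball_compact R n [set z].
  by split; [exact: compact_set1|move=> _ ->].
have e0' : 0 < e%:C by rewrite ltcR.
have H := Ff _ (family_nbhs f e0' Kz).
have [t [/= t0 h]] := filter_ex (filterI (nbhs_pinfty_ge (num_real 0)) H).
by exists t => //; rewrite -lecR -vnormE; apply: ltW; exact: h.
Qed.

(** The flow bound at [rho e_j] passes to [f] as time grows, since singletons are compact. It is
    then compared with the expansion of [f], and [rho] tends to [0]. The constants for the fields
    are those common to the class [M]; those for [f] may depend on [f]. *)
Lemma parametric_coef2_le (R : realType) n (alpha : R) (f : 'rV[R[i]]_n -> 'rV[R[i]]_n) (i j : 'I_n) :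
  i != j -> 0 <= alpha < 1 -> Salpha0 n alpha f ->
  cmod (coef2 i j f) <= 3 * Num.sqrt 3 / 2 * d1 alpha.
Proof.
move=> ij al [hf nf [h [v [[hM _] hMg sol lim]]]].
set Q := 3 * _ / 2 * _.
have lebF := ae_filter_ringOfSetsType (@lebesgue_measure R).
pose r : R := 20^-1 / (n%:R + 1).
have n1 : 0 < n%:R + 1 :> R by rewrite ltr_wpDl.
have r0 : 0 < r by rewrite divr_gt0 // invr_gt0.
have germ t : 0 <= t -> bounded_germ r 1 (h ^~ t) by move=> /hM; exact: classM_germ.
have hQ : {ae @lebesgue_measure R, forall t, 0 <= t -> cmod (coef2 i j (h ^~ t)) <= Q}.
  apply: (@filterS _ _ lebF _ _ _ hMg) => t H t0.
  exact: classMg_coef2_le ij al (hM t t0) (H t0).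
have Q0 : 0 <= Q.
  apply: mulr_ge0; first by rewrite divr_ge0 // mulr_ge0 // sqrtr_ge0.
  have [a0 a1] := andP al.
  by rewrite /d1; case: ifP => // _; rewrite divr_ge0 // subr_ge0 ltW.
have [r1 [M1 [r10 M10 gf]]] := hol_germ hf nf.
have [_ _ T] := germ_coef2 ij r10 M10 gf.
set c := coef2 i j f in T *.
set K := cauchy2 r 1; set K3 := cauchy3 r 1; set K3' := cauchy3 r1 M1 in T.
have K0 : 0 <= K by exact: cauchy2_ge0.
have K30 : 0 <= K3 by exact: cauchy3_ge0.
have K3'0 : 0 <= K3' by exact: cauchy3_ge0.
have C0 : 0 <= K3 + 128 * K ^+ 2 + K3'.
  by apply: addr_ge0 => //; apply: addr_ge0 => //; apply: mulr_ge0 => //; exact: sqr_ge0.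
have K1 : 0 < 4 * K + 1 by lra.
(* The excess over [Q] is truncated at [0], because [eq0_of_le_small] needs a nonnegative quantity.
   After division by [rho^2] it is at most a constant times [rho]. *)
suff E : Num.max 0 (cmod c - Q) = 0.
  by have : cmod c - Q <= Num.max 0 (cmod c - Q); [rewrite le_max lexx orbT|rewrite E; lra].
apply: (@eq0_of_le_small _ _ (K3 + 128 * K ^+ 2 + K3')
  (Num.min (Num.min (r1 / 8) (r / 32)) (Num.min 2^-1 (2^-1 / (4 * K + 1))))) => //.
- by rewrite le_max lexx.
- by rewrite !lt_min; do ![apply/andP; split]; rewrite ?divr_gt0 ?invr_gt0.
move=> rho rho0; rewrite !le_min => /andP[/andP[a1 a2] /andP[a3 a4]].
have Krho : 4 * K * rho < 1.
  have : rho * (4 * K + 1) <= 2^-1.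
    by rewrite -ler_pdivlMr.
  have := mulr_ge0 K0 (ltW rho0); lra.
pose z : 'rV[R[i]]_n := rho%:C *: delta_mx 0 j.
have crho : cmod rho%:C = rho by rewrite cmodR gtr0_norm.
have zb : eball n z by rewrite /eball /= /z enormZ enorm_delta crho; lra.
have B := loewner_coef_bound ij r0 ler01 germ Q0 hQ rho0 a2 Krho (sol z zb).
have fz : cmod (f z 0 i) <= Q * rho ^+ 2 + (K3 + 128 * K ^+ 2) * rho ^+ 3.
  apply/ler_addgt0Pr => e e0.
  have [t t0 ft] := family_cvg_point zb lim e0.
  have := le_trans (cmod_vnorm _ i) ft; rewrite !mxE => h1.
  have := cmodBD (f z 0 i) ((expR t)%:C * v z t 0 i) 0; rewrite !subr0.
  have := B t t0; rewrite -/K -/K3; lra.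
have T1 := T rho%:C; rewrite crho -/z in T1.
have h1 : cmod c * rho ^+ 2 <= (Q + (K3 + 128 * K ^+ 2 + K3') * rho) * rho ^+ 2.
  have -> : cmod c * rho ^+ 2 = cmod (c * rho%:C ^+ 2) by rewrite cmodM cmodX crho.
  rewrite (_ : c * rho%:C ^+ 2 = f z 0 i - (f z 0 i - c * rho%:C ^+ 2)); last by ring.
  apply: le_trans (cmodB _ _) _; apply: le_trans (lerD fz (T1 a1)) _.
  by rewrite le_eqVlt; apply/orP; left; apply/eqP; ring.
rewrite ge_max; apply/andP; split; first by apply: mulr_ge0 C0 (ltW rho0).
have := h1; rewrite ler_pM2r ?exprn_gt0 //; lra.
Qed.

(** * The extremal shear *)

(** The coefficient is free because [- c] occurs as well: [shear i j (- c)] is the inverse map, the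
    field [[Df]^-1 f] and the Loewner field. *)
Definition shear (R : realType) n (i j : 'I_n) (c : R[i]) (z : 'rV[R[i]]_n) : 'rV[R[i]]_n :=
  z + (c * z 0 j ^+ 2) *: delta_mx 0 i.

Lemma vnormZ_delta (R : realType) n (a : R[i]) (k : 'I_n) :
  vnorm (a *: (delta_mx 0 k : 'rV[R[i]]_n)) <= cmod a.
Proof. by rewrite vnormZ ler_piMr // vnorm_delta. Qed.

Lemma shear_diff (R : realType) n (i j : 'I_n) (c : R[i]) (x : 'rV[R[i]]_n) :
  differentiable (shear i j c) x /\
  'd (shear i j c) x = (fun w => w + (2 * c * x 0 j * w 0 j) *: delta_mx 0 i) :> (_ -> _).
Proof.
pose g (w : 'rV[R[i]]_n) : 'rV[R[i]]_n := w + (2 * c * x 0 j * w 0 j) *: delta_mx 0 i.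
have lg : linear g.
  by move=> a u v; rewrite /g; apply/rowP => k; rewrite !mxE; ring.
pose l : {linear 'rV[R[i]]_n -> 'rV[R[i]]_n} := HB.pack g (GRing.isLinear.Build _ _ _ _ g lg).
have L0 : 0 <= 1 + cmod (2 * c * x 0 j) by rewrite addr_ge0.
apply: (@differentiable_of_eps _ _ _ _ _ l (1 + cmod (2 * c * x 0 j))) => //.
  move=> h; rewrite -[l h]/(g h) /g; apply: le_trans (vnormD _ _) _.
  rewrite [leRHS]mulrDl mul1r lerD2l; apply: le_trans (vnormZ_delta _ _) _; rewrite cmodM.
  by apply: ler_wpM2l; [exact: cmod_ge0|exact: cmod_vnorm].
move=> e e0; have c0 : 0 < cmod c + 1 by rewrite ltr_wpDl.
exists (e / (cmod c + 1)); first by rewrite divr_gt0.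
move=> h; rewrite ltr_pdivlMr // => hd; rewrite -[l h]/(g h).
have -> : shear i j c (h + x) - shear i j c x - g h = (c * h 0 j ^+ 2) *: delta_mx 0 i.
  by rewrite /shear /g; apply/rowP => k; rewrite !mxE; ring.
apply: le_trans (vnormZ_delta _ _) _; rewrite cmodM cmodX expr2 mulrA.
have h1 := cmod_vnorm h j; have h2 := cmod_ge0 (h 0 j); have h3 := cmod_ge0 c; have h4 := vnorm_ge0 h.
apply: ler_pM => //; first by rewrite mulr_ge0.
apply: le_trans (ler_wpM2l h3 h1) _; lra.
Qed.

Lemma shear_normalized (R : realType) n (i j : 'I_n) (c : R[i]) : normalized (shear i j c).
Proof.
split; first by rewrite /shear mxE expr0n mulr0 scale0r addr0.
by move=> v; rewrite (shear_diff i j c 0).2 mxE mulr0 mul0r scale0r addr0.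
Qed.

Lemma shearK (R : realType) n (i j : 'I_n) (c : R[i]) : i != j ->
  cancel (shear i j c) (shear i j (- c)).
Proof.
move=> ij z; have zj : shear i j c z 0 j = z 0 j.
  by rewrite /shear !mxE eq_sym (negbTE ij) andbF mulr0 addr0.
by rewrite {1}/shear zj /shear mulNr scaleNr addrK.
Qed.

Lemma eball_open (R : realType) n : open (@eball R n).
Proof.
rewrite openE => z zb; have z1 : enorm z ^+ 2 < 1 by rewrite expr_lt1 ?enorm_ge0.
have n1 : 0 < n%:R * 3 + 1 :> R by rewrite ltr_wpDl ?mulr_ge0.
pose d := Num.min 1 ((1 - enorm z ^+ 2) / (n%:R * 3 + 1)).
have d0 : 0 < d by rewrite lt_min ltr01 divr_gt0 // subr_gt0.
have d1 : d <= 1 by rewrite ge_min lexx.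
have d2 : d * (n%:R * 3 + 1) <= 1 - enorm z ^+ 2 by rewrite -ler_pdivlMr // ge_min lexx orbT.
suff : nbhs (z : 'rV[R[i]]_n) (@eball R n) by [].
apply/nbhs_ballP; exists d%:C; first by rewrite /= ltcR.
move=> w; rewrite -ball_normE /= vnormE ltcR => wd.
rewrite /eball /= enorm_ltP ?ler01 // expr1n.
apply: le_lt_trans (_ : enorm z ^+ 2 + n%:R * (3 * d) < 1); last by move: d2; clear -d0; lra.
rewrite enorm_sqr.
have -> : n%:R * (3 * d) = \sum_(k < n) (3 * d) by rewrite sumr_const card_ord mulr_natl.
rewrite -big_split; apply: ler_sum => k _ /=.
have h1 : cmod (w 0 k) <= cmod (z 0 k) + d.
  have := cmodD (z 0 k) (- (z 0 k - w 0 k)); rewrite cmodN opprB addrC subrK.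
  have := cmod_vnorm (z - w) k; rewrite !mxE; lra.
have h2 : cmod (z 0 k) <= 1 by apply: le_trans (cmod_enorm z k) _; exact: ltW.
have h3 : cmod (w 0 k) ^+ 2 <= (cmod (z 0 k) + d) ^+ 2.
  by rewrite ler_pXn2r ?nnegrE ?addr_ge0 // ltW.
apply: le_trans h3 _; move: (cmod_ge0 (z 0 k)) h2; move: (cmod _) => a a0 a1.
have := ler_wpM2r (ltW d0) a1; have := ler_wpM2r (ltW d0) d1; rewrite !expr2; clear; lra.
Qed.

Lemma shear_hol (R : realType) n (i j : 'I_n) (c : R[i]) : hol n (shear i j c).
Proof. by move=> z _; exact: (shear_diff i j c z).1. Qed.

(** The inverse is global, so the whole ball serves as neighbourhood of each point. Its image is the
    preimage of the ball under the inverse shear, hence open. *)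
Lemma shear_locally_biholomorphic (R : realType) n (i j : 'I_n) (c : R[i]) : i != j ->
  locally_biholomorphic (shear i j c).
Proof.
move=> ij z zb; exists (eball n), (shear i j (- c)); split; split.
- exact: eball_open.
- exact: zb.
- by [].
- have -> : shear i j c @` eball n = shear i j (- c) @^-1` eball n.
    apply/seteqP; split => [_ [w wb <-]|w wb]; first by rewrite /preimage /= shearK.
    exists (shear i j (- c) w) => //.
    by have := shearK (- c) ij w; rewrite opprK.
  apply: open_comp (@eball_open R n) => w _.
  exact: differentiable_continuous (shear_diff i j (- c) w).1.
- exact: shear_hol.
- by move=> w _; exact: (shear_diff i j (- c) w).1.
- by move=> w _; exact: shearK.
Qed.

Lemma shear_jacobian (R : realType) n (i j : 'I_n) (c : R[i]) (z : 'rV[R[i]]_n) : i != j ->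
  shear i j c z *m invmx ('J (shear i j c) z) = shear i j (- c) z.
Proof.
move=> ij; have df := (shear_diff i j c z).1.
have dk := (shear_diff i j (- c) (shear i j c z)).1.
have dkf v : 'd (shear i j (- c)) (shear i j c z) ('d (shear i j c) z v) = v.
  apply: diff_left_inverse df dk _.
  have : nbhs z [set: 'rV[R[i]]_n] by exact: filterT.
  by apply: filterS => w _; exact: shearK.
have E : 'J (shear i j c) z *m 'J (shear i j (- c)) (shear i j c z) = 1%:M.
  apply/row_matrixP => l; rewrite rowE [RHS]rowE mulmxA mulmx1.
  by rewrite /jacobian !mul_rV_lin1 dkf.
have U := (mulmx1_unit E).1.
(* The differential at [z] fixes [z - c z_j^2 e_i] up to the added term [2 c z_j^2 e_i], and the sum
   is [z + c z_j^2 e_i]. *)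
suff -> : shear i j c z = shear i j (- c) z *m 'J (shear i j c) z by rewrite mulmxK.
rewrite /jacobian mul_rV_lin1 (shear_diff i j c z).2 /shear !mxE !(eq_sym j) (negbTE ij) andbF /= mulr0n mulr0 addr0.
by apply/rowP => k; rewrite !mxE; ring.
Qed.

(** For [X = |z_i|^2] and [Y = |z_j|^2], the gap [(X + Y)^3 - 27/4 X Y^2] equals
    [(X - Y / 2)^2 (X + 4 Y)]. It vanishes at [Y = 2 X], the direction that is also extremal for the
    coefficient. *)
Lemma shear_term_le (R : realType) n (i j : 'I_n) (d : R) (c : R[i]) (z : 'rV[R[i]]_n) : i != j ->
  0 <= d -> cmod c <= 3 * Num.sqrt 3 / 2 * d ->
  cmod (c * z 0 j ^+ 2 * (z 0 i)^*%C) <= d * enorm z ^+ 3.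
Proof.
move=> ij d0 cd; rewrite cmodM cmodJ cmodM cmodX.
have N0 := enorm_ge0 z.
have ab : cmod (z 0 i) ^+ 2 + cmod (z 0 j) ^+ 2 <= enorm z ^+ 2.
  rewrite enorm_sqr (bigD1 i) //= lerD2l (bigD1 j) ?(eq_sym j) //= lerDl.
  by rewrite sumr_ge0 // => k _; rewrite sqr_ge0.
move: (cmod_ge0 (z 0 i)) (cmod_ge0 (z 0 j)) (cmod_ge0 c) ab cd.
move: (cmod (z 0 i)) (cmod (z 0 j)) (cmod c) (enorm z) N0 => a b s N N0 a0 b0 s0 ab sd.
have s2 : s ^+ 2 <= 27 / 4 * d ^+ 2.
  have : s ^+ 2 <= (3 * Num.sqrt 3 / 2 * d) ^+ 2.
    by rewrite ler_pXn2r ?nnegrE // (le_trans s0 sd).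
  have -> : (3 * Num.sqrt 3 / 2 * d) ^+ 2 = 9 / 4 * Num.sqrt 3 ^+ 2 * d ^+ 2 by field.
  rewrite sqr_sqrtr //; lra.
rewrite -(@ler_pXn2r _ 2) ?nnegrE ?mulr_ge0 ?exprn_ge0 //.
set X := a ^+ 2; set Y := b ^+ 2.
have X0 : 0 <= X by exact: sqr_ge0. have Y0 : 0 <= Y by exact: sqr_ge0.
have XY : 27 / 4 * (X * Y ^+ 2) <= (N ^+ 2) ^+ 3.
  apply: le_trans (_ : (X + Y) ^+ 3 <= _); last first.
    by rewrite ler_pXn2r ?nnegrE ?addr_ge0 ?sqr_ge0.
  rewrite -subr_ge0 (_ : _ - _ = (X - Y / 2) ^+ 2 * (X + 4 * Y)); last by field.
  by rewrite mulr_ge0 ?sqr_ge0 ?addr_ge0 ?mulr_ge0.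
have -> : (s * b ^+ 2 * a) ^+ 2 = s ^+ 2 * (X * Y ^+ 2) by rewrite /X /Y; ring.
have -> : (d * N ^+ 3) ^+ 2 = d ^+ 2 * (N ^+ 2) ^+ 3 by ring.
apply: le_trans (ler_wpM2r (mulr_ge0 X0 (sqr_ge0 Y)) s2) _.
have := ler_wpM2l (sqr_ge0 d) XY; lra.
Qed.

Lemma d1_gt0 (R : realType) (alpha : R) : 0 <= alpha < 1 -> 0 < d1 alpha.
Proof.
move=> /andP[a0 a1]; rewrite /d1; case: ifPn => //; rewrite -ltNge => ah.
by rewrite divr_gt0 ?subr_gt0 //; lra.
Qed.

Lemma d1_le1 (R : realType) (alpha : R) : 0 <= alpha < 1 -> d1 alpha <= 1.
Proof.
move=> /andP[a0 a1]; rewrite /d1; case: ifPn => //; rewrite -ltNge => ah.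
by rewrite ler_pdivrMr; lra.
Qed.

(** For [r = |u|] the worst case is [Re u = - r] if [alpha <= 1/2] and [Re u = r] otherwise. There
    the gap factors as [(1 - r) (1 - alpha + alpha r)], respectively
    [(1 + r) (1 - alpha - alpha r)]. *)
Lemma near1_numrange (R : realType) (alpha : R) (u : R[i]) : 0 <= alpha < 1 ->
  cmod u < d1 alpha -> alpha * cmod (1 + u) ^+ 2 < Re (1 + u).
Proof.
move=> /andP[a0 a1] ud.
have -> : cmod (1 + u) ^+ 2 = 1 + 2 * Re u + cmod u ^+ 2.
  by rewrite !cmod_sqr !(ReD, ImD) /=; ring.
rewrite ReD /=; have := norm_Re u; have := cmod_ge0 u; move: ud.
move: (cmod u) (Re u) => r x ud r0; rewrite ler_norml => /andP[x1 x2].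
move: ud; rewrite /d1; case: ifPn => [ah r1|].
  have h1 : 0 < (1 - r) * (1 - alpha + alpha * r).
    by rewrite mulr_gt0 ?subr_gt0 // ltr_wpDr ?subr_gt0 // mulr_ge0.
  have h2 : (2 * alpha - 1) * x <= (1 - 2 * alpha) * r.
    have : 0 <= (1 - 2 * alpha) * (x + r) by rewrite mulr_ge0 //; lra.
    lra.
  rewrite expr2; lra.
rewrite -ltNge => ah; have ap : 0 < alpha by lra.
rewrite ltr_pdivlMr // => r1.
have h1 : 0 < (1 + r) * (1 - alpha - alpha * r) by rewrite mulr_gt0 //; lra.
have h2 : (2 * alpha - 1) * x <= (2 * alpha - 1) * r by rewrite ler_wpM2l //; lra.
rewrite expr2; lra.
Qed.

Lemma hdot_shear (R : realType) n (i j : 'I_n) (c : R[i]) (z : 'rV[R[i]]_n) :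
  hdot (shear i j c z) z = (enorm z ^+ 2)%:C + c * z 0 j ^+ 2 * (z 0 i)^*%C.
Proof.
rewrite /shear hdotDl hdotZl hdot_self /hdot (bigD1 i) //= mxE !eqxx mul1r big1 ?addr0 // => k ki.
by rewrite mxE eqxx (negbTE ki) mul0r.
Qed.

Lemma shear_classMg (R : realType) n (alpha : R) (i j : 'I_n) (c : R[i]) : i != j ->
  0 <= alpha < 1 -> cmod c <= 3 * Num.sqrt 3 / 2 * d1 alpha ->
  classMg n (g_alpha alpha) (shear i j c) /\ classM n (shear i j c).
Proof.
move=> ij al cd; apply: (classMg_intro al (@shear_hol _ _ _ _ _) (@shear_normalized _ _ _ _ _)).
move=> z z1 z0; have N0 := enorm_gt0 z0; have dp := d1_gt0 al.
have N2 : 0 < enorm z ^+ 2 by rewrite exprn_gt0.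
rewrite hdot_shear mulrDr -rmorphM mulVf ?gt_eqF // rmorph1.
apply: near1_numrange => //.
rewrite cmodM cmodR ger0_norm ?invr_ge0 ?sqr_ge0 // mulrC ltr_pdivrMr //.
apply: le_lt_trans (shear_term_le z ij (ltW dp) cd) _.
by rewrite ltr_pM2l // exprS gtr_pMl.
Qed.

Lemma shear_starlike (R : realType) n (alpha : R) (i j : 'I_n) (c : R[i]) : i != j ->
  0 <= alpha < 1 -> cmod c <= 3 * Num.sqrt 3 / 2 * d1 alpha ->
  Salpha_star n alpha (shear i j c).
Proof.
move=> ij al cd; split; [exact: shear_hol|exact: shear_normalized|exact: shear_locally_biholomorphic|].
have -> : (fun z => shear i j c z *m invmx ('J (shear i j c) z)) = shear i j (- c).
  by apply/funext => z; exact: shear_jacobian.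
by apply: (shear_classMg ij al _).1; rewrite cmodN.
Qed.

(* The left-hand side bounds the squared norm of the orbit point at time [- ln tau].  With [t = sqrt 3 * a] and [u = 1 - tau] the gap is [u] times a quadratic form in [tau * (t - 1)] and [u], up to nonnegative terms. *)
Lemma shear_orbit_scalar (R : realType) (a tau : R) : 0 <= a -> a <= 1 -> 0 < tau -> tau <= 1 ->
  tau ^+ 2 * ((a + (1 - tau) * (3 * Num.sqrt 3 / 2 * (1 - a ^+ 2))) ^+ 2 + 1 - a ^+ 2) <= 1.
Proof.
move=> a0 a1 tau0 tau1; set q3 : R := Num.sqrt 3.
have q32 : q3 ^+ 2 = 3 by rewrite sqr_sqrtr.
have q30 : 0 <= q3 by exact: sqrtr_ge0.
pose t := q3 * a; pose u := 1 - tau.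
have t0 : 0 <= t by exact: mulr_ge0.
have u0 : 0 <= u by rewrite subr_ge0.
have a2 : a ^+ 2 = t ^+ 2 / 3 by rewrite /t exprMn q32; field.
have t3 : t ^+ 2 <= 3.
  rewrite /t exprMn q32; have : a ^+ 2 <= 1 by rewrite expr_le1.
  lra.
pose k := - (3 / 4) * t ^+ 3 + t ^+ 2 / 4 + 19 / 4 * t + 7 / 4.
have k0 : 0 <= k.
  have : 0 <= t * (3 - t ^+ 2) by rewrite mulr_ge0 ?subr_ge0.
  have := sqr_ge0 t; rewrite /k (exprS t 2); lra.
(* To be used with [X = tau (t - 1)]. For [t >= 1] every term is nonnegative. For [t < 1] the mixed
   term is not, but the discriminant of the form is nonpositive: [k^2 <= 16 (t + 2)]. *)
have quad X : (1 <= t -> 0 <= X) -> (t <= 1 -> X <= 0) -> 0 <= (t + 2) * X ^+ 2 + k * X * u + 4 * u ^+ 2.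
  move=> X1 X2; have [/X1 X0|t1] := leP 1 t.
    by rewrite !addr_ge0 ?mulr_ge0 ?sqr_ge0 // addr_ge0.
  have kt : k <= 7 / 4 + 5 * t.
    have : t ^+ 2 <= t by rewrite expr2 ler_piMl // ltW.
    have : 0 <= t ^+ 3 by rewrite exprn_ge0.
    rewrite /k; lra.
  have k2 : k ^+ 2 <= 16 * (t + 2).
    apply: le_trans (_ : (7 / 4 + 5 * t) ^+ 2 <= _).
      by rewrite ler_pXn2r ?nnegrE // (le_trans k0 kt).
    have : 0 <= t * (1 - t) by rewrite mulr_ge0 // subr_ge0 ltW.
    rewrite !expr2; lra.
  have h1 := sqr_ge0 (8 * u + k * X).
  have h2 : 0 <= (16 * (t + 2) - k ^+ 2) * X ^+ 2 by rewrite mulr_ge0 ?sqr_ge0 // subr_ge0.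
  have : 16 * ((t + 2) * X ^+ 2 + k * X * u + 4 * u ^+ 2) =
    (8 * u + k * X) ^+ 2 + (16 * (t + 2) - k ^+ 2) * X ^+ 2 by ring.
  lra.
have E : (a + u * (3 * q3 / 2 * (1 - a ^+ 2))) ^+ 2 + 1 - a ^+ 2 =
   1 + u * (3 * t - t ^+ 3) + u ^+ 2 * (3 / 4 * (3 - t ^+ 2) ^+ 2).
  have -> : (a + u * (3 * q3 / 2 * (1 - a ^+ 2))) ^+ 2 + 1 - a ^+ 2 =
     1 + u * (3 * t * (1 - a ^+ 2)) + u ^+ 2 * (9 / 4 * q3 ^+ 2 * (1 - a ^+ 2) ^+ 2).
    by rewrite /t; field.
  by rewrite q32 a2; field.
rewrite -/u E -subr_ge0.
have -> : 1 - tau ^+ 2 * (1 + u * (3 * t - t ^+ 3) + u ^+ 2 * (3 / 4 * (3 - t ^+ 2) ^+ 2)) =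
   u * (tau * ((t + 2) * (tau * (t - 1)) ^+ 2 + k * (tau * (t - 1)) * u + 4 * u ^+ 2) + u ^+ 3).
  by rewrite /u /k; field.
apply: mulr_ge0 u0 (addr_ge0 (mulr_ge0 (ltW tau0) (quad _ _ _)) (exprn_ge0 _ u0)) => ht.
  by rewrite mulr_ge0 ?subr_ge0 // ltW.
by rewrite mulr_ge0_le0 ?subr_le0 // ltW.
Qed.

(** The standard flow [f^-1(e^(-t) f(z))] of a starlike map, written out for [f = shear i j c]. *)
Definition shear_flow (R : realType) n (i j : 'I_n) (c : R[i]) (z : 'rV[R[i]]_n) (t : R) : 'rV[R[i]]_n :=
  (expR (- t))%:C *: z + ((expR (- t) - expR (- t) ^+ 2)%:C * (c * z 0 j ^+ 2)) *: delta_mx 0 i.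

Lemma shear_flow_ball (R : realType) n (i j : 'I_n) (c : R[i]) (z : 'rV[R[i]]_n) t : i != j ->
  cmod c <= 3 * Num.sqrt 3 / 2 -> eball n z -> 0 <= t -> eball n (shear_flow i j c z t).
Proof.
move=> ij cs zb t0; rewrite /shear_flow.
have : expR (- t) <= 1 by rewrite -expR0 ler_expR oppr_le0.
move: (expR_gt0 (- t)); move: (expR (- t)) => tau tau0 tau1.
move: zb; rewrite /eball /= !enorm_ltP ?ler01 // expr1n !(bigD1 (P := predT) i) //=.
set q := \sum_(k < n | k != i) cmod (z 0 k) ^+ 2.
have -> : \sum_(k < n | k != i) cmod ((tau%:C *: z
    + ((tau - tau ^+ 2)%:C * (c * z 0 j ^+ 2)) *: delta_mx 0 i) 0 k) ^+ 2 = tau ^+ 2 * q.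
  rewrite mulr_sumr; apply: eq_bigr => k ki.
  by rewrite !mxE (negbTE ki) andbF mulr0 addr0 cmodM cmodR exprMn (gtr0_norm tau0).
have jq : cmod (z 0 j) ^+ 2 <= q.
  rewrite /q (bigD1 j) ?(eq_sym j) //= lerDl.
  by rewrite sumr_ge0 // => k _; rewrite sqr_ge0.
rewrite !mxE !eqxx mulr1; set a := cmod (z 0 i) => aq.
have a0 : 0 <= a by exact: cmod_ge0.
have a1 : a <= 1.
  rewrite -(@expr_le1 _ 2) //; have := sqr_ge0 (cmod (z 0 j)); lra.
have u0 : 0 <= 1 - tau by rewrite subr_ge0.
have s0 : 0 <= 3 * Num.sqrt 3 / 2 :> R by rewrite divr_ge0 // mulr_ge0 // sqrtr_ge0.
set y := 3 * Num.sqrt 3 / 2 * (1 - a ^+ 2).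
have w1 : cmod (tau%:C * z 0 i + (tau - tau ^+ 2)%:C * (c * z 0 j ^+ 2)) <= tau * (a + (1 - tau) * y).
  apply: le_trans (cmodD _ _) _; rewrite !cmodM !cmodR (gtr0_norm tau0) -/a mulrDr lerD2l.
  have -> : tau - tau ^+ 2 = tau * (1 - tau) by ring.
  rewrite ger0_norm ?(mulr_ge0 (ltW tau0)) // -mulrA ler_wpM2l ?(ltW tau0) // ler_wpM2l //.
  rewrite -expr2 /y; apply: ler_pM => //; first by rewrite sqr_ge0.
  lra.
have w2 : cmod (tau%:C * z 0 i + (tau - tau ^+ 2)%:C * (c * z 0 j ^+ 2)) ^+ 2 <= (tau * (a + (1 - tau) * y)) ^+ 2.
  by rewrite ler_pXn2r ?nnegrE // (le_trans (cmod_ge0 _) w1).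
have := shear_orbit_scalar a0 a1 tau0 tau1; rewrite -/y.
(* The scalar inequality is not strict; strictness comes from [q + a^2 < 1], that is, from [z] lying
   in the open ball. *)
have tq : tau ^+ 2 * (q + a ^+ 2) < tau ^+ 2 by rewrite gtr_pMr ?exprn_gt0 // addrC.
move: w2; rewrite exprMn; clear -tq; lra.
Qed.

Lemma expRN_lipschitz (R : realType) (s t : R) : 0 <= s -> 0 <= t ->
  `|expR (- s) - expR (- t)| <= `|s - t|.
Proof.
wlog st : s t / s <= t.
  by move=> W s0 t0; have [h|/ltW h] := leP s t; [exact: W|rewrite distrC (distrC s); exact: W].
move=> s0 _; have [h _] := expRN_diff s0 st.
rewrite ger0_norm ?subr_ge0 ?ler_expR ?lerN2 // distrC ger0_norm ?subr_ge0 //.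
Qed.

Lemma shear_flow_lipschitz (R : realType) n (i j : 'I_n) (c : R[i]) (z : 'rV[R[i]]_n) :
  locally_lipschitz_pos (shear_flow i j c z).
Proof.
move=> t t0; exists 1, (n%:R * (vnorm z + cmod (c * z 0 j ^+ 2))); split=> // s1 s2 s10 s20 _ _.
apply: le_trans (enorm_le_vnorm _) _; rewrite -mulrA ler_wpM2l //.
have := expRN_lipschitz s10 s20; rewrite /shear_flow.
have E1 : 0 <= expR (- s1) <= 1 by rewrite expR_ge0 -expR0 ler_expR oppr_le0.
have E2 : 0 <= expR (- s2) <= 1 by rewrite expR_ge0 -expR0 ler_expR oppr_le0.
move: (expR (- s1)) (expR (- s2)) E1 E2 `|s1 - s2| => x y /andP[x0 x1] /andP[y0 y1] r xyr.
set C := c * _.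
have -> : x%:C *: z + ((x - x ^+ 2)%:C * C) *: delta_mx 0 i - (y%:C *: z + ((y - y ^+ 2)%:C * C) *: delta_mx 0 i)
   = (x - y)%:C *: z + ((x - y) * (1 - (x + y)))%:C * C *: delta_mx 0 i.
  apply/rowP => k; rewrite !mxE !(rmorphB, rmorphD, rmorphM, rmorphXn) /= rmorph1; ring.
apply: le_trans (vnormD _ _) _; rewrite vnormZ cmodR.
apply: le_trans (lerD (lexx _) (vnormZ_delta _ _)) _; rewrite cmodM cmodR normrM.
have h : `|1 - (x + y)| <= 1 by rewrite ler_norml; lra.
rewrite mulrC [leRHS]mulrDl; apply: lerD; first by rewrite ler_wpM2l ?vnorm_ge0.
rewrite [leRHS]mulrC ler_wpM2r //; apply: le_trans xyr; rewrite ler_piMr //.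
Qed.

Lemma cvg_of_rdif (R : realType) n (u : R -> 'rV[R[i]]_n) (l : 'rV[R[i]]_n) t :
  (forall k, rdif (fun s => u s 0 k) t (l 0 k)) ->
  (r^-1)%:C *: (u (t + r) - u t) @[r --> (0 : R)^'] --> l.
Proof.
move=> ul; apply/cvgrPdist_le => e e0.
have er : e = (Re e)%:C by move: e0; rewrite ltcE; case: (e) => a b /= /andP[/eqP ->].
have re0 : 0 < Re e by move: e0; rewrite er ltcR.
have H : \forall r \near (0 : R)^', forall k, cmod ((l - (r^-1)%:C *: (u (t + r) - u t)) 0 k) <= Re e.
  apply: filter_forall => k; have [d d0 h] := ul k _ re0.
  apply/nbhs_ballP; exists d => // r; rewrite -ball_normE /= sub0r normrN => rd r0.
  have := h (t + r); rewrite addrAC subrr add0r => /(_ rd) h1.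
  have p : 0 < `|r| by rewrite normr_gt0.
  rewrite -(ler_pM2r p); apply: le_trans h1.
  rewrite -(cmodR r) -cmodM -cmodN; rewrite le_eqVlt; apply/orP; left; apply/eqP; congr cmod; rewrite !mxE.
  by rewrite fmorphV /=; field; rewrite -cmod_gt0 cmodR.
apply: filterS H => r Hr; rewrite er vnormE lecR; apply: vnorm_le => //; exact: ltW.
Qed.

Lemma rdif_expRN (R : realType) (t : R) : rdif (fun s => (expR (- s))%:C) t (- (expR (- t))%:C).
Proof.
have d : is_derive t 1 (fun s : R => expR (- s)) (- expR (- t)).
  have h : is_derive t 1 (fun s : R => - s) (-1) by apply: is_deriveN.
  have := @is_derive1_comp _ expR (fun s : R => - s) t _ _ (is_derive_expR (- t)) h.
  by rewrite mulrN1.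
rewrite (_ : - (expR (- t))%:C = Complex (- expR (- t)) 0); first exact: rdif_of_derive.
by apply: complex_ext; rewrite ?ReN ?ImN /= ?oppr0.
Qed.

Lemma shear_flow_solution (R : realType) n (i j : 'I_n) (c : R[i]) (z : 'rV[R[i]]_n) : i != j ->
  cmod c <= 3 * Num.sqrt 3 / 2 -> eball n z ->
  loewner_solution (fun z _ => shear i j (- c) z) z (shear_flow i j c z).
Proof.
move=> ij cs zb; split.
- by move=> t; exact: shear_flow_ball.
- exact: shear_flow_lipschitz.
- by rewrite /shear_flow oppr0 expR0 expr1n subrr mul0r scale0r addr0 scale1r.
apply: aeW => t t0; apply: cvg_of_rdif => k.
have dE := rdif_expRN t; have dE2 := rdifM dE dE.
pose d : R[i] := (delta_mx 0 i : 'rV[R[i]]_n) 0 k.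
have := rdifD (rdifZ (z 0 k) dE) (rdifZ (c * z 0 j ^+ 2 * d) (rdifB dE dE2)).
have flowE s m : shear_flow i j c z s 0 m = (expR (- s))%:C * z 0 m
   + ((expR (- s))%:C - (expR (- s))%:C * (expR (- s))%:C) * (c * z 0 j ^+ 2) * (delta_mx 0 i : 'rV[R[i]]_n) 0 m.
  by rewrite /shear_flow !mxE rmorphB rmorphXn.
have dj : (delta_mx 0 i : 'rV[R[i]]_n) 0 j = 0 by rewrite mxE eq_sym (negbTE ij) andbF.
move=> /rdif_ext; move=> /(_ (fun s => shear_flow i j c z s 0 k) 1 ltr01 _) H.
have -> : (- shear i j (- c) (shear_flow i j c z t)) 0 k =
   - (shear_flow i j c z t 0 k + - c * shear_flow i j c z t 0 j ^+ 2 * d).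
  by rewrite /shear /d !mxE.
rewrite !flowE dj mulr0 addr0 -/d.
set E := (expR (- t))%:C in H *.
rewrite [X in rdif _ _ X](_ : _ = z 0 k * - E + c * z 0 j ^+ 2 * d * (- E - (- E * E + E * - E))); last by ring.
by apply: H => s _; rewrite flowE -/d; ring.
Qed.

Lemma const_measurable_on_pos (R : realType) n (x : 'rV[R[i]]_n) :
  Lebesgue_measurable_on_pos (fun _ : R => x).
Proof.
move=> U _; have [Ux|Ux] := pselect (U x); last first.
  by rewrite (_ : _ `&` _ = set0) ?measurable0 //; apply/seteqP; split => [y [_ /Ux]|].
rewrite (_ : _ `&` _ = `[0, +oo[%classic); last first.
  by apply/seteqP; split => [y []|y].
rewrite g_sigma_completed_algebra_genE.
by exists `[0, +oo[%classic => //; exists set0; rewrite ?setU0 //; exact: negligible_set0.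
Qed.

(** The field is [shear i j (- c)] at every time. The rescaled flow misses its limit by
    [e^(-t) c z_j^2 e_i], which is small uniformly on the whole ball. As [d1] is at most [1], the
    invariance of the ball is only needed up to [3 sqrt 3 / 2]. *)
Lemma shear_parametric (R : realType) n (alpha : R) (i j : 'I_n) (c : R[i]) : i != j ->
  0 <= alpha < 1 -> cmod c <= 3 * Num.sqrt 3 / 2 * d1 alpha ->
  Salpha0 n alpha (shear i j c).
Proof.
move=> ij al cd; split; [exact: shear_hol|exact: shear_normalized|].
have [hMg hM] := @shear_classMg R n alpha i j (- c) ij al (eq_ind_r (fun x => x <= _) cd (cmodN c)).
have cs : cmod c <= 3 * Num.sqrt 3 / 2.
  apply: le_trans cd _; rewrite ler_piMr ?d1_le1 // divr_ge0 // mulr_ge0 // sqrtr_ge0 //.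
exists (fun z _ => shear i j (- c) z), (shear_flow i j c); split.
- by split => [t _|z _]; [exact: hM|exact: const_measurable_on_pos].
- by apply: aeW => t _.
- by move=> z zb; exact: shear_flow_solution.
apply: family_cvg_intro => A e [_ Ab] e0.
have er : e = (Re e)%:C by move: e0; rewrite ltcE; case: (e) => a b /= /andP[/eqP ->].
have re0 : 0 < Re e by move: e0; rewrite er ltcR.
have : \forall t \near +oo, (cmod c + 1) / Re e < t by apply: nbhs_pinfty_gt; exact: num_real.
apply: filterS => t; rewrite ltr_pdivrMr // => te y /Ab yb.
have p := expR_gt0 t; have pn : (expR t)%:C != 0 :> R[i] by rewrite -cmod_gt0 cmodR gtr0_norm.
have -> : shear i j c y - (expR t)%:C *: shear_flow i j c y t
     = ((expR (- t))%:C * (c * y 0 j ^+ 2)) *: delta_mx 0 i.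
  rewrite /shear /shear_flow expRN; apply/rowP => k; rewrite !mxE rmorphB rmorphXn fmorphV /=.
  by field.
rewrite vnormE er ltcR; apply: le_lt_trans (vnormZ_delta _ _) _.
rewrite !cmodM cmodR ger0_norm ?expR_ge0 // expRN mulrC ltr_pdivrMr // -expr2.
have y1 : cmod (y 0 j) ^+ 2 <= 1 by rewrite expr_le1 // (le_trans (cmod_enorm y j)) // ltW.
have := ler_wpM2l (cmod_ge0 c) y1; have := expR_ge1Dx t.
have := mulr_ge0 (cmod_ge0 c) (sqr_ge0 (cmod (y 0 j))).
move=> _ h1 h2; have : Re e * t <= Re e * expR t by rewrite ler_pM2l //; lra.
clear -te h2; lra.
Qed.

(** * The coefficient functional and support points *)

Lemma hol_coef2 (R : realType) n (f : 'rV[R[i]]_n -> 'rV[R[i]]_n) (i j : 'I_n) : hol n f ->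
  (forall w, cmod w < 1 ->
     cdif (fun w => f (w *: delta_mx 0 j) 0 i) w ('d f (w *: delta_mx 0 j) (delta_mx 0 j) 0 i)) /\
  cdif (fun w => 'd f (w *: delta_mx 0 j) (delta_mx 0 j) 0 i) 0 (2 * coef2 i j f).
Proof.
move=> hf.
have df w : cmod w < 1 -> differentiable f (w *: delta_mx 0 j).
  by move=> w1; apply: hol_differentiable => //; rewrite enormZ enorm_delta mulr1.
have dF w : cmod w < 1 -> cdif (fun w => f (w *: delta_mx 0 j) 0 i) w ('d f (w *: delta_mx 0 j) (delta_mx 0 j) 0 i).
  move=> w1; have := @cdif_line _ _ _ f 0 (delta_mx 0 j) i w; rewrite add0r => /(_ (df w w1)).
  by apply: cdif_ext ltr01 _ => v _; rewrite add0r.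
split=> //.
have [l dl] := @cdif_derivative R _ _ 0 1 ltr01 (fun z z1 => dF z (eq_ind _ (fun x => cmod x < 1) z1 _ (subr0 z))).
suff : 2 * coef2 i j f = l by move=> ->.
rewrite /coef2 mulrA mulfV ?pnatr_eq0 // mul1r; apply: derive_cdif.
apply: (cdif_ext ltr01 _ dl) => w; rewrite subr0 add0r => w1; apply/esym/derive_cdif.
have := @cdif_line _ _ _ f (w *: delta_mx 0 j) (delta_mx 0 j) i 0.
by rewrite scale0r addr0; apply; exact: df.
Qed.

(** Two Cauchy estimates with radius [1/4], each costing a factor [16], bound [2 * coef2] by
    [256 M]. *)
Lemma coef2_cauchy (R : realType) n (f : 'rV[R[i]]_n -> 'rV[R[i]]_n) (i j : 'I_n) (M : R) : hol n f ->
  (forall w : R[i], cmod w < 2^-1 -> cmod (f (w *: delta_mx 0 j) 0 i) <= M) ->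
  cmod (coef2 i j f) <= 128 * M.
Proof.
move=> hf fM; have [dF dF1] := hol_coef2 i j hf.
have r4 : 0 < 4^-1 :> R by rewrite invr_gt0.
have nearw (w z : R[i]) : cmod (w - 0) < 4^-1 -> cmod (z - w) < 4^-1 -> cmod z < 2^-1.
  rewrite subr0; have := cmodD (z - w) w; rewrite subrK; lra.
have near1 (z : R[i]) : cmod z < 2^-1 -> cmod z < 1 by lra.
have F1M w : cmod (w - 0) < 4^-1 -> cmod ('d f (w *: delta_mx 0 j) (delta_mx 0 j) 0 i) <= 4 * M / 4^-1.
  move=> w4; apply: (@cauchy_estimate _ _ w _ _ _ r4) (dF w _).
  - by move=> z zw; eexists; apply: dF; apply: near1; exact: nearw zw.
  - by move=> z zw; apply: fM; exact: nearw zw.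
  - by apply: near1; apply: nearw w4 _; rewrite subrr cmod0.
have := @cauchy_estimate _ _ 0 _ _ _ r4 _ F1M dF1.
have H : forall z : R[i], cmod (z - 0) < 4^-1 -> exists l, cdif (fun w => 'd f (w *: delta_mx 0 j) (delta_mx 0 j) 0 i) z l.
  move=> z z4; apply: (@cdif_derivative R (fun w => f (w *: delta_mx 0 j) 0 i) _ z _ r4) => w wz.
  by apply: dF; apply: near1; exact: nearw wz.
have c2 : cmod (2 : R[i]) = 2.
  by rewrite (_ : (2 : R[i]) = 2%:C) ?cmodR ?ger0_norm ?rmorph_nat.
move=> /(_ H); rewrite cmodM c2 invrK; lra.
Qed.

Lemma differentiable_combination (K : numFieldType) (V W : normedModType K) a (f g : V -> W) x :
  differentiable f x -> differentiable g x -> differentiable (a *: f + g) x.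
Proof. by move=> df dg; apply: differentiableD dg; exact: differentiableZ. Qed.

Lemma hol_combination (R : realType) n a (f g : 'rV[R[i]]_n -> 'rV[R[i]]_n) :
  hol n f -> hol n g -> hol n (a *: f + g).
Proof. by move=> hf hg z zb; apply: differentiable_combination; [exact: hf|exact: hg]. Qed.

Lemma coef2_combination (R : realType) n a (f g : 'rV[R[i]]_n -> 'rV[R[i]]_n) (i j : 'I_n) :
  hol n f -> hol n g -> coef2 i j (a *: f + g) = a * coef2 i j f + coef2 i j g.
Proof.
move=> hf hg; have [df df2] := hol_coef2 i j hf; have [dg dg2] := hol_coef2 i j hg.
have [d d2] := hol_coef2 i j (hol_combination a hf hg).
have two : (2 : R[i]) != 0 by rewrite pnatr_eq0.
apply: (mulfI two); apply: cdif_unique d2 _.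
rewrite mulrDr mulrCA; apply: (cdif_ext ltr01 _ (cdifD (cdifZ a df2) dg2)) => w.
rewrite subr0 => w1; apply: cdif_unique (d w w1).
by apply: (cdif_ext ltr01 _ (cdifD (cdifZ a (df w w1)) (dg w w1))) => v _; rewrite !mxE.
Qed.

Lemma coef2_shear (R : realType) n (i j : 'I_n) (c : R[i]) : i != j -> coef2 i j (shear i j c) = c.
Proof.
move=> ij; have [d d2] := hol_coef2 i j (@shear_hol R n i j c).
have two : (2 : R[i]) != 0 by rewrite pnatr_eq0.
apply: (mulfI two); apply: cdif_unique d2 _.
have := cdifZ (2 * c) (cdif_id (0 : R[i])); rewrite mulr1.
apply: (cdif_ext ltr01) => w; rewrite subr0 => w1; apply: cdif_unique (d w w1).
have := cdifZ c (cdifM (cdif_id w) (cdif_id w)); rewrite (_ : c * _ = 2 * c * id w); last by rewrite /=; ring.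
apply: (cdif_ext ltr01) => v _.
by rewrite /shear !mxE !eqxx (negbTE ij) /= mulr0n mulr0 add0r !mulr1.
Qed.

(** The compact set that [coef2_cauchy] calls for. A closed square around the disc is taken because
    it is a product of segments; its corners have modulus [sqrt 2 / 2], so it stays in the ball. *)
Lemma axis_square_compact (R : realType) n (j : 'I_n) :
  exists2 K : set 'rV[R[i]]_n, ball_compact n K &
    forall w : R[i], cmod w < 2^-1 -> K (w *: delta_mx 0 j).
Proof.
pose g (p : R * R) : 'rV[R[i]]_n := Complex p.1 p.2 *: delta_mx 0 j.
pose I : set R := `[- 2^-1, 2^-1]%classic.
have gB p q : g p - g q = Complex (p.1 - q.1) (p.2 - q.2) *: delta_mx 0 j.
  by rewrite /g -scalerBl; congr (_ *: _).
have cg : continuous g.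
  move=> p; apply/cvgrPdist_le => e e0.
  have er : e = (Re e)%:C by move: e0; rewrite ltcE; case: (e) => a b /= /andP[/eqP ->].
  have re0 : 0 < Re e by move: e0; rewrite er ltcR.
  have near (x : R) : nbhs x [set y | `|x - y| < Re e / 2].
    apply/nbhs_ballP; exists (Re e / 2); first by rewrite /= divr_gt0.
    by move=> y; rewrite -ball_normE.
  exists ([set y | `|p.1 - y| < Re e / 2], [set y | `|p.2 - y| < Re e / 2]).
    by split; exact: near.
  move=> q [/= h1 h2].
  rewrite vnormE er lecR gB; apply: le_trans (vnormZ_delta _ _) _.
  apply: le_trans (cmod_le_ReIm _) _; rewrite /=; lra.
exists (g @` (I `*` I)); last first.
  move=> w w2; exists (Re w, Im w); last by congr (_ *: _); exact: complex_ext.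
  split; rewrite /I /= in_itv /= -ler_norml; apply: ltW; apply: le_lt_trans w2; [exact: norm_Re|exact: norm_Im].
split.
  apply: continuous_compact; first exact: continuous_subspaceT.
  by apply: compact_setX; exact: segment_compact.
move=> _ [[x y] [hx hy] <-]; rewrite /eball /= /g enormZ enorm_delta mulr1.
move: hx hy; rewrite /I /= !in_itv /= => /andP[x1 x2] /andP[y1 y2].
rewrite -(@ltr_pXn2r _ 2) ?nnegrE // cmod_sqr /= expr1n.
have := mulr_ge0 (_ : 0 <= 2^-1 - x) (_ : 0 <= x + 2^-1); have := mulr_ge0 (_ : 0 <= 2^-1 - y) (_ : 0 <= y + 2^-1).
rewrite !expr2; lra.
Qed.

Lemma coef2_functional (R : realType) n (i j : 'I_n) (a : R[i]) :
  continuous_functional (fun f : 'rV[R[i]]_n -> 'rV[R[i]]_n => a * coef2 i j f).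
Proof.
split; first by move=> b f g hf hg; rewrite (coef2_combination b i j hf hg) mulrDr mulrCA.
have [K Kb Kw] := axis_square_compact R j.
apply/subspace_continuousP => f hf; apply/cvgrPdist_le => e e0.
have er : e = (Re e)%:C by move: e0; rewrite ltcE; case: (e) => x y /= /andP[/eqP ->].
have re0 : 0 < Re e by move: e0; rewrite er ltcR.
have a0 : 0 < cmod a + 1 by rewrite ltr_wpDl.
pose d : R := Re e / (cmod a + 1) / 128.
have d0 : 0 < d%:C by rewrite ltcR !divr_gt0.
apply: filterS (family_nbhs f d0 Kb) => g Hg hg.
rewrite er normrC lecR -mulrBr cmodM.
have -> : coef2 i j f - coef2 i j g = coef2 i j (-1 *: g + f).
  by rewrite coef2_combination // mulN1r addrC.
have H : cmod (coef2 i j (-1 *: g + f)) <= 128 * d.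
  apply: coef2_cauchy; first exact: hol_combination.
  move=> w w2; have := Hg _ (Kw w w2); rewrite vnormE ltcR => h.
  apply: le_trans (ltW h); apply: le_trans (cmod_vnorm _ i).
  by rewrite !mxE mulN1r addrC.
apply: le_trans (ler_wpM2l (cmod_ge0 a) H) _.
have -> : 128 * d = Re e / (cmod a + 1) by rewrite /d mulrC divfK // pnatr_eq0.
rewrite mulrA ler_pdivrMr // mulrC ler_wpM2l ?lerDl //; exact: ltW.
Qed.

Lemma shear_bounded (R : realType) n (i j : 'I_n) (c : R[i]) : bounded_on_ball (shear i j c).
Proof.
exists (n%:R * (1 + cmod c)) => z zb; apply: le_trans (enorm_le_vnorm _) _.
rewrite ler_wpM2l //; apply: le_trans (vnormD _ _) _; apply: lerD.
  by apply: le_trans (vnorm_le_enorm z) _; exact: ltW.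
apply: le_trans (vnormZ_delta _ _) _; rewrite cmodM cmodX ler_piMr //.
by rewrite expr_le1 // (le_trans (cmod_enorm z j)) // ltW.
Qed.

Lemma cmod_signM (R : realType) (b : bool) (s : R) : 0 <= s -> cmod ((-1) ^+ b * s%:C) = s.
Proof. by move=> s0; rewrite cmodM cmodX cmodN cmod1 expr1n mul1r cmodR ger0_norm. Qed.

(** The functional is the coefficient times the sign of the shear. It equals [s] at this shear, the
    largest value that the coefficient bound allows, and [- s] at the opposite shear, so its real
    part is not constant on [E]. *)
Lemma shear_support_point (R : realType) n (E : set ('rV[R[i]]_n -> 'rV[R[i]]_n)) (i j : 'I_n)
    (s : R) (neg : bool) : i != j -> 0 < s ->
  (forall f, E f -> cmod (coef2 i j f) <= s) ->
  (forall b : bool, E (shear i j ((-1) ^+ b * s%:C))) ->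
  bounded_support_point E (shear i j ((-1) ^+ neg * s%:C)).
Proof.
move=> ij s0 Es Esh; split; last exact: shear_bounded.
split=> //; exists (fun f => (-1) ^+ neg * coef2 i j f).
have sgn2 : (-1) ^+ neg * ((-1) ^+ neg * s%:C) = s%:C :> R[i] by rewrite mulrA -expr2 sqrr_sign mul1r.
split; first exact: coef2_functional.
  move=> [r Hr]; have h1 := Hr _ (Esh neg); have h2 := Hr _ (Esh (~~ neg)).
  move: h1 h2; rewrite !coef2_shear // sgn2 signrN mulNr mulrN sgn2 ReN /=; lra.
move=> f Ef; rewrite coef2_shear // sgn2 /=.
apply: le_trans (Re_le _) _; rewrite cmodM cmodX cmodN cmod1 expr1n mul1r; exact: Es.
Qed.

Unset Implicit Arguments.

Theorem corollary5p5 (R : realType) (n : nat) (alpha : R)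
    (hn : (2 <= n)%N) (halpha : 0 <= alpha < 1) :
  [/\ forall i j : 'I_n, i != j ->
        (forall f, Salpha0 n alpha f ->
           `| 2^-1 * 'D_(delta_mx 0 j) ('D_(delta_mx 0 j)
                        (fun z : 'rV[R[i]]_n => f z 0 i)) 0 |
             <= (3 * Num.sqrt 3 / 2 * d1 alpha)%:C) /\
        (exists2 f, Salpha0 n alpha f &
           `| 2^-1 * 'D_(delta_mx 0 j) ('D_(delta_mx 0 j)
                        (fun z : 'rV[R[i]]_n => f z 0 i)) 0 |
             = (3 * Num.sqrt 3 / 2 * d1 alpha)%:C),
      forall (neg : bool) (i j : 'I_n), i != j ->
        Salpha_star n alpha (Phi alpha neg i j) /\
        Salpha0 n alpha (Phi alpha neg i j) &
      forall (neg : bool) (i j : 'I_n), i != j ->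
        bounded_support_point (Salpha0 n alpha) (Phi alpha neg i j) /\
        bounded_support_point (Salpha_star n alpha) (Phi alpha neg i j)].
Proof.
set s := 3 * Num.sqrt 3 / 2 * d1 alpha.
have s0 : 0 < s by rewrite mulr_gt0 ?d1_gt0 // divr_gt0 // mulr_gt0 // sqrtr_gt0.
have PhiE neg (i j : 'I_n) : Phi alpha neg i j = shear i j ((-1) ^+ neg * s%:C) by [].
have sgn (neg : bool) : cmod ((-1) ^+ neg * s%:C) <= s by rewrite cmod_signM // ltW.
have star neg (i j : 'I_n) : i != j -> Salpha_star n alpha (Phi alpha neg i j).
  by move=> ij; rewrite PhiE; exact: shear_starlike ij halpha (sgn neg).
have par neg (i j : 'I_n) : i != j -> Salpha0 n alpha (Phi alpha neg i j).
  by move=> ij; rewrite PhiE; exact: shear_parametric ij halpha (sgn neg).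
split => [i j ij|neg i j ij|neg i j ij].
- split => [f Sf|].
    by rewrite normrC lecR; exact: parametric_coef2_le ij halpha Sf.
  exists (Phi alpha false i j); first exact: par.
  rewrite normrC; congr (_%:C).
  by rewrite -[X in cmod X]/(coef2 i j _) PhiE coef2_shear // cmod_signM // ltW.
- by split; [exact: star|exact: par].
- rewrite PhiE; split; apply: (shear_support_point neg ij s0).
  + by move=> f; exact: parametric_coef2_le.
  + by move=> b; exact: par.
  + by move=> f; exact: starlike_coef2_le.
  + by move=> b; exact: star.
Qed.
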